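(* Assume that $\phi\in C^1\big(X,\mathrm U(2)\big)$ and that $T_\phi$ is uniquely ergodic. Then, for each $\ell\in\mathbb N$, $m\in\mathbb Z$ and $j\in\{0,\ldots,\ell\}$, $$\lim_{N\to\infty}\big\langle\varphi,\big(U_{\phi,\pi^{(\ell,m)},j}\big)^N\psi\big\rangle=0\quad\hbox{for each }\varphi\in\ker(D_{\phi,\ell,m})^\perp\hbox{ and }\psi\in\mathcal H^{(\pi^{(\ell,m)})}_j,$$ with $$\ker(D_{\phi,\ell,m})^\perp=\begin{cases}\mathcal H^{(\pi^{(\ell,m)})}_j&\hbox{if }s_\phi(2m-\ell)\ne0,\\\{0\}&\hbox{if }s_\phi(2m-\ell)=0.\end{cases}$$ In particular, if $s_\phi\ne0$, then $U_\phi$ is mixing in the subspace $$\mathcal H_{\rm mix}:=\bigoplus_{m\in\mathbb Z}\ \bigoplus_{\ell\in\mathbb N\setminus\{2m\}}\ \bigoplus_{j\in\{0,\ldots,\ell\}}\mathcal H^{(\pi^{(\ell,m)})}_j\subset\mathcal H.$$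
   Context: Setting. $X$ is a smooth compact second countable Hausdorff manifold with Borel probability measure $\mu_X$, $\{F_t\}_{t\in\mathbb R}$ a $C^1$ flow on $X$ preserving $\mu_X$ with continuous vector field $Y$, $\mathcal L_Yf(x)=\frac d{dt}|_{t=0}f(F_t(x))$. $\mathbb N=\{0,1,2,\dots\}$, $\mathbb T=\{z\in\mathbb C:|z|=1\}$. $\mu$ is the normalised Haar measure of $\mathrm U(2)$, $\mathcal H:=L^2(X\times\mathrm U(2),\mu_X\otimes\mu)$, $T_\phi(x,g)=(F_1(x),g\phi(x))$, and $U_\phi\psi=\psi\circ T_\phi$ is the (unitary) Koopman operator. ''$T_\phi$ uniquely ergodic'' means that $\mu_X\otimes\mu$ is the only $T_\phi$-invariant Borel probability measure. ''$U_\phi$ is mixing in a closed subspace $\mathcal K$'' means $\langle\varphi,U_\phi^N\psi\rangle\to0$ as $N\to\infty$ for all $\varphi\in\mathcal K$, $\psi\in\mathcal H$. Degree. $M_\phi:=(\mathcal L_Y\phi)\phi^{-1}:X\to\mathfrak u(2)$. If $T_\phi$ is uniquely ergodic, then $M_{\phi,\star}:=\int_{X\times\mathrm U(2)}d(\mu_X\otimes\mu)(x,g)\,gM_\phi(x)g^{-1}$ belongs to the center $\{isI_2:s\in\mathbb R\}$ of $\mathfrak u(2)$, and $s_\phi\in\mathbb R$ is defined by $M_{\phi,\star}=is_\phi I_2$. Representations. For $\ell\in\mathbb N$, $V_\ell$ is the space of homogeneous polynomials of degree $\ell$ in $\omega_1,\omega_2\in\mathbb C$, with basis $p_j(\omega_1,\omega_2)=\omega_1^j\omega_2^{\ell-j}$,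 $j\in\{0,\ldots,\ell\}$, and scalar product $\langle\sum_j\alpha_jp_j,\sum_k\beta_kp_k\rangle_{V_\ell}=\sum_{j=0}^\ell j!(\ell-j)!\,\alpha_j\overline{\beta_j}$; $(\pi^{(\ell)}(g)p)(\omega_1,\omega_2)=p((\omega_1,\omega_2)g)$ is an irreducible unitary representation of $\mathrm{SU}(2)$ on $V_\ell$, with $\pi^{(\ell)}_{jk}(g):=\langle\pi^{(\ell)}(g)p_k,p_j\rangle_{V_\ell}$. Up to equivalence the finite-dimensional irreducible unitary representations of $\mathrm U(2)$ are the $\pi^{(\ell,m)}$, $\ell\in\mathbb N$, $m\in\mathbb Z$, given by $\pi^{(\ell,m)}(zg):=z^{2m-\ell}\pi^{(\ell)}(g)$ for $z\in\mathbb T$, $g\in\mathrm{SU}(2)$, with matrix elements $\pi^{(\ell,m)}_{jk}(zg)=z^{2m-\ell}\pi^{(\ell)}_{jk}(g)$. $\mathcal H^{(\pi^{(\ell,m)})}_j:=\bigoplus_{k=0}^\ell L^2(X,\mu_X)\otimes\{\pi^{(\ell,m)}_{jk}\}$ reduces $U_\phi$, and $U_{\phi,\pi^{(\ell,m)},j}$ is the restriction of $U_\phi$ to it. Operator $D_{\phi,\ell,m}$. $H$ is the self-adjoint operator in $L^2(X,\mu_X)$ given by $H\varphi=\lim_{t\to0}it^{-1}(\varphi\circ F_t-\varphi)$; $A\sum_k\varphi_k\otimes\pi^{(\ell,m)}_{jk}:=\sum_kH\varphi_k\otimes\pi^{(\ell,m)}_{jk}$ on $\bigoplus_k\mathcal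 D(H)\otimes\{\pi^{(\ell,m)}_{jk}\}$, self-adjoint in $\mathcal H^{(\pi^{(\ell,m)})}_j$; $D_{\phi,\ell,m}:=\mathrm{s\text{-}lim}_{N\to\infty}\frac1N[A,(U_{\phi,\pi^{(\ell,m)},j})^N](U_{\phi,\pi^{(\ell,m)},j})^{-N}$ (this limit exists since $\phi\in C^1$), where for a bounded operator $S$, $[A,S]$ is the bounded operator associated with the continuous extension of the form $\varphi\mapsto\langle A\varphi,S\varphi\rangle-\langle\varphi,SA\varphi\rangle$ on $\mathcal D(A)$. *)

(* Defs.v *)
From HB Require Import structures.
From mathcomp Require Import all_boot all_order all_algebra.
From mathcomp Require Import all_classical all_reals all_analysis.
From mathcomp Require Import complex ring.
Set Implicit Arguments.
Unset Strict Implicit.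
Unset Printing Implicit Defensive.

Import Order.TTheory GRing.Theory Num.Theory.
Import numFieldNormedType.Exports.

Local Open Scope classical_set_scope.
Local Open Scope ring_scope.
Local Open Scope complex_scope.

#[non_forgetful_inheritance]
HB.instance Definition _ (R : realType) := PseudoPointedMetric.copy R[i] R[i]^o.
#[non_forgetful_inheritance]
HB.instance Definition _ (R : realType) := NormedModule.copy R[i] R[i]^o.

(** * Manifolds and flows *)

(* [Ck k U f]: f is of class C^k on the open set U.  In finite dimension,
   continuity of x |-> 'D_v f x for every fixed v is continuity of the
   differential. *)
Fixpoint Ck (R : realType) (V W : normedModType R) (k : nat) (U : set V)
    (f : V -> W) : Prop :=
  match k with
  | 0 => forall x, U x -> {for x, continuous f}
  | k'.+1 => (forall x, U x -> differentiable f x) /\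
             (forall v : V, Ck k' U (fun x => 'D_v f x : W))
  end.

(* Total functions; only [chart_map] on [chart_dom] and [chart_inv] on
   [chart_img] are meaningful. *)
Record chart (R : realType) (n : nat) (X : topologicalType) := Chart {
  chart_dom : set X;
  chart_map : X -> 'rV[R]_n;
  chart_inv : 'rV[R]_n -> X }.

Definition chart_img (R : realType) (n : nat) (X : topologicalType)
  (c : chart R n X) : set 'rV[R]_n := chart_map c @` chart_dom c.

Record is_chart (R : realType) (n : nat) (X : topologicalType)
    (c : chart R n X) : Prop := IsChart {
  chart_dom_open : open (chart_dom c);
  chart_img_open : open (chart_img c);
  chart_mapK : forall x, chart_dom c x -> chart_inv c (chart_map c x) = x;
  chart_map_cont :
    forall x, chart_dom c x -> {for x, continuous (chart_map c)};
  chart_inv_cont :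
    forall u, chart_img c u -> {for u, continuous (chart_inv c)} }.

Record smooth_atlas (R : realType) (n : nat) (X : topologicalType)
    (atl : set (chart R n X)) : Prop := SmoothAtlas {
  atlas_chart : forall c, atl c -> is_chart c;
  atlas_cover : forall x, exists2 c, atl c & chart_dom c x;
  atlas_smooth : forall c d, atl c -> atl d -> forall k,
    Ck k (chart_map c @` (chart_dom c `&` chart_dom d))
         (chart_map d \o chart_inv c) }.

Record C1_flow (R : realType) (n : nat) (X : topologicalType)
    (atl : set (chart R n X)) (F : R -> X -> X) : Prop := C1Flow {
  flow0 : forall x, F 0 x = x;
  flowD : forall s t x, F (s + t) x = F s (F t x);
  flow_cont : continuous (fun p : R * X => F p.1 p.2);
  flow_C1 : forall c d, atl c -> atl d ->
    Ck 1 [set p : R * 'rV[R]_n |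
           chart_img c p.2 /\ chart_dom d (F p.1 (chart_inv c p.2))]
         (fun p => chart_map d (F p.1 (chart_inv c p.2))) }.

(** * The group U(2) *)

Record U2 (R : realType) := MkU2 {
  U2mx :> 'M[R[i]]_2;
  U2mx_unitary : U2mx \is unitarymx }.

HB.instance Definition _ (R : realType) := [isSub for @U2mx R].
HB.instance Definition _ (R : realType) := [Choice of U2 R by <:].


Fact U2_one_unitary (R : realType) : (1%:M : 'M[R[i]]_2) \is unitarymx.
Proof. by apply/unitarymxP; rewrite trmx1 map_mx1 mulmx1. Qed.

Fact U2_inv_unitary (R : realType) (g : U2 R) : invmx (U2mx g) \is unitarymx.
Proof. by rewrite invmx_unitary ?trmxC_unitary ?U2mx_unitary. Qed.

Definition U2_one (R : realType) : U2 R := MkU2 (U2_one_unitary R).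
Definition U2_mul (R : realType) (g h : U2 R) : U2 R :=
  MkU2 (mul_unitarymx (U2mx_unitary g) (U2mx_unitary h)).
Definition U2_inv (R : realType) (g : U2 R) : U2 R := MkU2 (U2_inv_unitary g).

Fact U2_mulA (R : realType) : associative (@U2_mul R).
Proof. by move=> g h k; apply: val_inj; rewrite /= mulmxA. Qed.
Fact U2_mul1 (R : realType) : left_id (U2_one R) (@U2_mul R).
Proof. by move=> g; apply: val_inj; rewrite /= mul1mx. Qed.
Fact U2_1mul (R : realType) : right_id (U2_one R) (@U2_mul R).
Proof. by move=> g; apply: val_inj; rewrite /= mulmx1. Qed.
Fact U2_mulV (R : realType) : left_inverse (U2_one R) (@U2_inv R) (@U2_mul R).
Proof.
by move=> g; apply: val_inj; rewrite /= mulVmx ?unitarymx_unit ?U2mx_unitary.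
Qed.
Fact U2_Vmul (R : realType) : right_inverse (U2_one R) (@U2_inv R) (@U2_mul R).
Proof.
by move=> g; apply: val_inj; rewrite /= mulmxV ?unitarymx_unit ?U2mx_unitary.
Qed.

HB.instance Definition _ (R : realType) := isGroup.Build (U2 R)
  (@U2_mulA R) (@U2_mul1 R) (@U2_1mul R) (@U2_mulV R) (@U2_Vmul R).
HB.instance Definition _ (R : realType) := isPointed.Build (U2 R) (U2_one R).
HB.instance Definition _ (R : realType) :=
  Topological.copy (U2 R) (initial_topology (@U2mx R)).

(* U(2) is an embedded submanifold of M_2(C) = R^8, so a map into U(2) is C^1
   iff the real and imaginary parts of its matrix entries are. *)
Definition C1_to_U2 (R : realType) (n : nat) (X : topologicalType)
    (atl : set (chart R n X)) (phi : X -> U2 R) : Prop :=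
  forall c, atl c -> forall a b : 'I_2,
    Ck 1 (chart_img c) (fun u => complex.Re (phi (chart_inv c u) a b)) /\
    Ck 1 (chart_img c) (fun u => complex.Im (phi (chart_inv c u) a b)).

(** * Measures *)

Notation borel X := (g_sigma_algebraType (@open X)).

Definition preserves_measure (d : measure_display) (T : measurableType d)
    (R : realType) (f : T -> T) (P : set T -> \bar R) : Prop :=
  forall A, measurable A -> P (f @^-1` A) = P A.

Definition uniquely_ergodic (d : measure_display) (T : measurableType d)
    (R : realType) (f : T -> T) (P : set T -> \bar R) : Prop :=
  preserves_measure f P /\
  forall Q : probability T R, preserves_measure f Q ->
    forall A, measurable A -> Q A = P A.

(* A compact group is unimodular: its Haar measure is bi-invariant. *)
Definition is_haar (R : realType) (mu : probability (borel (U2 R)) R) : Prop :=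
  forall g : U2 R, preserves_measure (fun h : borel (U2 R) => (g * h)%g) mu /\
                   preserves_measure (fun h : borel (U2 R) => (h * g)%g) mu.

(** * Complex L^2 spaces

   Vectors are represented by square-integrable functions; two functions
   represent the same vector when they are equal almost everywhere.  A closed
   subspace is represented by the set of all functions representing one of its
   vectors. *)

Section L2.
Context {R : realType} {d : measure_display} {T : measurableType d}.
Variable mu : {measure set T -> \bar R}.

Definition L2 : set (T -> R[i]) := [set f : _ -> R[i] |
  (@complex.Re R \o f) \in Lfun mu 2%:E /\
  (@complex.Im R \o f) \in Lfun mu 2%:E].

Definition cintegral (f : T -> R[i]) : R[i] :=
  Rintegral mu setT (@complex.Re R \o f) +i*
  Rintegral mu setT (@complex.Im R \o f).

Definition L2inner (f g : T -> R[i]) : R[i] :=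
  cintegral (fun x => f x * conjc (g x)).

Definition L2norm (f : T -> R[i]) : R := Num.sqrt (complex.Re (L2inner f f)).

Definition L2zero : set (T -> R[i]) :=
  [set f : _ -> R[i] | L2 f /\ ae_eq mu setT f 0].

Definition ortho_in (K S : set (T -> R[i])) : set (T -> R[i]) :=
  [set f : _ -> R[i] | K f /\ forall g, S g -> L2inner f g = 0].

Definition bounded_op (K : set (T -> R[i]))
    (B : (T -> R[i]) -> (T -> R[i])) : Prop :=
  [/\ forall f, K f -> K (B f),
      forall (a : R[i]) f g, K f -> K g ->
        ae_eq mu setT (B (fun x => a * f x + g x))
                      (fun x => a * B f x + B g x)
    & exists M : R, forall f, K f -> L2norm (B f) <= M * L2norm f].

Definition op_ker (K : set (T -> R[i])) (B : (T -> R[i]) -> (T -> R[i])) :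
    set (T -> R[i]) :=
  [set f : _ -> R[i] | K f /\ ae_eq mu setT (B f) 0].

(* [is_commutator K A S B]: B is the bounded operator on K associated with the
   continuous extension of the form f |-> <A f, S f> - <f, S A f> on D(A).
   The unbounded operator A is given by its graph. *)
Definition is_commutator (K : set (T -> R[i]))
    (A : (T -> R[i]) -> (T -> R[i]) -> Prop)
    (S B : (T -> R[i]) -> (T -> R[i])) : Prop :=
  bounded_op K B /\
  forall f h, A f h -> L2inner f (B f) = L2inner h (S f) - L2inner f (S h).

(* Hilbert sum of the pairwise orthogonal closed subspaces K i such that P i,
   as the closure of their algebraic sum. *)
Definition hilbert_sum (I : eqType) (P : set I) (K : I -> set (T -> R[i])) :
    set (T -> R[i]) :=
  [set f : _ -> R[i] | L2 f /\ forall e : R, 0 < e ->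
     exists (s : seq I) (g : I -> T -> R[i]),
       (forall i, i \in s -> P i /\ K i (g i)) /\
       L2norm (fun x => f x - \sum_(i <- s) g i x) < e].

End L2.

Definition koopman (R : realType) (T : Type) (S : T -> T) (f : T -> R[i]) :
  T -> R[i] := f \o S.

(** * Irreducible representations of U(2) *)

(* A polynomial function of (w_1, w_2) is a function of the row vector w. *)
Definition monom (R : realType) (l j : nat) (w : 'rV[R[i]]_2) : R[i] :=
  w 0 0 ^+ j * w 0 1 ^+ (l - j).

Definition hpoly (R : realType) (l : nat) (al : 'rV[R[i]]_l.+1)
  (w : 'rV[R[i]]_2) : R[i] := \sum_(j < l.+1) al 0 j * monom l j w.

(* The coefficients of p in V_l = range (hpoly l). *)
Definition hcoef (R : realType) (l : nat) (p : 'rV[R[i]]_2 -> R[i]) :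
  'rV[R[i]]_l.+1 := xget 0 [set al : 'rV[R[i]]_l.+1 | p = hpoly al].

Definition hinner (R : realType) (l : nat) (p q : 'rV[R[i]]_2 -> R[i]) : R[i] :=
  \sum_(j < l.+1)
    (j`! * (l - j)`!)%:R * hcoef l p 0 j * conjc (hcoef l q 0 j).

Definition poly_act (R : realType) (g : 'M[R[i]]_2) (p : 'rV[R[i]]_2 -> R[i]) :
  'rV[R[i]]_2 -> R[i] := fun w => p (w *m g).

Definition rep_elt (R : realType) (l : nat) (j k : 'I_l.+1) (g : 'M[R[i]]_2) :
  R[i] := hinner l (poly_act g (monom l k)) (monom l j).

(* The square root z of det u satisfies |z| = 1 and z^-1 u \in SU(2); the other
   choice -z gives the same value, see [U2_rep_eltE] below. *)
Definition U2_rep_elt (R : realType) (l : nat) (m : int) (j k : 'I_l.+1)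
    (u : U2 R) : R[i] :=
  let z := sqrtC (\det (U2mx u)) in
  z ^ (2 * m - l%:Z) * rep_elt j k (z^-1 *: U2mx u).

Lemma hpolyK (R : realType) (l : nat) (al : 'rV[R[i]]_l.+1) :
  hcoef l (hpoly al) = al.
Proof.
rewrite /hcoef; case: xgetP => [be _ /= E|/(_ al)]; last by case.
pose P (a : 'rV[R[i]]_l.+1) := \poly_(i < l.+1) a 0 (inord i).
have PE a x : (P a).[x] =
    hpoly a (\row_(i < 2) if i == 0 then x else 1).
  rewrite /P horner_poly /hpoly; apply: eq_bigr => i _.
  by rewrite /monom !mxE /= expr1n mulr1 inord_val.
suff PP : P be - P al = 0.
  apply/rowP => i; have /(congr1 (fun p : {poly R[i]} => p`_i)) := PP.
  by rewrite coefB !coef_poly ltn_ord inord_val coef0 => /eqP;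
     rewrite subr_eq0 => /eqP.
apply/eqP/negPn/negP => nz.
have := @max_poly_roots _ _ [seq i%:R | i <- iota 0 l.+2] nz.
have -> : all (root (P be - P al)) [seq i%:R | i <- iota 0 l.+2].
  apply/allP => _ /mapP[i _ ->].
  by rewrite /root hornerD hornerN !PE E subrr.
have -> : uniq [seq i%:R : R[i] | i <- iota 0 l.+2].
  by rewrite map_inj_uniq ?iota_uniq//; apply: mulrIn; exact: oner_neq0.
rewrite size_map size_iota => /(_ isT isT).
apply/negP; rewrite -leqNgt; apply: leqW.
apply: leq_trans (size_polyD _ _) _.
by rewrite size_polyN geq_max; apply/andP; split; exact: size_poly.
Qed.

Lemma hcoefZ (R : realType) (l : nat) (c : R[i]) (p : 'rV[R[i]]_2 -> R[i]) :
  c != 0 -> hcoef l (fun w => c * p w) = c *: hcoef l p.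
Proof.
have hZ (b : R[i]) (al : 'rV[R[i]]_l.+1) :
    (fun w => b * hpoly al w) = hpoly (b *: al).
  apply: funext => w; rewrite /hpoly mulr_sumr.
  by apply: eq_bigr => i _; rewrite [in RHS]mxE mulrA.
move=> c0; have [[al E]|nex] := pselect (exists al : 'rV[R[i]]_l.+1, p = hpoly al).
  by rewrite E hZ !hpolyK.
rewrite /hcoef; case: xgetP => [be _ /= E|_].
  exfalso; apply: nex; exists (c^-1 *: be); rewrite -hZ -E.
  by apply: funext => w; rewrite mulKf.
case: xgetP => [be _ /= E|_]; last by rewrite scaler0.
by exfalso; apply: nex; exists be.
Qed.

Lemma U2_rep_eltE (R : realType) (l : nat) (m : int) (j k : 'I_l.+1)
    (z : R[i]) (g : 'M[R[i]]_2) (u : U2 R) :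
  `|z| = 1 -> \det g = 1 -> U2mx u = z *: g ->
  U2_rep_elt m j k u = z ^ (2 * m - l%:Z) * rep_elt j k g.
Proof.
move=> z1 g1 uE; rewrite /U2_rep_elt uE detZ g1 mulr1.
have z0 : z != 0 by rewrite -normr_eq0 z1 oner_neq0.
have : (sqrtC (z ^+ 2)) ^+ 2 == z ^+ 2 by rewrite sqrtCK.
rewrite eqf_sqr => /orP[/eqP ->|/eqP ->].
  rewrite scalerA.
  rewrite (mulVf z0).
  rewrite scale1r.
  reflexivity.
rewrite scalerA.
rewrite invrN mulNr (mulVf z0).
rewrite scaleN1r.
have -> : rep_elt j k (- g) = (-1) ^+ l * rep_elt j k g.
  rewrite /rep_elt /hinner mulr_sumr.
  have -> : poly_act (- g) (monom l k) =
      (fun w => (-1) ^+ l * poly_act g (monom l k) w).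
    apply: funext => w; rewrite /poly_act mulmxN /monom !mxE.
    rewrite (exprNn _ k) (exprNn _ (l - k)) mulrACA -exprD subnKC//.
    by rewrite -ltnS.
  apply: eq_bigr => i _; rewrite hcoefZ ?expf_neq0 ?oppr_eq0 ?oner_neq0//.
  by rewrite mxE; ring.
have -> : (- z) ^ (2 * m - l%:Z) = (-1) ^+ l * z ^ (2 * m - l%:Z).
  rewrite -[- z]mulN1r expfzMl; congr (_ * _).
  rewrite expfzDr ?oppr_eq0 ?oner_neq0// -exprz_exp.
  have -> : (-1 : R[i]) ^ (2 : int) = 1 by rewrite -[LHS]/((-1) ^+ 2) sqrrN expr1n.
  by rewrite exp1rz mul1r -exprz_inv invrN invr1.
rewrite mulrACA -exprD addnn -mul2n exprM sqrrN expr1n expr1n mul1r.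
by [].
Qed.

(** * The skew product and its degree *)

Definition skew_product (R : realType) (X : Type) (F : R -> X -> X)
  (phi : X -> U2 R) (p : X * U2 R) : X * U2 R := (F 1 p.1, (p.2 * phi p.1)%g).

Definition skew_product_inv (R : realType) (X : Type) (F : R -> X -> X)
  (phi : X -> U2 R) (p : X * U2 R) : X * U2 R :=
  (F (- 1) p.1, (p.2 * (phi (F (- 1)%R p.1))^-1)%g).

Lemma skew_productK (R : realType) (n : nat) (X : topologicalType)
    (atl : set (chart R n X)) (F : R -> X -> X) (phi : X -> U2 R) :
  C1_flow atl F ->
  cancel (skew_product F phi) (skew_product_inv F phi) /\
  cancel (skew_product_inv F phi) (skew_product F phi).
Proof.
move=> [F0 FD _ _]; split=> -[x g]; rewrite /skew_product /skew_product_inv /=.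
  by rewrite -FD addNr F0 mulgK.
by rewrite -FD addrN F0 mulgVK.
Qed.

Definition lie_deriv (R : realType) (X : Type) (F : R -> X -> X)
  (f : X -> R[i]) (x : X) : R[i] :=
  derive1 (fun t => complex.Re (f (F t x))) 0 +i*
  derive1 (fun t => complex.Im (f (F t x))) 0.

Definition cocycle_deriv (R : realType) (X : Type) (F : R -> X -> X)
  (phi : X -> U2 R) (x : X) : 'M[R[i]]_2 :=
  (\matrix_(a, b) lie_deriv F (fun y => phi y a b) x) *m U2mx (phi x)^-1%g.

Definition degree_mx (R : realType) (X : ptopologicalType) (F : R -> X -> X)
    (muX : probability (borel X) R) (mu : probability (borel (U2 R)) R)
    (phi : X -> U2 R) : 'M[R[i]]_2 :=
  \matrix_(a, b) cintegral (muX \x mu)%E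
    (fun p : borel X * borel (U2 R) =>
       (U2mx p.2 *m cocycle_deriv F phi p.1 *m U2mx (p.2 : U2 R)^-1%g) a b).

(* The s such that degree_mx = i s I_2; it exists when the skew product is
   uniquely ergodic. *)
Definition degree (R : realType) (X : ptopologicalType) (F : R -> X -> X)
    (muX : probability (borel X) R) (mu : probability (borel (U2 R)) R)
    (phi : X -> U2 R) : R :=
  xget 0 [set s : R | degree_mx F muX mu phi = (0 +i* s)%:M].

(** * The subspaces H_j^(l,m) and the operators H, A and D *)

Section Operators.
Context {R : realType} {X : ptopologicalType}.
Variables (F : R -> X -> X) (muX : probability (borel X) R).
Variables (mu : probability (borel (U2 R)) R) (phi : X -> U2 R).

(* X and U(2) are second countable, so the product sigma-algebra is the Borel
   sigma-algebra of the product. *)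
Local Notation XU := (borel X * borel (U2 R))%type.

Definition haar_prod : {measure set XU -> \bar R} := (muX \x mu)%E.

Definition rep_sum (l : nat) (m : int) (j : 'I_l.+1)
    (u : 'I_l.+1 -> X -> R[i]) (p : XU) : R[i] :=
  \sum_(k < l.+1) u k p.1 * U2_rep_elt m j k p.2.

Definition rep_space (l : nat) (m : int) (j : 'I_l.+1) : set (XU -> R[i]) :=
  [set f : _ -> R[i] | L2 haar_prod f /\
     exists2 u : 'I_l.+1 -> borel X -> R[i], (forall k, L2 muX (u k)) &
       ae_eq haar_prod setT f (rep_sum m j u)].

Definition H_graph (f h : borel X -> R[i]) : Prop :=
  [/\ L2 muX f, L2 muX h &
   (fun t : R => L2norm muX
      (fun x => 'i * (t^-1)%:C * (f (F t x) - f x) - h x)) @ 0^' --> (0 : R)].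

Definition A_graph (l : nat) (m : int) (j : 'I_l.+1) (f h : XU -> R[i]) :
    Prop :=
  rep_space m j f /\ rep_space m j h /\
  exists u v : 'I_l.+1 -> borel X -> R[i],
    [/\ forall k, H_graph (u k) (v k),
        ae_eq haar_prod setT f (rep_sum m j u)
      & ae_eq haar_prod setT h (rep_sum m j v)].

Definition is_D (l : nat) (m : int) (j : 'I_l.+1)
    (D : (XU -> R[i]) -> (XU -> R[i])) : Prop :=
  bounded_op haar_prod (rep_space m j) D /\
  exists B : nat -> (XU -> R[i]) -> (XU -> R[i]),
    (forall N, is_commutator haar_prod (rep_space m j) (A_graph m j)
                 (iter N (koopman (skew_product F phi))) (B N)) /\
    (forall f, rep_space m j f ->
       (fun N : nat => L2norm haar_prod (fun p =>
          (N%:R^-1)%:C *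
            B N (iter N (koopman (skew_product_inv F phi)) f) p - D f p))
       @ \oo --> (0 : R)).

(* The strong limit is unique up to equality almost everywhere of its values;
   it exists for phi of class C^1. *)
Definition D_op (l : nat) (m : int) (j : 'I_l.+1) :
  (XU -> R[i]) -> (XU -> R[i]) := xget (fun=> 0) [set D | is_D m j D].

Definition D_ker_ortho (l : nat) (m : int) (j : 'I_l.+1) : set (XU -> R[i]) :=
  ortho_in haar_prod (rep_space m j)
    (op_ker haar_prod (rep_space m j) (D_op m j)).

Definition H_mix : set (XU -> R[i]) :=
  hilbert_sum haar_prod
    [set i : int * {l : nat & 'I_l.+1} | (tag i.2)%:Z != 2 * i.1]
    (fun i => rep_space i.1 (tagged i.2)).

Definition mixing_in (K : set (XU -> R[i])) : Prop :=
  forall f g, K f -> L2 haar_prod g ->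
    (fun N : nat =>
       L2inner haar_prod f (iter N (koopman (skew_product F phi)) g))
      @ \oo --> (0 : R[i]).

End Operators.

(* Main.v *)
Require Import Defs.
From HB Require Import structures.
From mathcomp Require Import all_boot all_order all_algebra.
From mathcomp Require Import all_classical all_reals all_analysis.
From mathcomp Require Import measurable_realfun.
From mathcomp Require Import complex ring lra.

(** The theorem rests on the computation of the operator [D] of the statement: on
    each isotypic component it is multiplication by the constant
    [- s (2 m - l)], where [s] is the degree.

    Write a vector of the component as a sum over [k] of products of [u k] by the
    matrix coefficient of index [(j, k)]. By orthogonality of the coefficients
    ([gramE], [gram_norm_gt0]) its squared norm is a combination of the squared
    norms of the coordinates [u k], and the powers of the Koopman operator act on
    the coordinates by the transfer operators
    [u |-> rho(phi_N) (u o F_N)], where [phi_N] is the iterated cocycle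
    ([koopman_rep_sum]). On coordinates [A] is the generator [H] of the flow, so
    the Leibniz rule ([H_graph_mul], [transfer_H_graph]) identifies the commutator
    of [A] with the [N]-th power: it is multiplication by [i gen N] after the
    transfer operator, where [gen N] is the logarithmic derivative of
    [rho(phi_N)] along the flow ([commutator_op_gen], [commutatorP]). A commutator
    being defined by its quadratic form, it is unique because the domain of [H] is
    dense ([generator_dense], [bounded_op_form_ext]).

    By the cocycle relation, [gen N x] conjugated by [rho g] is a Birkhoff sum of
    the skew product at [(x, g)], for the function obtained by applying the
    differential of [rho] to [g M g^-1], with [M] the infinitesimal cocycle
    ([birkhoff_gen]). Its space average is the value of the differential of [rho]
    at the degree [i s I], that is the scalar [i s (2 m - l)]
    ([integral_drho_conj]). Unique ergodicity gives the almost everywhere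
    convergence of the averages ([birkhoff_cvg]), hence that of [gen N x / N]
    ([gen_cvg]), and dominated convergence the strong limit ([commutator_limit],
    [D_opE]).

    If the constant does not vanish, correlations decay: for [f] and [g] in the
    domain of [A], the pairing of [f] with the commutator applied to [g] is
    [<A f, U^N g> - <f, U^N A g>], which is bounded. Dividing by [N] leaves in the
    limit the constant times [<f, U^N g>] ([transfer_weak0_smooth]). Density of the
    domain extends this to all vectors of the component, density of the functions
    of product type extends it to all [g] ([L2_decorrelates]), and the passage to
    the Hilbert sum is a uniform approximation ([hilbert_sum_decorrelates]). *)

Set Implicit Arguments.
Unset Strict Implicit.
Unset Printing Implicit Defensive.

Import Order.TTheory GRing.Theory Num.Theory.
Import numFieldNormedType.Exports.

Local Open Scope classical_set_scope.
Local Open Scope ring_scope.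
Local Open Scope complex_scope.

Local Notation Re := (@complex.Re _).
Local Notation Im := (@complex.Im _).

(** * Complex-valued integration *)

Section ComplexNumbers.
Context {R : realType}.
Implicit Types x y z : R[i].

Definition nsq z : R := Re z ^+ 2 + Im z ^+ 2.

Lemma complex_eqP x y : Re x = Re y -> Im x = Im y -> x = y.
Proof. by case: x y => a b [c d] /= -> ->. Qed.

Lemma ReD x y : Re (x + y) = Re x + Re y. Proof. by case: x y => ? ? []. Qed.
Lemma ImD x y : Im (x + y) = Im x + Im y. Proof. by case: x y => ? ? []. Qed.
Lemma ReN x : Re (- x) = - Re x. Proof. by case: x. Qed.
Lemma ImN x : Im (- x) = - Im x. Proof. by case: x. Qed.
Lemma ReM x y : Re (x * y) = Re x * Re y - Im x * Im y.
Proof. by case: x y => ? ? []. Qed.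
Lemma ImM x y : Im (x * y) = Re x * Im y + Im x * Re y.
Proof. by case: x y => ? ? [] /= *; rewrite addrC. Qed.
Lemma ReJ x : Re (conjc x) = Re x. Proof. by case: x. Qed.
Lemma ImJ x : Im (conjc x) = - Im x. Proof. by case: x. Qed.

Definition cplxE := (ReD, ImD, ReN, ImN, ReM, ImM, ReJ, ImJ).

Lemma conjcD x y : conjc (x + y) = conjc x + conjc y.
Proof. exact: rmorphD. Qed.
Lemma conjcM x y : conjc (x * y) = conjc x * conjc y.
Proof. exact: rmorphM. Qed.
Lemma conjcN x : conjc (- x) = - conjc x.
Proof. exact: rmorphN. Qed.

Lemma nsq_ge0 z : 0 <= nsq z. Proof. by rewrite addr_ge0 ?sqr_ge0. Qed.

Lemma nsqM x y : nsq (x * y) = nsq x * nsq y.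
Proof. by rewrite /nsq !cplxE; ring. Qed.

Lemma nsqJ x : nsq (conjc x) = nsq x.
Proof. by rewrite /nsq !cplxE sqrrN. Qed.

Lemma nsqN x : nsq (- x) = nsq x.
Proof. by rewrite /nsq !cplxE !sqrrN. Qed.

Lemma nsqE x : (nsq x)%:C = x * conjc x.
Proof. by apply: complex_eqP; rewrite /nsq !cplxE /=; ring. Qed.

Lemma nsqD_le x y : nsq (x + y) <= 2 * (nsq x + nsq y).
Proof.
rewrite /nsq !cplxE -subr_ge0.
have -> : 2 * (Re x ^+ 2 + Im x ^+ 2 + (Re y ^+ 2 + Im y ^+ 2)) -
  ((Re x + Re y) ^+ 2 + (Im x + Im y) ^+ 2) =
  (Re x - Re y) ^+ 2 + (Im x - Im y) ^+ 2 by ring.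
by rewrite addr_ge0 ?sqr_ge0.
Qed.

Lemma nsq_eq0 x : (nsq x == 0) = (x == 0).
Proof.
rewrite paddr_eq0 ?sqr_ge0// !sqrf_eq0.
by case: x => a b /=; rewrite eq_complex.
Qed.

Lemma nsq0 : nsq 0 = 0. Proof. by apply/eqP; rewrite nsq_eq0. Qed.

Lemma nsqC (a : R) : nsq a%:C = a ^+ 2.
Proof. by rewrite /nsq /= expr0n addr0. Qed.

Lemma normc_nsq z : `|z| = (Num.sqrt (nsq z))%:C.
Proof. by rewrite normc_def. Qed.

Lemma Re2_le_nsq z : Re z ^+ 2 <= nsq z.
Proof. by rewrite lerDl sqr_ge0. Qed.

Lemma Im2_le_nsq z : Im z ^+ 2 <= nsq z.
Proof. by rewrite lerDr sqr_ge0. Qed.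

Lemma conjc_sum (I : Type) (r : seq I) (f : I -> R[i]) :
  conjc (\sum_(i <- r) f i) = \sum_(i <- r) conjc (f i).
Proof. exact: raddf_sum. Qed.

Lemma Re_sum (I : Type) (r : seq I) (f : I -> R[i]) :
  Re (\sum_(i <- r) f i) = \sum_(i <- r) Re (f i).
Proof. exact: raddf_sum. Qed.

Lemma Im_sum (I : Type) (r : seq I) (f : I -> R[i]) :
  Im (\sum_(i <- r) f i) = \sum_(i <- r) Im (f i).
Proof. exact: raddf_sum. Qed.

End ComplexNumbers.

Section CMeasurable.
Context {R : realType} {d : measure_display} {T : measurableType d}.
Implicit Types f g : T -> R[i].

Definition cmeas f := measurable_fun setT (Re \o f) /\
                      measurable_fun setT (Im \o f).

Lemma cmeas_ext f g : f =1 g -> cmeas f -> cmeas g.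
Proof. by move=> /funext ->. Qed.

Lemma cmeas_cst (c : R[i]) : cmeas (fun=> c).
Proof. by split; exact: measurable_cst. Qed.

Lemma cmeasD f g : cmeas f -> cmeas g -> cmeas (fun x => f x + g x).
Proof.
move=> [f1 f2] [g1 g2]; split.
  by rewrite (_ : _ \o _ = (Re \o f) \+ (Re \o g)); [exact: measurable_funD|
    apply/funext => x /=; rewrite ReD].
by rewrite (_ : _ \o _ = (Im \o f) \+ (Im \o g)); [exact: measurable_funD|
  apply/funext => x /=; rewrite ImD].
Qed.

Lemma cmeasM f g : cmeas f -> cmeas g -> cmeas (fun x => f x * g x).
Proof.
move=> [f1 f2] [g1 g2]; split.
  rewrite (_ : _ \o _ = (Re \o f) \* (Re \o g) \- (Im \o f) \* (Im \o g)).
    by apply: measurable_funB; apply: measurable_funM.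
  by apply/funext => x /=; rewrite ReM.
rewrite (_ : _ \o _ = (Re \o f) \* (Im \o g) \+ (Im \o f) \* (Re \o g)).
  by apply: measurable_funD; apply: measurable_funM.
by apply/funext => x /=; rewrite ImM.
Qed.

Lemma cmeasJ f : cmeas f -> cmeas (fun x => conjc (f x)).
Proof.
move=> [f1 f2]; split.
  by rewrite (_ : _ \o _ = Re \o f)//; apply/funext => x /=; rewrite ReJ.
rewrite (_ : _ \o _ = \- (Im \o f)); last by apply/funext => x /=; rewrite ImJ.
exact: measurableT_comp.
Qed.

Lemma cmeasZ (a : R[i]) f : cmeas f -> cmeas (fun x => a * f x).
Proof. exact/cmeasM/cmeas_cst. Qed.

Lemma cmeasN f : cmeas f -> cmeas (fun x => - f x).
Proof.
by move=> /(cmeasZ (-1)); apply: cmeas_ext => x; rewrite mulN1r.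
Qed.

Lemma cmeasB f g : cmeas f -> cmeas g -> cmeas (fun x => f x - g x).
Proof. by move=> ? ?; apply: cmeasD => //; exact: cmeasN. Qed.

Lemma cmeas_nsq f : cmeas f -> measurable_fun setT (nsq \o f).
Proof.
move=> [f1 f2]; rewrite (_ : _ \o _ = (fun x => (Re \o f) x ^+ 2) \+
  (fun x => (Im \o f) x ^+ 2))//.
by apply: measurable_funD; apply: measurable_funX.
Qed.

End CMeasurable.

Lemma cmeas_comp {R : realType} {d d'} {T : measurableType d}
    {T' : measurableType d'} (S : T' -> T) (f : T -> R[i]) :
  measurable_fun setT S -> cmeas f -> cmeas (f \o S).
Proof.
move=> mS [f1 f2]; split.
  exact: (measurableT_comp f1 mS).
exact: (measurableT_comp f2 mS).
Qed.

Section CIntegral.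
Context {R : realType} {d : measure_display} {T : measurableType d}.
Variable mu : {measure set T -> \bar R}.
Implicit Types f g : T -> R[i].

Definition cintegrable f :=
  mu.-integrable setT (EFin \o (Re \o f)) /\
  mu.-integrable setT (EFin \o (Im \o f)).

Lemma cintegrable_ext f g : f =1 g -> cintegrable f -> cintegrable g.
Proof. by move=> /funext ->. Qed.

Lemma cintegrable_le f (h : T -> R) : cmeas f ->
  mu.-integrable setT (EFin \o h) ->
  (forall x, nsq (f x) <= h x ^+ 2) -> cintegrable f.
Proof.
move=> [f1 f2] ih hle; split.
  apply: le_integrable ih => //; first exact/measurable_EFinP.
  move=> x _ /=; rewrite lee_fin -(ler_pXn2r (n := 2)) ?nnegrE//.
  by rewrite !real_normK ?num_real//; apply: le_trans (hle x); exact: Re2_le_nsq.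
apply: le_integrable ih => //; first exact/measurable_EFinP.
move=> x _ /=; rewrite lee_fin -(ler_pXn2r (n := 2)) ?nnegrE//.
by rewrite !real_normK ?num_real//; apply: le_trans (hle x); exact: Im2_le_nsq.
Qed.

Lemma cintegrableD f g : cintegrable f -> cintegrable g ->
  cintegrable (fun x => f x + g x).
Proof.
move=> [f1 f2] [g1 g2]; split.
  by have := integrableD measurableT f1 g1; apply: eq_integrable => // x _ /=;
    rewrite ReD.
by have := integrableD measurableT f2 g2; apply: eq_integrable => // x _ /=;
  rewrite ImD.
Qed.

Lemma cintegralD f g : cintegrable f -> cintegrable g ->
  cintegral mu (fun x => f x + g x) = cintegral mu f + cintegral mu g.
Proof.
move=> [f1 f2] [g1 g2]; apply: complex_eqP; rewrite ?ReD ?ImD /=.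
  rewrite -RintegralD//; apply: eq_Rintegral => x _ /=; exact: ReD.
rewrite -RintegralD//; apply: eq_Rintegral => x _ /=; exact: ImD.
Qed.

Lemma cintegrableZ (a : R[i]) f : cintegrable f ->
  cintegrable (fun x => a * f x).
Proof.
move=> [f1 f2].
have Z (b : R) (h : T -> R) : mu.-integrable setT (EFin \o h) ->
    mu.-integrable setT (EFin \o (fun x => b * h x)).
  by move=> ih; have := integrableZl measurableT b ih;
    apply: eq_integrable => // x _.
split.
  have := integrableD measurableT (Z (Re a) _ f1) (Z (- Im a) _ f2).
  by apply: eq_integrable => // x _ /=; rewrite ReM mulNr.
have := integrableD measurableT (Z (Re a) _ f2) (Z (Im a) _ f1).
by apply: eq_integrable => // x _ /=; rewrite ImM.
Qed.

Lemma cintegralZ (a : R[i]) f : cintegrable f ->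
  cintegral mu (fun x => a * f x) = a * cintegral mu f.
Proof.
move=> [f1 f2].
have Z (b : R) (h : T -> R) : mu.-integrable setT (EFin \o h) ->
    mu.-integrable setT (EFin \o (fun x => b * h x)).
  by move=> ih; have := integrableZl measurableT b ih;
    apply: eq_integrable => // x _.
apply: complex_eqP; rewrite ?ReM ?ImM /=.
  rewrite -!RintegralZl// -RintegralB//; try exact: Z.
  by apply: eq_Rintegral => x _ /=; rewrite ReM.
rewrite -!RintegralZl// -RintegralD//; try exact: Z.
by apply: eq_Rintegral => x _ /=; rewrite ImM.
Qed.

Lemma cintegralJ f : cintegrable f ->
  cintegral mu (fun x => conjc (f x)) = conjc (cintegral mu f).
Proof.
move=> [f1 f2]; apply: complex_eqP; rewrite ?ReJ ?ImJ /=.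
  by apply: eq_Rintegral => x _ /=; rewrite ReJ.
rewrite -mulN1r -RintegralZl//; apply: eq_Rintegral => x _ /=.
by rewrite ImJ mulN1r.
Qed.

Lemma cintegrable0 : cintegrable (fun=> 0).
Proof. by split; exact: integrable0. Qed.

Lemma cintegrable_sum (I : Type) (s : seq I) (f : I -> T -> R[i]) :
  (forall i, cintegrable (f i)) -> cintegrable (fun x => \sum_(i <- s) f i x).
Proof.
move=> h; elim: s => [|i s IH].
  by apply: (cintegrable_ext _ cintegrable0) => x; rewrite big_nil.
by apply: (cintegrable_ext _ (cintegrableD (h i) IH)) => x; rewrite big_cons.
Qed.

Lemma cintegral0 : cintegral mu (fun=> 0) = 0.
Proof.
by apply: complex_eqP => /=; rewrite /Rintegral integral0.
Qed.

Lemma eq_cintegral f g : f =1 g -> cintegral mu f = cintegral mu g.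
Proof. by move=> /funext ->. Qed.

Lemma cintegral_sum (I : Type) (s : seq I) (f : I -> T -> R[i]) :
  (forall i, cintegrable (f i)) ->
  cintegral mu (fun x => \sum_(i <- s) f i x) =
  \sum_(i <- s) cintegral mu (f i).
Proof.
move=> h; elim: s => [|i s IH].
  rewrite big_nil -[RHS]cintegral0.
  by apply: eq_cintegral => x; rewrite big_nil.
rewrite big_cons -IH -cintegralD//; last exact: cintegrable_sum.
by apply: eq_cintegral => x; rewrite big_cons.
Qed.

Lemma cintegral_ae f g : cmeas f -> cmeas g -> ae_eq mu setT f g ->
  cintegral mu f = cintegral mu g.
Proof.
move=> [f1 f2] [g1 g2] fg; rewrite /cintegral /Rintegral.
congr ((fine _) +i* (fine _)); apply: ae_eq_integral => //.
- exact/measurable_EFinP.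
- exact/measurable_EFinP.
- by apply: filterS fg => x /= + _ => /(_ I) ->.
- exact/measurable_EFinP.
- exact/measurable_EFinP.
- by apply: filterS fg => x /= + _ => /(_ I) ->.
Qed.

End CIntegral.

(** * Square-integrable complex functions *)

Section Cnorm.
Context {R : realType}.
Implicit Types x y z : R[i].

Definition cnorm z : R := Num.sqrt (nsq z).

Lemma cnormE z : `|z| = (cnorm z)%:C. Proof. exact: normc_nsq. Qed.

Lemma cnorm_ge0 z : 0 <= cnorm z. Proof. exact: sqrtr_ge0. Qed.

Lemma cnorm_sqr z : cnorm z ^+ 2 = nsq z.
Proof. by rewrite sqr_sqrtr ?nsq_ge0. Qed.

Lemma cnormM x y : cnorm (x * y) = cnorm x * cnorm y.
Proof. by rewrite /cnorm nsqM sqrtrM ?nsq_ge0. Qed.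

Lemma cnormD x y : cnorm (x + y) <= cnorm x + cnorm y.
Proof. by rewrite -lecR -cnormE rmorphD /= -!cnormE ler_normD. Qed.

Lemma cnormN x : cnorm (- x) = cnorm x.
Proof. by rewrite /cnorm nsqN. Qed.

Lemma cnormJ x : cnorm (conjc x) = cnorm x.
Proof. by rewrite /cnorm nsqJ. Qed.

Lemma cnorm0 : cnorm 0 = 0.
Proof. by rewrite /cnorm nsq0 sqrtr0. Qed.

Lemma cnorm_eq0 x : cnorm x = 0 -> x = 0.
Proof. by move=> h; apply/eqP; rewrite -nsq_eq0 -cnorm_sqr h expr0n. Qed.

Lemma Re_le_cnorm z : `|Re z| <= cnorm z.
Proof.
rewrite -(ler_pXn2r (n := 2)) ?nnegrE ?cnorm_ge0// cnorm_sqr.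
by rewrite real_normK ?num_real ?Re2_le_nsq.
Qed.

Lemma Im_le_cnorm z : `|Im z| <= cnorm z.
Proof.
rewrite -(ler_pXn2r (n := 2)) ?nnegrE ?cnorm_ge0// cnorm_sqr.
by rewrite real_normK ?num_real ?Im2_le_nsq.
Qed.

Lemma cnorm_le_ReIm z : cnorm z <= `|Re z| + `|Im z|.
Proof.
rewrite -(ler_pXn2r (n := 2)) ?nnegrE ?cnorm_ge0 ?addr_ge0// cnorm_sqr.
rewrite sqrrD !real_normK ?num_real// /nsq lerD2r lerDl.
by rewrite mulrn_wge0// mulr_ge0.
Qed.

Lemma cnorm_sum (I : Type) (s : seq I) (f : I -> R[i]) :
  cnorm (\sum_(i <- s) f i) <= \sum_(i <- s) cnorm (f i).
Proof.
elim: s => [|i s IH]; first by rewrite !big_nil cnorm0.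
by rewrite !big_cons (le_trans (cnormD _ _))// lerD2l.
Qed.

(** The topology of the complex numbers is given by their own norm, which takes
    its values in the complex numbers themselves; the real-valued [cnorm] yields
    the same null sequences. *)
Lemma cvg_cnorm0 (z : R[i] ^nat) :
  ((fun N => cnorm (z N)) @ \oo --> (0 : R)) -> z @ \oo --> (0 : R[i]).
Proof.
move=> h; apply/cvgr0Pnorm_lt => e e0.
have eE : e = (Re e)%:C.
  by case: e e0 => a b; rewrite ltcE /= => /andP[/eqP -> _].
have re0 : 0 < Re e by rewrite -ltcR -eE.
move/cvgr0Pnorm_lt : h => /(_ _ re0); apply: filterS => N.
by rewrite ger0_norm ?cnorm_ge0// cnormE -ltcR -eE.
Qed.

End Cnorm.

Arguments L2inner {R d T} mu f g : simpl never.

Section L2Theory.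
Context {R : realType} {d : measure_display} {T : measurableType d}.
Variable mu : {measure set T -> \bar R}.
Implicit Types f g h : T -> R[i].

Lemma Lfun2P (f : T -> R) : f \in Lfun mu 2%:E <->
  measurable_fun setT f /\
  mu.-integrable setT (EFin \o (fun x => f x ^+ 2)).
Proof.
split=> [fL|[mf fi]].
  split; last exact: Lfun2_integrable_sqr.
  by move: fL; rewrite inE => /andP[]; rewrite inE.
rewrite inE; apply/andP; split; first by rewrite inE.
rewrite inE /= /finite_norm unlock poweR_lty//.
move/integrableP : fi => [_]; apply: le_lt_trans.
rewrite le_eqVlt; apply/orP; left; apply/eqP; apply: eq_integral => x _ /=.
by rewrite powR_mulrn// normrX.
Qed.

Lemma L2P f : L2 mu f <->
  cmeas f /\ mu.-integrable setT (EFin \o (nsq \o f)).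
Proof.
split=> [[/Lfun2P[m1 i1] /Lfun2P[m2 i2]]|[[m1 m2] i]].
  split=> //; have := integrableD measurableT i1 i2.
  by apply: eq_integrable.
split; apply/Lfun2P; split=> //.
  apply: le_integrable i => //.
    by apply/measurable_EFinP; apply: measurable_funX.
  move=> x _ /=; rewrite lee_fin !ger0_norm ?sqr_ge0 ?nsq_ge0//.
  exact: Re2_le_nsq.
apply: le_integrable i => //.
  by apply/measurable_EFinP; apply: measurable_funX.
move=> x _ /=; rewrite lee_fin !ger0_norm ?sqr_ge0 ?nsq_ge0//.
exact: Im2_le_nsq.
Qed.

Lemma L2_cmeas f : L2 mu f -> cmeas f. Proof. by move=> /L2P[]. Qed.

Lemma L2_nsq f : L2 mu f -> mu.-integrable setT (EFin \o (nsq \o f)).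
Proof. by move=> /L2P[]. Qed.

Lemma L2_ext f g : f =1 g -> L2 mu f -> L2 mu g.
Proof. by move=> /funext ->. Qed.

Lemma L2_le f (h : T -> R) : cmeas f -> mu.-integrable setT (EFin \o h) ->
  (forall x, nsq (f x) <= h x) -> L2 mu f.
Proof.
move=> mf ih fh; apply/L2P; split=> //; apply: le_integrable ih => //.
  by apply/measurable_EFinP; exact: cmeas_nsq.
move=> x _ /=; rewrite lee_fin ger0_norm ?nsq_ge0//.
exact: le_trans (fh x) (ler_norm _).
Qed.

Lemma L2D f g : L2 mu f -> L2 mu g -> L2 mu (fun x => f x + g x).
Proof.
move=> /L2P[mf fi] /L2P[mg gi].
apply: (@L2_le _ (fun x => 2 * (nsq (f x) + nsq (g x)))).
- exact: cmeasD.
- have := integrableZl measurableT 2 (integrableD measurableT fi gi).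
  by apply: eq_integrable => // x _ /=.
- by move=> x; exact: nsqD_le.
Qed.

Lemma L2_bdM (K : R) (a : T -> R[i]) f : cmeas a ->
  (forall x, nsq (a x) <= K) -> L2 mu f -> L2 mu (fun x => a x * f x).
Proof.
move=> ma aK /L2P[mf fi].
apply: (@L2_le _ (fun x => K * nsq (f x))).
- exact: cmeasM.
- have := integrableZl measurableT K fi.
  by apply: eq_integrable => // x _ /=.
- by move=> x; rewrite nsqM ler_wpM2r ?nsq_ge0.
Qed.

Lemma L2Z (a : R[i]) f : L2 mu f -> L2 mu (fun x => a * f x).
Proof. by apply: (@L2_bdM (nsq a)) => //; exact: cmeas_cst. Qed.

Lemma L2N f : L2 mu f -> L2 mu (fun x => - f x).
Proof. by move=> /(L2Z (-1)); apply: L2_ext => x; rewrite mulN1r. Qed.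

Lemma L2B f g : L2 mu f -> L2 mu g -> L2 mu (fun x => f x - g x).
Proof. by move=> ? ?; apply: L2D => //; exact: L2N. Qed.

Lemma L20 : L2 mu (fun=> 0).
Proof.
apply: (@L2_le _ (fun=> 0)).
- exact: cmeas_cst.
- exact: integrable0.
- by move=> x; rewrite nsq0.
Qed.

Lemma L2_sum (I : Type) (s : seq I) (f : I -> T -> R[i]) :
  (forall i, L2 mu (f i)) -> L2 mu (fun x => \sum_(i <- s) f i x).
Proof.
move=> h; elim: s => [|i s IH].
  by apply: (L2_ext _ L20) => x; rewrite big_nil.
by apply: (L2_ext _ (L2D (h i) IH)) => x; rewrite big_cons.
Qed.

Lemma L2_prod f g : L2 mu f -> L2 mu g ->
  cintegrable mu (fun x => f x * conjc (g x)).
Proof.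
move=> /L2P[mf fi] /L2P[mg gi].
apply: (@cintegrable_le _ _ _ _ _ (fun x => nsq (f x) + nsq (g x))).
- by apply: cmeasM => //; exact: cmeasJ.
- by have := integrableD measurableT fi gi; apply: eq_integrable.
move=> x; rewrite nsqM nsqJ sqrrD.
apply: (@le_trans _ _ (nsq (f x) * nsq (g x) *+ 2)).
  by rewrite mulr2n lerDl mulr_ge0 ?nsq_ge0.
by rewrite addrAC lerDr addr_ge0 ?sqr_ge0.
Qed.

Lemma L2innerDl f g h : L2 mu f -> L2 mu g -> L2 mu h ->
  L2inner mu (fun x => f x + g x) h = L2inner mu f h + L2inner mu g h.
Proof.
move=> ? ? ?; rewrite /L2inner -cintegralD; [|exact: L2_prod..].
by apply: eq_cintegral => x; rewrite mulrDl.
Qed.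

Lemma L2innerZl (a : R[i]) f g : L2 mu f -> L2 mu g ->
  L2inner mu (fun x => a * f x) g = a * L2inner mu f g.
Proof.
move=> ? ?; rewrite /L2inner -cintegralZ; last exact: L2_prod.
by apply: eq_cintegral => x; rewrite mulrA.
Qed.

Lemma L2innerC f g : L2 mu f -> L2 mu g ->
  L2inner mu g f = conjc (L2inner mu f g).
Proof.
move=> ? ?; rewrite /L2inner -cintegralJ; last exact: L2_prod.
by apply: eq_cintegral => x; rewrite rmorphM /= conjcK mulrC.
Qed.

Lemma L2innerDr f g h : L2 mu f -> L2 mu g -> L2 mu h ->
  L2inner mu h (fun x => f x + g x) = L2inner mu h f + L2inner mu h g.
Proof.
move=> Lf Lg Lh; have Lfg := L2D Lf Lg.
by rewrite (L2innerC Lfg)// L2innerDl// conjcD -!L2innerC.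
Qed.

Lemma L2innerZr (a : R[i]) f g : L2 mu f -> L2 mu g ->
  L2inner mu g (fun x => a * f x) = conjc a * L2inner mu g f.
Proof.
move=> Lf Lg; have Lfa := L2Z a Lf.
by rewrite (L2innerC Lfa)// L2innerZl// conjcM -!L2innerC.
Qed.

Lemma L2innerNl f g : L2 mu f -> L2 mu g ->
  L2inner mu (fun x => - f x) g = - L2inner mu f g.
Proof.
move=> Lf Lg; rewrite -mulN1r -L2innerZl//.
by congr (L2inner _ _ _); apply/funext => x; rewrite mulN1r.
Qed.

Lemma L2innerNr f g : L2 mu f -> L2 mu g ->
  L2inner mu g (fun x => - f x) = - L2inner mu g f.
Proof.
move=> Lf Lg; rewrite (L2innerC _ Lg); last exact: L2N.
by rewrite L2innerNl// conjcN -L2innerC.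
Qed.

Lemma L2innerBl f g h : L2 mu f -> L2 mu g -> L2 mu h ->
  L2inner mu (fun x => f x - g x) h = L2inner mu f h - L2inner mu g h.
Proof.
by move=> Lf Lg Lh; rewrite (L2innerDl Lf _ Lh) ?L2innerNl//; exact: L2N.
Qed.

Lemma L2innerBr f g h : L2 mu f -> L2 mu g -> L2 mu h ->
  L2inner mu h (fun x => f x - g x) = L2inner mu h f - L2inner mu h g.
Proof.
by move=> Lf Lg Lh; rewrite (L2innerDr Lf _ Lh) ?L2innerNr//; exact: L2N.
Qed.

Lemma L2inner_suml (I : Type) (s : seq I) (f : I -> T -> R[i]) g :
  (forall i, L2 mu (f i)) -> L2 mu g ->
  L2inner mu (fun x => \sum_(i <- s) f i x) g = \sum_(i <- s) L2inner mu (f i) g.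
Proof.
move=> Lf Lg; rewrite /L2inner -cintegral_sum.
  by apply: eq_cintegral => x; rewrite mulr_suml.
by move=> i; exact: L2_prod.
Qed.

Lemma L2inner_sumr (I : Type) (s : seq I) (f : I -> T -> R[i]) g :
  (forall i, L2 mu (f i)) -> L2 mu g ->
  L2inner mu g (fun x => \sum_(i <- s) f i x) = \sum_(i <- s) L2inner mu g (f i).
Proof.
move=> Lf Lg; rewrite (L2innerC _ Lg); last exact: L2_sum.
rewrite L2inner_suml// conjc_sum; apply: eq_bigr => i _.
by rewrite -L2innerC.
Qed.

Lemma L2inner_ae f f' g g' : L2 mu f -> L2 mu f' -> L2 mu g -> L2 mu g' ->
  ae_eq mu setT f f' -> ae_eq mu setT g g' ->
  L2inner mu f g = L2inner mu f' g'.
Proof.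
move=> Lf Lf' Lg Lg' ff gg; apply: cintegral_ae.
- by apply: cmeasM; [exact: L2_cmeas|apply: cmeasJ; exact: L2_cmeas].
- by apply: cmeasM; [exact: L2_cmeas|apply: cmeasJ; exact: L2_cmeas].
- by apply: filterS2 ff gg => x /= + + _ => /(_ I) -> /(_ I) ->.
Qed.

Definition L2sq f : R := Rintegral mu setT (nsq \o f).

Lemma L2inner_diag f : L2inner mu f f = (L2sq f)%:C.
Proof.
apply: complex_eqP => /=; rewrite /L2inner /L2sq /=.
  by apply: eq_Rintegral => x _ /=; rewrite -nsqE.
rewrite /Rintegral (eq_integral (cst 0%E)) ?integral0// => x _ /=.
by rewrite -nsqE.
Qed.

Lemma L2sq_ge0 f : 0 <= L2sq f.
Proof. by apply: Rintegral_ge0 => x _; exact: nsq_ge0. Qed.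

Lemma L2normE f : L2norm mu f = Num.sqrt (L2sq f).
Proof. by rewrite /L2norm L2inner_diag. Qed.

Lemma L2norm_ge0 f : 0 <= L2norm mu f.
Proof. exact: sqrtr_ge0. Qed.

Lemma L2norm_sqr f : L2norm mu f ^+ 2 = L2sq f.
Proof. by rewrite L2normE sqr_sqrtr ?L2sq_ge0. Qed.

Lemma L2sq_ae0 f : L2 mu f -> L2sq f = 0 -> ae_eq mu setT f 0.
Proof.
move=> /L2P[mf fi] f0.
have h : (\int[mu]_(x in setT) `|(nsq (f x))%:E| = 0)%E.
  rewrite (eq_integral (EFin \o (nsq \o f))); last first.
    by move=> x _ /=; rewrite ger0_norm ?nsq_ge0.
  by rewrite -[LHS]fineK; [rewrite -[X in X%:E]/(L2sq f) f0|
    exact: integrable_fin_num].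
have mn : measurable_fun setT (fun x => (nsq (f x))%:E).
  by apply/measurable_EFinP; exact: cmeas_nsq.
have /(_ mn) [/(_ h) h' _] := @ae_eq_integral_abs _ _ _ mu setT measurableT
  (fun x => (nsq (f x))%:E).
apply: filterS h' => x /= + _ => /(_ I) [] /eqP.
by rewrite nsq_eq0 => /eqP.
Qed.

Lemma L2norm_ae0 f : L2 mu f -> L2norm mu f = 0 -> ae_eq mu setT f 0.
Proof. by move=> Lf f0; apply: L2sq_ae0 => //; rewrite -L2norm_sqr f0 expr0n. Qed.

Lemma L2norm_ae f g : L2 mu f -> L2 mu g -> ae_eq mu setT f g ->
  L2norm mu f = L2norm mu g.
Proof. by move=> Lf Lg fg; rewrite /L2norm (L2inner_ae Lf Lg Lf Lg). Qed.

Lemma L2inner0l f g : L2 mu f -> L2 mu g -> ae_eq mu setT f 0 ->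
  L2inner mu f g = 0.
Proof.
move=> Lf Lg f0; rewrite (L2inner_ae Lf L20 Lg Lg)//; last exact: ae_eq_refl.
rewrite /L2inner -[RHS](cintegral0 mu); apply: eq_cintegral => x.
by rewrite mul0r.
Qed.

Lemma L2norm0 f : L2 mu f -> ae_eq mu setT f 0 -> L2norm mu f = 0.
Proof. by move=> Lf f0; rewrite /L2norm L2inner0l// sqrtr0. Qed.

Lemma cauchy_schwarz f g : L2 mu f -> L2 mu g ->
  cnorm (L2inner mu f g) <= L2norm mu f * L2norm mu g.
Proof.
move=> Lf Lg; rewrite -(ler_pXn2r (n := 2)) ?nnegrE ?cnorm_ge0//; last first.
  by rewrite mulr_ge0 ?L2norm_ge0.
rewrite cnorm_sqr exprMn !L2norm_sqr.
have [z zE] : exists z, L2inner mu f g = z by exists (L2inner mu f g).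
rewrite zE.
have key (t : R) : 0 <= L2sq f - 2 * t * nsq z + t ^+ 2 * nsq z * L2sq g.
  have Lg' := L2Z (t%:C * z) Lg.
  have := L2sq_ge0 (fun x => f x - t%:C * z * g x).
  suff -> : L2sq (fun x => f x - t%:C * z * g x) =
     L2sq f - 2 * t * nsq z + t ^+ 2 * nsq z * L2sq g by [].
  have := L2inner_diag (fun x => f x - t%:C * z * g x).
  rewrite (L2innerBl Lf Lg' (L2B Lf Lg')) (L2innerBr Lf Lg' Lf).
  rewrite (L2innerBr Lf Lg' Lg') (L2innerZl _ Lg Lf) (L2innerZl _ Lg Lg').
  rewrite (L2innerZr _ Lg Lf) (L2innerZr _ Lg Lg) (L2innerC Lf Lg) zE.
  rewrite !L2inner_diag.
  move=> /(congr1 Re) /= <-; rewrite /nsq.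
  by case: (z) => a b /=; ring.
have [g0|g0] := eqVneq (L2sq g) 0.
  rewrite g0 mulr0; have [//|N0] := lerP (nsq z) 0.
  have := key ((L2sq f + 1) / (2 * nsq z)).
  rewrite g0 mulr0 addr0.
  have -> : L2sq f - 2 * ((L2sq f + 1) / (2 * nsq z)) * nsq z = -1.
    by field; rewrite gt_eqF.
  by rewrite ler0N1.
have gp : 0 < L2sq g by rewrite lt_def g0 L2sq_ge0.
have := key (L2sq g)^-1.
have -> : L2sq f - 2 * (L2sq g)^-1 * nsq z + (L2sq g)^-1 ^+ 2 * nsq z * L2sq g =
   L2sq f - nsq z / L2sq g by field.
by rewrite subr_ge0 ler_pdivrMr.
Qed.

Lemma L2normD f g : L2 mu f -> L2 mu g ->
  L2norm mu (fun x => f x + g x) <= L2norm mu f + L2norm mu g.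
Proof.
move=> Lf Lg.
rewrite -(ler_pXn2r (n := 2)) ?nnegrE ?L2norm_ge0//; last first.
  by rewrite addr_ge0 ?L2norm_ge0.
rewrite sqrrD !L2norm_sqr.
have := L2inner_diag (fun x => f x + g x).
rewrite (L2innerDl Lf Lg (L2D Lf Lg)) (L2innerDr Lf Lg Lf).
rewrite (L2innerDr Lf Lg Lg) (L2innerC Lf Lg) !L2inner_diag.
have := le_trans (ler_norm _) (le_trans (Re_le_cnorm _) (cauchy_schwarz Lf Lg)).
have [z ->] : exists z, L2inner mu f g = z by exists (L2inner mu f g).
move=> h /(congr1 Re); rewrite !cplxE /= => <-.
by rewrite mulr2n; lra.
Qed.

Lemma L2normZ (a : R[i]) f : L2 mu f ->
  L2norm mu (fun x => a * f x) = cnorm a * L2norm mu f.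
Proof.
move=> Lf; rewrite {1}/L2norm L2innerZl ?L2innerZr//; last exact: L2Z.
rewrite L2inner_diag mulrA -nsqE -rmorphM /= sqrtrM ?nsq_ge0//.
by rewrite L2normE.
Qed.

Lemma L2normN f : L2 mu f -> L2norm mu (fun x => - f x) = L2norm mu f.
Proof.
move=> Lf; rewrite (_ : (fun x => - f x) = (fun x => -1 * f x)).
  by rewrite L2normZ// cnormN -[cnorm 1]/(cnorm (1%:C)) /cnorm nsqC expr1n sqrtr1 mul1r.
by apply/funext => x; rewrite mulN1r.
Qed.

Lemma L2normB f g : L2 mu f -> L2 mu g ->
  L2norm mu (fun x => f x - g x) <= L2norm mu f + L2norm mu g.
Proof.
by move=> Lf Lg; rewrite (le_trans (L2normD Lf (L2N Lg)))// L2normN.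
Qed.

Lemma L2norm_sum (I : Type) (s : seq I) (f : I -> T -> R[i]) :
  (forall i, L2 mu (f i)) ->
  L2norm mu (fun x => \sum_(i <- s) f i x) <= \sum_(i <- s) L2norm mu (f i).
Proof.
move=> h; elim: s => [|i s IH].
  rewrite big_nil L2norm0//.
    by apply: (L2_ext _ L20) => x; rewrite big_nil.
  by apply/aeW => x _; rewrite big_nil.
rewrite (_ : (fun x => _) = (fun x => f i x + \sum_(i <- s) f i x)).
  by rewrite (le_trans (L2normD _ _))// ?big_cons ?lerD//; exact: L2_sum.
by apply/funext => x; rewrite big_cons.
Qed.

Lemma L2norm_bdM (K : R) (a : T -> R[i]) f : 0 <= K -> cmeas a ->
  (forall x, cnorm (a x) <= K) -> L2 mu f ->
  L2norm mu (fun x => a x * f x) <= K * L2norm mu f.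
Proof.
move=> K0 ma aK Lf.
have aK2 x : nsq (a x) <= K ^+ 2.
  by rewrite -cnorm_sqr lerXn2r ?nnegrE ?cnorm_ge0.
rewrite -(ler_pXn2r (n := 2)) ?nnegrE ?L2norm_ge0//; last first.
  by rewrite mulr_ge0 ?L2norm_ge0.
rewrite exprMn !L2norm_sqr /L2sq -RintegralZl//; last exact: L2_nsq.
apply: le_Rintegral => //.
- by apply: L2_nsq; exact: L2_bdM Lf.
- have := integrableZl measurableT (K ^+ 2) (L2_nsq Lf).
  by apply: eq_integrable.
- by move=> x _ /=; rewrite nsqM ler_wpM2r ?nsq_ge0.
Qed.

(** Dominated convergence for the squares of the moduli. *)
Lemma L2_dominated_cvg0 (f : (T -> R[i]) ^nat) (h : T -> R) :
  (forall N, cmeas (f N)) -> mu.-integrable setT (EFin \o h) ->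
  (forall N x, nsq (f N x) <= h x) ->
  {ae mu, forall x, (fun N => cnorm (f N x)) @ \oo --> (0 : R)} ->
  (fun N => L2norm mu (f N)) @ \oo --> (0 : R).
Proof.
move=> mf ih fh f0.
have [] := @dominated_convergence _ _ _ mu setT measurableT
  (fun N x => (nsq (f N x))%:E) (cst 0%E) (EFin \o h).
- by move=> N; apply/measurable_EFinP; exact: cmeas_nsq.
- exact: measurable_cst.
- apply: filterS f0 => x fx0 _; apply: cvg_EFin; first exact: nearW.
  rewrite (_ : _ \o _ = (fun N => cnorm (f N x) * cnorm (f N x))).
    by rewrite -[X in _ --> X](mulr0 (0 : R)); exact: cvgM.
  by apply/funext => N /=; rewrite -cnorm_sqr expr2.
- exact: ih.
- by apply/aeW => x N _ /=; rewrite lee_fin ger0_norm ?nsq_ge0.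
move=> _ _ h0.
have {}h0 : (fun N => L2sq (f N)) @ \oo --> (0 : R).
  have {}h0 : (\int[mu]_x (nsq (f N x))%:E)%E @[N --> \oo] --> (0 : R)%:E.
    by move: h0; rewrite integral_cst// mul0e.
  exact: (fine_cvg h0).
rewrite (_ : (fun N => _) = (fun N => Num.sqrt (L2sq (f N)))); last first.
  by apply/funext => N; rewrite L2normE.
rewrite -[X in _ --> X]sqrtr0.
exact: (continuous_cvg _ (@sqrt_continuous R 0)).
Qed.

End L2Theory.

Section MeasurePreserving.
Context {R : realType} {d : measure_display} {T : measurableType d}.
Variables (mu : {measure set T -> \bar R}) (S : T -> T).
Hypotheses (mS : measurable_fun setT S) (pS : preserves_measure S mu).

Lemma ge0_integral_preserves (f : T -> \bar R) : measurable_fun setT f ->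
  (forall x, 0 <= f x)%E ->
  (\int[mu]_x f (S x) = \int[mu]_x f x)%E.
Proof.
move=> mf f0; rewrite -(@ge0_integral_pushforward _ _ _ _ _ S mS mu setT f)//.
by apply: eq_measure_integral => A mA _; rewrite /= /pushforward pS.
Qed.

Lemma integrable_preserves (f : T -> \bar R) : mu.-integrable setT f ->
  mu.-integrable setT (f \o S).
Proof.
move=> /integrableP[mf fi]; apply/integrableP; split.
  exact: measurableT_comp.
rewrite (@ge0_integral_preserves (fun x => `|f x|%E))//.
exact: measurableT_comp.
Qed.

Lemma integral_preserves (f : T -> \bar R) : mu.-integrable setT f ->
  (\int[mu]_x f (S x) = \int[mu]_x f x)%E.
Proof.
move=> fi; have [mf _] := integrableP _ _ _ fi.
rewrite -(@integral_pushforward _ _ _ _ _ S mS mu setT f)//; last first.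
  by rewrite preimage_setT; exact: integrable_preserves.
by apply: eq_measure_integral => A mA _; rewrite /= /pushforward pS.
Qed.

Lemma cintegral_preserves (f : T -> R[i]) : cintegrable mu f ->
  cintegral mu (f \o S) = cintegral mu f.
Proof.
move=> [f1 f2]; rewrite /cintegral /Rintegral.
congr (fine _ +i* fine _).
  exact: (integral_preserves f1).
exact: (integral_preserves f2).
Qed.

Lemma L2_preserves (f : T -> R[i]) : L2 mu f -> L2 mu (f \o S).
Proof.
move=> /L2P[mf fi]; apply/L2P; split; first exact: cmeas_comp.
exact: (integrable_preserves fi).
Qed.

Lemma L2inner_preserves (f g : T -> R[i]) : L2 mu f -> L2 mu g ->
  L2inner mu (f \o S) (g \o S) = L2inner mu f g.
Proof.
move=> Lf Lg; rewrite /L2inner.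
exact: (cintegral_preserves (L2_prod Lf Lg)).
Qed.

Lemma L2norm_preserves (f : T -> R[i]) : L2 mu f ->
  L2norm mu (f \o S) = L2norm mu f.
Proof. by move=> Lf; rewrite /L2norm L2inner_preserves. Qed.

Lemma ae_preserves (P : T -> Prop) : {ae mu, forall x, P x} ->
  {ae mu, forall x, P (S x)}.
Proof.
move=> [N [mN N0 PN]]; exists (S @^-1` N); split.
- by rewrite -[X in measurable X]setTI; exact: mS.
- by rewrite pS.
- by move=> x /= nP; apply: PN.
Qed.

End MeasurePreserving.

(** * Birkhoff averages of bounded functions *)

Section BoundedFunctions.
Context {R : realType} {d : measure_display} {T : measurableType d}.
Variable P : probability T R.

Lemma bounded_integrable (M : R) (f : T -> R) : measurable_fun setT f ->
  (forall x, `|f x| <= M) -> P.-integrable setT (EFin \o f).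
Proof.
move=> mf fM; apply: (@le_integrable _ _ _ _ _ _ _ (cst M%:E)) => //.
- exact/measurable_EFinP.
- by move=> x _ /=; rewrite lee_fin; exact: le_trans (fM x) (ler_norm _).
- exact: finite_measure_integrable_cst.
Qed.

Lemma bounded_cvg_Rintegral (M : R) (f : (T -> R) ^nat) (g : T -> R) :
  (forall n, measurable_fun setT (f n)) -> measurable_fun setT g ->
  (forall n x, `|f n x| <= M) ->
  {ae P, forall x, f n x @[n --> \oo] --> g x} ->
  Rintegral P setT (f n) @[n --> \oo] --> Rintegral P setT g.
Proof.
move=> mf mg fM fg.
have [] := @dominated_convergence _ _ _ P setT measurableT
  (fun N x => (f N x)%:E) (EFin \o g) (cst M%:E).
- by move=> N; exact/measurable_EFinP.
- exact/measurable_EFinP.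
- by apply: filterS fg => x fx0 _; apply: cvg_EFin => //; exact: nearW.
- exact: finite_measure_integrable_cst.
- by apply/aeW => x N _ /=; rewrite lee_fin.
move=> ig _ h0; apply: fine_cvg; rewrite fineK//.
exact: integrable_fin_num.
Qed.

Lemma Rintegral_cst_probability (c : R) : Rintegral P setT (fun=> c) = c.
Proof. rewrite (@Rintegral_cst _ _ _ P setT measurableT c) -[X in fine X]/(P setT) probability_setT /= mulr1 //. Qed.

End BoundedFunctions.

Section Ergodic.
Context {R : realType} {d : measure_display} {T : measurableType d}.
Variables (P : probability T R) (S : T -> T).
Hypothesis mS : measurable_fun setT S.

(** The measure conditioned on an invariant set is again invariant, so unique
    ergodicity forces it to be [P] itself. *)
Lemma uniquely_ergodic_trivial (A : set T) : uniquely_ergodic S P ->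
  measurable A -> S @^-1` A = A -> P A = 0%E \/ P A = 1%E.
Proof.
move=> [pS uS] mA SA; have [->|PA0] := eqVneq (P A) 0%E; [by left|right].
pose Q : probability T R := mnormalize (mrestr P mA) P.
have QE B : Q B = (P (B `&` A) * (fine (P A))^-1%:E)%E.
  have TA : mrestr P mA setT = P A by rewrite /mrestr setTI.
  rewrite /Q /= /mnormalize /= TA (negbTE PA0) /=.
  by rewrite lt_eqF// (le_lt_trans (probability_le1 _ mA))// ltry.
have pQ : preserves_measure S Q.
  move=> B mB; rewrite !QE -{1}SA -preimage_setI pS//.
  exact: measurableI.
have := uS Q pQ A mA; rewrite QE setIid => <-.
have PAfin : P A \is a fin_num by exact: fin_num_measure.
by rewrite -{1}(fineK PAfin) -EFinM divff// fine_eq0.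
Qed.

Definition birkhoff (f : T -> R) (n : nat) (x : T) : R :=
  \sum_(i < n) f (iter i S x).

Lemma birkhoffS f n x : birkhoff f n.+1 x = f x + birkhoff f n (S x).
Proof.
rewrite /birkhoff big_ord_recl /=; congr (_ + _).
by apply: eq_bigr => i _; rewrite -iterSr.
Qed.

Lemma measurable_iter i : measurable_fun setT (iter i S).
Proof.
elim: i => [|i IH]; first exact: measurable_id.
exact: measurableT_comp.
Qed.

Lemma measurable_birkhoff f n : measurable_fun setT f ->
  measurable_fun setT (birkhoff f n).
Proof.
move=> mf; apply: measurable_sum => i.
by apply: measurableT_comp => //; exact: measurable_iter.
Qed.

(** [maxsum f n x] is the maximum of [0] and of the sums [birkhoff f k x],
    [k <= n]; the recursion on [n] is what the maximal inequality needs. *)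
Fixpoint maxsum (f : T -> R) (n : nat) (x : T) : R :=
  if n is n'.+1 then Num.max 0 (f x + maxsum f n' (S x)) else 0.

Lemma maxsum_ge0 f n x : 0 <= maxsum f n x.
Proof. by case: n => [|n] //=; rewrite le_max lexx. Qed.

Lemma maxsum_leS f n x : maxsum f n x <= maxsum f n.+1 x.
Proof.
elim: n x => [|n IH] x; first by rewrite maxsum_ge0.
rewrite /= ge_max !le_max lexx /= lerD2l.
by rewrite -[X in _ || X]/(maxsum f n (S x) <= maxsum f n.+1 (S x)) IH orbT.
Qed.

Lemma maxsum_ge f n m x : (n <= m)%N -> maxsum f n x <= maxsum f m x.
Proof.
move=> /subnK <-; elim: (m - n)%N => //= k IH.
exact: le_trans IH (maxsum_leS _ _ _).
Qed.

Lemma birkhoff_le_maxsum f n x : birkhoff f n x <= maxsum f n x.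
Proof.
elim: n x => [|n IH] x; first by rewrite /birkhoff big_ord0.
by rewrite birkhoffS /= le_max lerD2l IH orbT.
Qed.

Lemma measurable_maxsum f n : measurable_fun setT f ->
  measurable_fun setT (maxsum f n).
Proof.
move=> mf; elim: n => [|n IH] /=; first exact: measurable_cst.
apply: measurable_maxr; first exact: measurable_cst.
by apply: measurable_funD => //; exact: measurableT_comp.
Qed.

Lemma measurable_gt (r : R) (h : T -> R) : measurable_fun setT h ->
  measurable [set y | r < h y].
Proof.
move=> mh; rewrite -[X in measurable X]setTI.
have := mh measurableT `]r, +oo[%classic (measurable_itv _).
by congr (measurable _); apply/seteqP; split=> x /=; rewrite in_itv /= andbT.
Qed.

Lemma measurable_maxsum_gt0 f n : measurable_fun setT f ->
  measurable [set y | 0 < maxsum f n y].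
Proof. by move=> mf; apply: measurable_gt; exact: measurable_maxsum. Qed.

Lemma maxsum_le (M : R) (f : T -> R) n x : (forall y, `|f y| <= M) ->
  `|maxsum f n x| <= n%:R * M.
Proof.
move=> fM; rewrite ger0_norm ?maxsum_ge0//.
have M0 : 0 <= M by exact: le_trans (fM x).
elim: n x => [|n IH] x /=; first by rewrite mul0r.
rewrite ge_max mulr_ge0//= -natr1 mulrDl mul1r addrC lerD//.
exact: le_trans (ler_norm _) (fM x).
Qed.

(** The maximal ergodic inequality, after Garsia. *)
Lemma maximal_ergodic (M : R) (f : T -> R) n : preserves_measure S P ->
  measurable_fun setT f -> (forall x, `|f x| <= M) ->
  0 <= Rintegral P setT (fun x => f x * \1_[set y | 0 < maxsum f n.+1 y] x).
Proof.
move=> pS mf fM.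
have mE := measurable_maxsum_gt0 n.+1 mf.
have iM := @bounded_integrable _ _ _ P _ _ (measurable_maxsum n.+1 mf)
  (fun x => maxsum_le n.+1 x fM).
have iMS : P.-integrable setT (EFin \o (maxsum f n.+1 \o S)).
  exact: (integrable_preserves mS pS iM).
have E : Rintegral P setT (fun x => maxsum f n.+1 x - maxsum f n.+1 (S x)) = 0.
  rewrite RintegralB//; apply/eqP; rewrite subr_eq0; apply/eqP.
  by rewrite /Rintegral -(integral_preserves mS pS iM).
rewrite -[leLHS]E; apply: le_Rintegral => //.
- by have := integrableB measurableT iM iMS; apply: eq_integrable.
- apply: (@bounded_integrable _ _ _ P M).
    by apply: measurable_funM => //; exact: measurable_indic.
  move=> x; rewrite normrM (le_trans _ (fM x))// ler_piMr//.
  by rewrite indicE; case: (_ \in _); rewrite ?normr1 ?normr0.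
- move=> x _; rewrite indicE.
  have [/set_mem /= h|/negP h] := boolP (x \in _); last first.
    rewrite mulr0; suff -> : maxsum f n.+1 x = 0 by rewrite sub0r oppr_le0 maxsum_ge0.
    apply/eqP; rewrite eq_le maxsum_ge0 andbT leNgt; apply/negP => h'.
    by apply: h; rewrite inE.
  rewrite mulr1 lerBlDr; apply: (@le_trans _ _ (f x + maxsum f n (S x))).
    move: h => /=; rewrite lt_max ltxx /= => h.
    by rewrite ge_max lexx ltW.
  by rewrite lerD2l; exact: maxsum_leS.
Qed.

(** The set where the sums are unbounded is invariant. If it had full measure,
    the functions of the maximal inequality would tend to [f] almost everywhere
    and the integral of [f] could not be negative. *)
Lemma birkhoff_bounded_above (M : R) (f : T -> R) : uniquely_ergodic S P ->
  measurable_fun setT f -> (forall x, `|f x| <= M) ->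
  Rintegral P setT f < 0 ->
  {ae P, forall x, exists K : R, forall n, birkhoff f n x <= K}.
Proof.
move=> eS mf fM f0; have pS : preserves_measure S P by case: eS.
pose A := \bigcap_(k : nat) \bigcup_(n : nat) [set x | k%:R < birkhoff f n x].
have mA : measurable A.
  apply: bigcapT_measurable => k; apply: bigcupT_measurable => n.
  by apply: measurable_gt; exact: measurable_birkhoff.
have bnd (r : R) : exists k : nat, r <= k%:R.
  by exists (Num.truncn `|r|).+1; rewrite (le_trans (ler_norm _))// ltW// truncnS_gt.
have SA : S @^-1` A = A.
  apply/seteqP; split => x /= Ax k _.
    have [k' hk'] := bnd (k%:R - f x).
    have [n _ /= h] := Ax k' I.
    exists n.+1 => //=; rewrite birkhoffS -ltrBlDl.
    exact: le_lt_trans h.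
  have [k' hk'] := bnd (k%:R + f x).
  have [[|n] _ /= h] := Ax k' I.
    by move: h; rewrite /birkhoff big_ord0 ltNge ler0n.
  exists n => //=; rewrite -(ltrD2l (f x)) -birkhoffS addrC.
  exact: le_lt_trans h.
have [PA0|PA1] := uniquely_ergodic_trivial eS mA SA.
  exists A; split=> // x /= nK; rewrite /A /= => k _.
  apply: contrapT => nk; apply: nK; exists k%:R => n.
  by rewrite leNgt; apply/negP => h; apply: nk; exists n.
have aeA : {ae P, forall x, A x}.
  exists (~` A); split=> //; first exact: measurableC.
  by rewrite probability_setC// PA1 subee.
suff : 0 <= Rintegral P setT f by rewrite leNgt f0.
pose g n x := f x * \1_[set y | 0 < maxsum f n.+1 y] x.
have gf : Rintegral P setT (g n) @[n --> \oo] --> Rintegral P setT f.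
  apply: (@bounded_cvg_Rintegral _ _ _ _ M) => //.
  - move=> n; apply: measurable_funM => //; apply: measurable_indic.
    exact: measurable_maxsum_gt0.
  - move=> n x; rewrite /g normrM (le_trans _ (fM x))// ler_piMr//.
    by rewrite indicE; case: (_ \in _); rewrite ?normr1 ?normr0.
  - apply: filterS aeA => x /(_ 0%N I)[n _ /= h].
    apply: cvg_near_cst; exists n => // m /= nm; rewrite /g indicE mem_set ?mulr1//=.
    rewrite -[X in _ < X]/(maxsum f m.+1 x).
    apply: (lt_le_trans h); apply: le_trans (birkhoff_le_maxsum _ _ _) _.
    by apply: maxsum_ge; exact: leqW.
rewrite -(cvg_lim _ gf)//; apply: limr_ge; first by apply/cvg_ex; eexists; exact: gf.
by apply: nearW => n; exact: (@maximal_ergodic M).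
Qed.

(** The Birkhoff sums of [f - c - 1/k] and of [c - 1/k - f], with [c] the integral
    of [f], have a negative integral; that both are bounded above at a point for
    all [k] is convergence of the averages to [c] there. *)
Lemma birkhoff_cvg (M : R) (f : T -> R) : uniquely_ergodic S P ->
  measurable_fun setT f -> (forall x, `|f x| <= M) ->
  {ae P, forall x, (n%:R^-1 * birkhoff f n x) @[n --> \oo] -->
                   Rintegral P setT f}.
Proof.
move=> eS mf fM.
set c := Rintegral P setT f.
have iN : P.-integrable setT (EFin \o f) by exact: (@bounded_integrable _ _ _ P M).
have ic (b : R) : P.-integrable setT (EFin \o (cst b : T -> R)).
  exact: finite_measure_integrable_cst.
have shift (b : R) : Rintegral P setT (fun x => f x - b) = c - b.
  rewrite (RintegralB measurableT iN (ic b)); congr (_ - _).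
  exact: Rintegral_cst_probability.
have shift' (b : R) : Rintegral P setT (fun x => b - f x) = b - c.
  rewrite (RintegralB measurableT (ic b) iN); congr (_ - _).
  exact: Rintegral_cst_probability.
pose up k x := f x - (c + k.+1%:R^-1) : R.
pose dn k x := (c - k.+1%:R^-1) - f x : R.
have mcst (b : R) : measurable_fun setT (cst b : T -> R) by exact: measurable_cst.
have Hup k : {ae P, forall x, exists K : R, forall n, birkhoff (up k) n x <= K}.
  apply: (@birkhoff_bounded_above (M + `|c + k.+1%:R^-1|)) => //.
  - exact: measurable_funB.
  - by move=> x; rewrite (le_trans (ler_normB _ _))// lerD2r.
  - rewrite shift.
    by rewrite opprD addrA subrr sub0r oppr_lt0 invr_gt0.
have Hdn k : {ae P, forall x, exists K : R, forall n, birkhoff (dn k) n x <= K}.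
  apply: (@birkhoff_bounded_above (M + `|c - k.+1%:R^-1|)) => //.
  - exact: measurable_funB.
  - by move=> x; rewrite (le_trans (ler_normB _ _))// addrC lerD2r.
  - rewrite shift'.
    by rewrite addrAC subrr sub0r oppr_lt0 invr_gt0.
have {}Hup := ae_foralln Hup; have {}Hdn := ae_foralln Hdn.
apply: filterS2 Hup Hdn => x Hu Hd.
apply/cvgrPdist_le => e e0.
have [k hk] : exists k : nat, k.+1%:R^-1 <= e / 2.
  have e2 : 0 < e / 2 by rewrite divr_gt0.
  exists (Num.truncn (e / 2)^-1); rewrite invf_ple ?posrE//.
  by rewrite ltW// truncnS_gt.
have [K hK] := Hu k; have [L hL] := Hd k.
have birkB n a : birkhoff (fun y => f y - a) n x = birkhoff f n x - n%:R * a.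
  by rewrite /birkhoff sumrB sumr_const card_ord mulr_natl.
have birkB' n a : birkhoff (fun y => a - f y) n x = n%:R * a - birkhoff f n x.
  by rewrite /birkhoff sumrB sumr_const card_ord mulr_natl.
near=> n.
have n0 : 0 < n%:R :> R by rewrite ltr0n; near: n; exists 1%N.
have nK : `|K| + `|L| <= n%:R * (e / 2).
  rewrite -ler_pdivrMr ?divr_gt0//; near: n.
  by exists (Num.truncn ((`|K| + `|L|) / (e / 2))).+1 => // m /= hm;
    rewrite (le_trans (ltW (truncnS_gt _)))// ler_nat.
have nk : n%:R * k.+1%:R^-1 <= n%:R * (e / 2) by rewrite ler_wpM2l// ltW.
have h1 : birkhoff f n x <= n%:R * (c + e).
  have := hK n; rewrite /up birkB !mulrDr (splitr e) mulrDr.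
  move: (n%:R * _) (n%:R * c) (n%:R * (e / 2)) nk nK => A B C nk nK.
  have := ler_norm K; have := normr_ge0 L; lra.
have h2 : n%:R * (c - e) <= birkhoff f n x.
  have := hL n; rewrite /dn birkB' !mulrBr (splitr e) mulrDr.
  move: (n%:R * _) (n%:R * c) (n%:R * (e / 2)) nk nK => A B C nk nK.
  have := ler_norm L; have := normr_ge0 K; lra.
rewrite ler_norml; apply/andP; split.
  by rewrite lerBrDr addrC lerBlDr ler_pdivrMl// addrC.
by rewrite lerBlDr -lerBlDl ler_pdivlMl.
Unshelve. all: by end_near.
Qed.

End Ergodic.

(** * The representations of U(2) as matrix-valued functions *)

Section SymmetricPowers.
Context {R : realType}.
Implicit Types (A B : 'M[R[i]]_2) (p q : {poly R[i]}) (w : 'rV[R[i]]_2).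

Definition homog (l : nat) p w : R[i] :=
  \sum_(j < l.+1) p`_j * monom l j w.

Lemma homogM (l1 l2 : nat) p q w : (size p <= l1.+1)%N -> (size q <= l2.+1)%N ->
  homog (l1 + l2) (p * q) w = homog l1 p w * homog l2 q w.
Proof.
move=> sp sq; rewrite /homog /monom.
have horn l (r : {poly R[i]}) : (size r <= l.+1)%N -> w 0 1 != 0 ->
    \sum_(j < l.+1) r`_j * (w 0 0 ^+ j * w 0 1 ^+ (l - j)) =
    w 0 1 ^+ l * r.[w 0 0 / w 0 1].
  move=> sr w0; rewrite (horner_coef_wide _ sr) mulr_sumr.
  apply: eq_bigr => j _; have jl : (j <= l)%N by rewrite -ltnS.
  rewrite [RHS]mulrCA; congr (_ * _).
  rewrite -[X in _ = _ ^+ X * _](subnK jl) exprD expr_div_n mulrACA.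
  by rewrite divff ?expf_neq0// mulr1 mulrC.
have [w0|w0] := eqVneq (w 0 1) 0; last first.
  rewrite !horn//; first by rewrite hornerM exprD mulrACA.
  rewrite (leq_trans (size_polyMleq _ _))// -subn1 leq_subLR add1n.
  by rewrite (leq_trans (leq_add sp sq))// addSn addnS.
have top l (r : {poly R[i]}) : \sum_(j < l.+1) r`_j * (w 0 0 ^+ j * w 0 1 ^+ (l - j)) =
    r`_l * w 0 0 ^+ l.
  rewrite big_ord_recr /= subnn expr0 mulr1 big1 ?add0r// => j _.
  by rewrite w0 expr0n subn_eq0 leqNgt ltn_ord !mulr0.
rewrite !top exprD mulrACA; congr (_ * _).
rewrite coefM (bigD1 (inord l1 : 'I_(l1 + l2).+1))//= inordK; last first.
  by rewrite ltnS leq_addr.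
rewrite addKn big1 ?addr0// => j /eqP jl.
have [jl1|jl1] := ltnP l1 j; first by rewrite nth_default ?mul0r// (leq_trans sp).
rewrite [q`__]nth_default ?mulr0// (leq_trans sq)// ltn_subRL.
rewrite ltn_add2r ltn_neqAle jl1 andbT; apply/eqP => e.
by apply: jl; apply: val_inj; rewrite /= inordK ?e// ltnS leq_addr.
Qed.

Definition colpoly A (b : 'I_2) : {poly R[i]} := A 0 b *: 'X + (A 1 b)%:P.

Lemma size_colpoly A b : (size (colpoly A b) <= 2)%N.
Proof.
rewrite (leq_trans (size_polyD _ _))// geq_max (leq_trans (size_scale_leq _ _)) ?size_polyX//=.
by rewrite (leq_trans (size_polyC_leq1 _)).
Qed.

Lemma homog_colpoly A b w : homog 1 (colpoly A b) w = (w *m A) 0 b.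
Proof.
rewrite /homog !big_ord_recl big_ord0 /monom /colpoly mxE.
rewrite !coefD !coefZ !coefX !coefC /= !(mulr0, mulr1, mul1r, expr0, expr1, add0r, addr0).
rewrite big_ord_recl big_ord1.
rewrite [lift ord0 ord0](_ : _ = 1); last exact: val_inj.
by rewrite addrC; congr (_ + _); exact: mulrC.
Qed.

Lemma size_colpolyX A b k : (size (colpoly A b ^+ k) <= k.+1)%N.
Proof.
elim: k => [|k IH]; first by rewrite expr0 size_poly1.
rewrite exprS (leq_trans (size_polyMleq _ _))// -subn1 leq_subLR add1n.
by rewrite (leq_trans (leq_add (size_colpoly A b) IH)).
Qed.

Lemma homog_colpolyX A b k w : homog k (colpoly A b ^+ k) w = (w *m A) 0 b ^+ k.
Proof.
elim: k => [|k IH].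
  by rewrite /homog big_ord1 expr0 coef1 /monom /= !expr0 !mulr1.
rewrite exprS -[k.+1]add1n homogM ?size_colpoly ?size_colpolyX//.
by rewrite IH homog_colpoly -exprS.
Qed.

Lemma homogE (l : nat) p : homog l p = hpoly (\row_(j < l.+1) p`_j).
Proof. by apply/funext => w; apply: eq_bigr => j _; rewrite mxE. Qed.

(** The dehomogenisation of [monom l k] composed with [A]. *)
Definition actpoly (l k : nat) A : {poly R[i]} :=
  colpoly A 0 ^+ k * colpoly A 1 ^+ (l - k).

Lemma poly_act_monom (l k : nat) A : (k <= l)%N ->
  poly_act A (monom l k) = hpoly (\row_(j < l.+1) (actpoly l k A)`_j).
Proof.
move=> kl; rewrite -homogE; apply/funext => w.
rewrite /poly_act {1}/monom -!homog_colpolyX.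
by rewrite -{3}(subnKC kl) -homogM ?size_colpolyX.
Qed.

(** The matrix of the action of [A] on homogeneous polynomials of degree [l] in
    the basis of monomials. *)
Definition cmx (l : nat) A : 'M[R[i]]_l.+1 :=
  \matrix_(i, k) (actpoly l k A)`_i.

Lemma poly_act_cmx (l : nat) (k : 'I_l.+1) A :
  poly_act A (monom l k) = hpoly (col k (cmx l A))^T.
Proof.
rewrite poly_act_monom -1?ltnS//; congr (hpoly _).
by apply/rowP => i; rewrite !mxE.
Qed.

Lemma hcoef_monom (l : nat) (j : 'I_l.+1) :
  hcoef l (monom l j) = delta_mx (0 : 'I_1) j :> 'rV[R[i]]_l.+1.
Proof.
rewrite -[RHS]hpolyK; congr (hcoef l _); apply/funext => w.
rewrite /hpoly (bigD1 j)//= mxE !eqxx mul1r big1 ?addr0// => i /negPf ij.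
by rewrite mxE ij mul0r.
Qed.

Lemma rep_elt_cmx (l : nat) (j k : 'I_l.+1) A :
  rep_elt j k A = (j`! * (l - j)`!)%:R * cmx l A j k.
Proof.
rewrite /rep_elt /hinner poly_act_cmx hpolyK hcoef_monom (bigD1 j)//=.
rewrite big1 ?addr0 => [|i /negPf ij]; last by rewrite !mxE ij conjc0 mulr0.
by rewrite !mxE !eqxx conjc1 mulr1.
Qed.

(** Composition of the substitutions [w |-> w A] and [w |-> w B]; the coefficients
    of a homogeneous polynomial are determined by its values. *)
Lemma cmxM (l : nat) A B : cmx l (A *m B) = cmx l A *m cmx l B.
Proof.
apply/matrixP => i k.
have E : hpoly (col k (cmx l (A *m B)))^T = hpoly (col k (cmx l A *m cmx l B))^T.
  rewrite -poly_act_cmx; apply/funext => w.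
  transitivity (poly_act B (monom l k) (w *m A)).
    by rewrite /poly_act mulmxA.
  rewrite poly_act_cmx /hpoly.
  transitivity (\sum_(j < l.+1) cmx l B j k *
     hpoly (col j (cmx l A))^T w).
    by apply: eq_bigr => j _; rewrite -poly_act_cmx !mxE.
  rewrite /hpoly; under eq_bigr do rewrite mulr_sumr.
  rewrite exchange_big /=; apply: eq_bigr => a _; rewrite !mxE mulr_suml.
  by apply: eq_bigr => b _; rewrite !mxE mulrCA mulrA.
have := congr1 (hcoef l) E; rewrite !hpolyK => /rowP/(_ i).
by rewrite !mxE => ->.
Qed.

Lemma cmx_diag (l : nat) (a b : R[i]) :
  cmx l (diag_mx (\row_i (if i == 0 then a else b))) =
  diag_mx (\row_(k < l.+1) (a ^+ k * b ^+ (l - k))).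
Proof.
apply/matrixP => i k; rewrite !mxE /actpoly /colpoly !mxE /=.
rewrite !mulr1n !mulr0n scale0r polyC0 add0r addr0.
rewrite exprZn -polyC_exp mulrC mul_polyC !coefZ coefXn.
rewrite -val_eqE /=; case: eqP => [->|_]; last by rewrite !mulr0 mulr0n.
by rewrite mulr1 mulr1n mulrC.
Qed.

Lemma cmx_scalar (l : nat) (z : R[i]) : cmx l z%:M = (z ^+ l)%:M.
Proof.
have -> : z%:M = diag_mx (\row_(i < 2) (if i == 0 then z else z)).
  by apply/matrixP => i j; rewrite !mxE if_same.
rewrite cmx_diag; apply/matrixP => i k; rewrite !mxE.
by rewrite -exprD subnKC // -ltnS.
Qed.

Lemma cmxZ (l : nat) (z : R[i]) A : cmx l (z *: A) = z ^+ l *: cmx l A.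
Proof. by rewrite -mul_scalar_mx cmxM cmx_scalar mul_scalar_mx. Qed.

End SymmetricPowers.

Section U2.
Context {R : realType}.
Implicit Types g h : U2 R.

Lemma U2_entry_le1 g a b : cnorm (U2mx g a b) <= 1.
Proof.
have /unitarymxP/matrixP/(_ a a) := U2mx_unitary g.
rewrite !mxE eqxx => E.
have {}E : \sum_j nsq (U2mx g a j) = 1.
  have /(congr1 Re) := E; rewrite Re_sum /= => <-; apply: eq_bigr => j _.
  by rewrite !mxE -[_ * _](nsqE (U2mx g a j)).
rewrite -(ler_pXn2r (n := 2)) ?nnegrE ?cnorm_ge0// cnorm_sqr expr1n -E.
by rewrite (bigD1 b)//= lerDl sumr_ge0// => j _; exact: nsq_ge0.
Qed.

Lemma U2_det_nsq g : \det (U2mx g) * conjc (\det (U2mx g)) = 1.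
Proof.
have /unitarymxP/(congr1 (@determinant _ _)) := U2mx_unitary g.
by rewrite det_mulmx det_map_mx det_tr det1.
Qed.

Lemma U2_det_neq0 g : \det (U2mx g) != 0.
Proof.
apply/eqP => h; have := U2_det_nsq g; rewrite h mul0r => /eqP.
by rewrite eq_sym oner_eq0.
Qed.

Lemma U2_det_inv g : (\det (U2mx g))^-1 = conjc (\det (U2mx g)).
Proof.
by apply: (mulfI (U2_det_neq0 g)); rewrite U2_det_nsq divff ?U2_det_neq0.
Qed.

Lemma U2mxM g h : U2mx (g * h)%g = U2mx g *m U2mx h. Proof. by []. Qed.

Lemma U2mx1 : U2mx (1%g : U2 R) = 1%:M. Proof. by []. Qed.

Lemma U2mxV g : U2mx (g^-1)%g = map_mx conjc (U2mx g)^T.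
Proof.
have gu : U2mx g \in unitmx by rewrite unitarymx_unit ?U2mx_unitary.
apply: (can_inj (mulKmx gu)); rewrite [LHS]mulmxV//.
by have /unitarymxP -> := U2mx_unitary g.
Qed.

(** The representation with highest weights given by [l] and [m], in the basis
    of monomials: in this basis it is multiplicative but not unitary. *)
Definition rho (l : nat) (m : int) g : 'M[R[i]]_l.+1 :=
  \det (U2mx g) ^ (m - l%:Z) *: cmx l (U2mx g).

(** The squared norm of the monomial of index [j] in V_l. *)
Definition weight (l : nat) (j : 'I_l.+1) : R[i] := (j`! * (l - j)`!)%:R.

Lemma weight_neq0 (l : nat) (j : 'I_l.+1) : weight j != 0.
Proof. by rewrite /weight pnatr_eq0 -lt0n muln_gt0 !fact_gt0. Qed.

(** With [z] a square root of the determinant of [g], homogeneity gives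
    [z^(2m-l) cmx (z^-1 g) = z^(2m-2l) cmx g], and [z^2] is the determinant: the
    square root disappears. *)
Lemma U2_rep_elt_rho (l : nat) (m : int) (j k : 'I_l.+1) g :
  U2_rep_elt m j k g = weight j * rho l m g j k.
Proof.
rewrite /U2_rep_elt rep_elt_cmx cmxZ /rho !mxE.
set D := \det _; set z := sqrtC D.
have z0 : z != 0 by rewrite sqrtC_eq0 U2_det_neq0.
rewrite -[D]sqrtCK -/z mulrCA; congr (_ * _); rewrite mulrA; congr (_ * _).
rewrite exprVn exprnN -expfzDr// [z ^+ 2]exprnP exprz_exp; congr (z ^ _).
ring.
Qed.

Lemma rhoM (l : nat) (m : int) g h :
  rho l m (g * h)%g = rho l m g *m rho l m h.
Proof.
rewrite /rho U2mxM cmxM det_mulmx expfzMl -scalemxAr -scalemxAl scalerA.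
by rewrite mulrC.
Qed.

Lemma rho1 (l : nat) (m : int) : rho l m 1%g = 1%:M.
Proof. by rewrite /rho U2mx1 det1 exp1rz scale1r cmx_scalar expr1n. Qed.

Lemma rhoV (l : nat) (m : int) g : rho l m g *m rho l m g^-1%g = 1%:M.
Proof. by rewrite -rhoM mulgV rho1. Qed.

Lemma rhoVl (l : nat) (m : int) g : rho l m g^-1%g *m rho l m g = 1%:M.
Proof. by rewrite -rhoM mulVg rho1. Qed.

End U2.

(** The closure properties shared by all the classes of functions met below:
    matrix coefficients of the representations composed with a map into U(2)
    belong to any such class that contains the matrix entries of the map. *)
Record conj_algebra {R : realType} {T : Type} (C : (T -> R[i]) -> Prop) : Prop := {
  calg_cst : forall c, C (fun=> c);
  calgD : forall f g, C f -> C g -> C (fun x => f x + g x);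
  calgM : forall f g, C f -> C g -> C (fun x => f x * g x);
  calgJ : forall f, C f -> C (fun x => conjc (f x)) }.

Section ConjAlgebra.
Context {R : realType} {T : Type} {C : (T -> R[i]) -> Prop}.
Hypothesis CA : conj_algebra C.

Lemma calg_sum (I : Type) (s : seq I) (f : I -> T -> R[i]) :
  (forall i, C (f i)) -> C (fun x => \sum_(i <- s) f i x).
Proof.
move=> Cf; elim: s => [|i s IH].
  by rewrite (_ : (fun _ => _) = (fun=> 0)); [exact: (calg_cst CA)|
    apply/funext => x; rewrite big_nil].
rewrite (_ : (fun _ => _) = (fun x => f i x + \sum_(i <- s) f i x)).
  exact: (calgD CA).
by apply/funext => x; rewrite big_cons.
Qed.

Lemma calgX (f : T -> R[i]) n : C f -> C (fun x => f x ^+ n).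
Proof.
move=> Cf; elim: n => [|n IH].
  by rewrite (_ : (fun _ => _) = (fun=> 1)); [exact: (calg_cst CA)|
    apply/funext => x; rewrite expr0].
rewrite (_ : (fun _ => _) = (fun x => f x * f x ^+ n)).
  exact: (calgM CA).
by apply/funext => x; rewrite exprS.
Qed.

Lemma calg_mulmx (n p q : nat) (A : T -> 'M[R[i]]_(n, p)) (B : T -> 'M[R[i]]_(p, q)) :
  (forall a b, C (fun x => A x a b)) -> (forall a b, C (fun x => B x a b)) ->
  forall a b, C (fun x => (A x *m B x) a b).
Proof.
move=> CAx CB a b.
rewrite (_ : (fun _ => _) = (fun x => \sum_j A x a j * B x j b)).
  by apply: calg_sum => j; exact: (calgM CA).
by apply/funext => x; rewrite mxE.
Qed.

Lemma calg_polyM (p q : T -> {poly R[i]}) :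
  (forall i, C (fun x => (p x)`_i)) -> (forall i, C (fun x => (q x)`_i)) ->
  forall i, C (fun x => (p x * q x)`_i).
Proof.
move=> Cp Cq i.
rewrite (_ : (fun _ => _) = (fun x => \sum_(j < i.+1) (p x)`_j * (q x)`_(i - j))).
  by apply: calg_sum => j; exact: (calgM CA).
by apply/funext => x; rewrite coefM.
Qed.

Lemma calg_polyX (p : T -> {poly R[i]}) n :
  (forall i, C (fun x => (p x)`_i)) -> forall i, C (fun x => (p x ^+ n)`_i).
Proof.
move=> Cp; elim: n => [|n IH] i.
  rewrite (_ : (fun _ => _) = (fun=> (1 : {poly R[i]})`_i)); first exact: (calg_cst CA).
  by apply/funext => x; rewrite expr0.
rewrite (_ : (fun _ => _) = (fun x => (p x * p x ^+ n)`_i)).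
  exact: calg_polyM.
by apply/funext => x; rewrite exprS.
Qed.

Lemma calg_colpoly (A : T -> 'M[R[i]]_2) (b : 'I_2) (i : nat) :
  (forall a b, C (fun x => A x a b)) -> C (fun x => (colpoly (A x) b)`_i).
Proof.
move=> CAx.
rewrite (_ : (fun _ => _) = (fun x => A x 0 b * ('X : {poly R[i]})`_i +
    A x 1 b * (1 : {poly R[i]})`_i)).
  by apply: (calgD CA); apply: (calgM CA (CAx _ _)); exact: (calg_cst CA).
apply/funext => x; rewrite /colpoly coefD coefZ coefC coef1.
by case: eqP; rewrite ?(mulr1, mulr0).
Qed.

Lemma calg_cmx (l : nat) (A : T -> 'M[R[i]]_2) (i k : 'I_l.+1) :
  (forall a b, C (fun x => A x a b)) -> C (fun x => cmx l (A x) i k).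
Proof.
move=> CAx; rewrite (_ : (fun _ => _) = (fun x => (actpoly l k (A x))`_i)).
  by apply: calg_polyM => {}i; apply: calg_polyX => {}i; exact: calg_colpoly.
by apply/funext => x; rewrite mxE.
Qed.

Lemma det_mx2 (A : 'M[R[i]]_2) : \det A = A 0 0 * A 1 1 - A 0 1 * A 1 0.
Proof.
rewrite (expand_det_row _ 0) !big_ord_recl big_ord0 addr0.
rewrite /cofactor !det_mx11 !mxE /= expr0 expr1 mul1r mulN1r mulrN.
by congr (A _ _ * A _ _ - A _ _ * A _ _); exact: val_inj.
Qed.

Lemma calg_det2 (A : T -> 'M[R[i]]_2) :
  (forall a b, C (fun x => A x a b)) -> C (fun x => \det (A x)).
Proof.
move=> CAx.
rewrite (_ : (fun _ => _) = (fun x => A x 0 0 * A x 1 1 + (-1) * (A x 0 1 * A x 1 0))).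
  apply: (calgD CA); first exact: (calgM CA (CAx _ _) (CAx _ _)).
  exact: (calgM CA (calg_cst CA _) (calgM CA (CAx _ _) (CAx _ _))).
by apply/funext => x; rewrite det_mx2 mulN1r.
Qed.

Lemma calg_det_exprz (f : T -> U2 R) (e : int) :
  (forall a b, C (fun x => U2mx (f x) a b)) ->
  C (fun x => \det (U2mx (f x)) ^ e).
Proof.
move=> Cf; case: e => n.
  by apply: calgX; exact: calg_det2.
rewrite (_ : (fun _ => _) = (fun x => conjc (\det (U2mx (f x))) ^+ n.+1)).
  by apply: calgX; apply: (calgJ CA); exact: calg_det2.
by apply/funext => x; rewrite NegzE -exprnN -exprVn U2_det_inv.
Qed.

Lemma calg_rho (l : nat) (m : int) (f : T -> U2 R) (i k : 'I_l.+1) :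
  (forall a b, C (fun x => U2mx (f x) a b)) -> C (fun x => rho l m (f x) i k).
Proof.
move=> Cf; rewrite (_ : (fun _ => _) = (fun x => \det (U2mx (f x)) ^ (m - l%:Z) * cmx l (U2mx (f x)) i k)).
  by apply: (calgM CA); [exact: calg_det_exprz|exact: calg_cmx].
by apply/funext => x; rewrite mxE.
Qed.

Lemma calg_U2V (f : T -> U2 R) :
  (forall a b, C (fun x => U2mx (f x) a b)) ->
  forall a b, C (fun x => U2mx (f x)^-1%g a b).
Proof.
move=> Cf a b; rewrite (_ : (fun _ => _) = (fun x => conjc (U2mx (f x) b a))).
  exact: (calgJ CA).
by apply/funext => x; rewrite U2mxV !mxE.
Qed.

End ConjAlgebra.

(** * Borel measurability on the manifold and on U(2) *)

Definition bm {R : realType} {d} {T : measurableType d} (f : T -> R[i]) : Prop :=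
  cmeas f /\ exists K : R, forall x, cnorm (f x) <= K.

Lemma bm_conj_algebra {R : realType} {d} {T : measurableType d} :
  conj_algebra (@bm R d T).
Proof.
have K0 (f : T -> R[i]) (K : R) : (forall x, cnorm (f x) <= K) ->
    forall x, cnorm (f x) <= `|K|.
  by move=> fK x; exact: le_trans (fK x) (ler_norm _).
split.
- by move=> c; split; [exact: cmeas_cst|exists (cnorm c)].
- move=> f g [mf [K fK]] [mg [L gL]]; split; first exact: cmeasD.
  by exists (K + L) => x; rewrite (le_trans (cnormD _ _))// lerD.
- move=> f g [mf [K fK]] [mg [L gL]]; split; first exact: cmeasM.
  exists (`|K| * `|L|) => x; rewrite cnormM ler_pM ?cnorm_ge0//; exact: K0.
- move=> f [mf [K fK]]; split; first exact: cmeasJ.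
  by exists K => x; rewrite cnormJ.
Qed.

Lemma bm_comp {R : realType} {d d'} {T : measurableType d}
    {T' : measurableType d'} (S : T' -> T) (f : T -> R[i]) :
  measurable_fun setT S -> bm f -> bm (f \o S).
Proof.
move=> mS [mf [K fK]]; split; first exact: cmeas_comp.
by exists K => x; exact: fK.
Qed.

Section Borel.
Context {R : realType}.

Lemma open_borel_measurable {Y : ptopologicalType} (U : set Y) : open U ->
  measurable (U : set (borel Y)).
Proof. exact: sub_sigma_algebra. Qed.

Lemma measurable_fun_borel {d} {T : measurableType d} {Y : ptopologicalType}
    (f : T -> borel Y) : (forall U : set Y, open U -> measurable (f @^-1` U)) ->
  measurable_fun setT f.
Proof.
move=> h; have := @measurability _ _ T (borel Y) setT f (@open Y) erefl; apply.
by move=> _ [U oU <-]; rewrite setTI; exact: h.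
Qed.

Lemma continuous_borel {Y Z : ptopologicalType} (f : Y -> Z) : continuous f ->
  measurable_fun setT (f : borel Y -> borel Z).
Proof.
move=> cf; apply: measurable_fun_borel => U oU; apply: open_borel_measurable.
exact: open_comp.
Qed.

Lemma continuous_measurable_real {Y : ptopologicalType} (f : Y -> R) :
  continuous f -> measurable_fun setT (f : borel Y -> R).
Proof.
move=> cf; apply: (@measurability _ _ _ _ _ _ (@RGenOInfty.G R)) => //.
  exact: RGenOInfty.measurableE.
move=> _ [_ [r ->] <-]; rewrite setTI; apply: open_borel_measurable.
by apply: open_comp => // x _; exact: cf.
Qed.

Lemma Re_continuous : continuous (fun z : R[i] => Re z).
Proof.
move=> z; have FF : Filter (nbhs z) := nbhs_filter z.
apply/(@cvgrPdist_lt _ R^o _ _ FF) => e e0.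
have e0C : 0 < e%:C by rewrite ltcR.
apply: filterS (nbhsx_ballx z _ e0C) => w.
rewrite -ball_normE /= cnormE ltcR => /(le_lt_trans _); apply.
by rewrite -ReN -ReD; exact: Re_le_cnorm.
Qed.

Lemma Im_continuous : continuous (fun z : R[i] => Im z).
Proof.
move=> z; have FF : Filter (nbhs z) := nbhs_filter z.
apply/(@cvgrPdist_lt _ R^o _ _ FF) => e e0.
have e0C : 0 < e%:C by rewrite ltcR.
apply: filterS (nbhsx_ballx z _ e0C) => w.
rewrite -ball_normE /= cnormE ltcR => /(le_lt_trans _); apply.
by rewrite -ImN -ImD; exact: Im_le_cnorm.
Qed.

Lemma U2mx_continuous : continuous (@U2mx R).
Proof. exact: initial_continuous. Qed.

Lemma bm_U2_entry (a b : 'I_2) :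
  bm (fun g : borel (U2 R) => U2mx g a b).
Proof.
have ce : continuous (fun g : U2 R => U2mx g a b).
  move=> g; apply: (@continuous_comp _ _ _ (@U2mx R) (fun M => M a b)).
    exact: U2mx_continuous.
  exact: coord_continuous.
split; last by exists 1 => g; exact: U2_entry_le1.
split; apply: continuous_measurable_real => g.
  apply: (@continuous_comp _ _ _ (fun g : U2 R => U2mx g a b) (fun z => Re z)).
    exact: ce.
  exact: Re_continuous.
apply: (@continuous_comp _ _ _ (fun g : U2 R => U2mx g a b) (fun z => Im z)).
  exact: ce.
exact: Im_continuous.
Qed.

(** Rational boxes form a countable base of the topology of the matrices, so
    that a map into U(2) is measurable as soon as its entries are. *)
Lemma measurable_U2 {d} {T : measurableType d} (f : T -> borel (U2 R)) :
  (forall a b, cmeas (fun x => U2mx (f x) a b)) -> measurable_fun setT f.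
Proof.
move=> mf; apply: measurable_fun_borel => _ [V oV <-].
pose Idx := ({ffun 'I_2 * 'I_2 -> rat * rat} * nat)%type.
pose Box (i : Idx) : set 'M[R[i]]_2 := [set A | forall ab : 'I_2 * 'I_2,
  `|Re (A ab.1 ab.2) - ratr (i.1 ab).1| < i.2.+1%:R^-1 /\
  `|Im (A ab.1 ab.2) - ratr (i.1 ab).2| < i.2.+1%:R^-1].
have mBox i : measurable [set x | Box i (U2mx (f x))].
  rewrite (_ : [set x | _] = \bigcap_(ab in [set: 'I_2 * 'I_2])
    ([set x | `|Re (U2mx (f x) ab.1 ab.2) - ratr (i.1 ab).1| < i.2.+1%:R^-1] `&`
     [set x | `|Im (U2mx (f x) ab.1 ab.2) - ratr (i.1 ab).2| < i.2.+1%:R^-1])).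
    apply: fin_bigcap_measurable; first exact: finite_finset.
    move=> ab _; have [m1 m2] := mf ab.1 ab.2.
    have lt_meas (h : T -> R) (c r : R) : measurable_fun setT h ->
        measurable [set x | `|h x - c| < r].
      move=> mh; rewrite -[X in measurable X]setTI.
      have mh' : measurable_fun setT (fun x => `|h x - c|).
        by apply: measurableT_comp => //; apply: measurable_funB.
      have := mh' measurableT `]-oo, r[%classic (measurable_itv _).
      by congr (measurable _); apply/seteqP; split=> x /=; rewrite in_itv.
    by apply: measurableI; exact: lt_meas.
  apply/seteqP; split=> x /=; first by move=> h ab _; exact: h.
  by move=> h ab; exact: (h ab I).
rewrite (_ : _ @^-1` _ = \bigcup_n (if unpickle n is Some i then
    if `[< Box i `<=` V >] then [set x | Box i (U2mx (f x))] else set0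
    else set0)); last first.
  apply/seteqP; split=> x /=; last first.
    move=> [n _]; case: (unpickle n) => // i; case: ifPn => // /asboolP BV Bx.
    exact: BV.
  move=> Vx; have [P nP PV] : nbhs (U2mx (f x)) V by apply: open_nbhs_nbhs; split.
  have /choice[e0 he0] : forall ab : 'I_2 * 'I_2, exists e : R, 0 < e /\
      forall z, cnorm (U2mx (f x) ab.1 ab.2 - z) < e -> P ab.1 ab.2 z.
    move=> ab; have /nbhs_ballP[e /= e_gt0 eP] := nP ab.1 ab.2.
    have eE : e = (Re e)%:C.
      by case: e e_gt0 {eP} => a b; rewrite ltcE /= => /andP[/eqP -> _].
    exists (Re e); split; first by rewrite -ltcR -eE.
    by move=> z hz; apply: eP; rewrite -ball_normE /= cnormE eE ltcR.
  have [k hk] : exists k : nat, forall ab, 4 * k.+1%:R^-1 < e0 ab.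
    have [k hk] : exists k : nat, forall ab, 4 / e0 ab < k.+1%:R.
      exists (\max_(ab : 'I_2 * 'I_2) Num.truncn (4 / e0 ab)) => ab.
      rewrite (lt_le_trans (truncnS_gt _))// ler_nat ltnS.
      exact: leq_bigmax.
    exists k => ab; have [e00 _] := he0 ab.
    by rewrite ltr_pdivrMr// mulrC -ltr_pdivrMr.
  have rd : 0 < k.+1%:R^-1 :> R by rewrite invr_gt0.
  have /choice[q hq] : forall ab : 'I_2 * 'I_2, exists q : rat * rat,
    `|Re (U2mx (f x) ab.1 ab.2) - ratr q.1| < k.+1%:R^-1 /\
    `|Im (U2mx (f x) ab.1 ab.2) - ratr q.2| < k.+1%:R^-1.
    have approx (r : R) : exists q : rat, `|r - ratr q| < k.+1%:R^-1.
      have lt_r : r - k.+1%:R^-1 < r + k.+1%:R^-1 by rewrite ltrD2l gtrN.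
      have [q hq] := rat_in_itvoo lt_r; exists q; rewrite distrC ltr_distl.
      by move: hq; rewrite in_itv.
    move=> ab; have [q1 h1] := approx (Re (U2mx (f x) ab.1 ab.2)).
    by have [q2 h2] := approx (Im (U2mx (f x) ab.1 ab.2)); exists (q1, q2).
  exists (pickle (([ffun ab => q ab], k) : Idx)) => //.
  rewrite pickleK; case: ifPn => [_|/asboolP].
    by move=> ab; rewrite /= ffunE; exact: hq.
  case => A BA; apply: PV => a b; have [_] := he0 (a, b); apply.
  rewrite (le_lt_trans (cnorm_le_ReIm _))// (lt_trans _ (hk (a, b)))//= !cplxE.
  have [] := BA (a, b); have [] := hq (a, b); rewrite /= ffunE.
  move: (q (a, b)) => [q1 q2] /=.
  move: (Re (A a b)) (Im (A a b)) (Re (U2mx _ _ _)) (Im (U2mx _ _ _)) => u v s t.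
  move: (ratr q1) (ratr q2) (k.+1%:R^-1) => c1 c2 r h1 h2 h3 h4.
  have : `|s - u| <= `|s - c1| + `|u - c1|.
    by rewrite (_ : s - u = s - c1 - (u - c1)) ?ler_normB//; ring.
  have : `|t - v| <= `|t - c2| + `|v - c2|.
    by rewrite (_ : t - v = t - c2 - (v - c2)) ?ler_normB//; ring.
  lra.
apply: bigcupT_measurable => n; case: (unpickle n) => // i.
by case: ifPn.
Qed.

End Borel.

(** * Differentiation along the flow *)

Lemma cvgr_sum {R : realType} {T I : Type} {E : set_system T} {FE : Filter E}
    (s : seq I) (f : I -> T -> R) (l : I -> R) :
  (forall i, f i x @[x --> E] --> l i) ->
  (\sum_(i <- s) f i x) @[x --> E] --> \sum_(i <- s) l i.
Proof.
move=> h; elim: s => [|i s IH].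
  by under eq_fun do rewrite big_nil; rewrite big_nil; exact: cvg_cst.
by under eq_fun do rewrite big_cons; rewrite big_cons; exact: cvgD.
Qed.

Section RealDerivative.
Context {R : realType}.
Implicit Types f g : R -> R.

Lemma is_deriveP f (x d : R) : is_derive x 1 f d <->
  (fun h => h^-1 * (f (h + x) - f x)) @ 0^' --> d.
Proof.
have E : (fun h => h^-1 *: ((f \o shift x) (h *: 1) - f x)) =
         (fun h => h^-1 * (f (h + x) - f x)).
  by apply/funext => h; rewrite /= /GRing.scale /= mulr1.
split=> [[fx <-]|h].
  by move: fx; rewrite /derivable /derive E.
apply: DeriveDef; first by rewrite /derivable E; apply/cvg_ex; exists d.
by rewrite /derive E; exact: cvg_lim.
Qed.

Lemma is_derive_shift f (x t d : R) : is_derive (x + t) 1 f d ->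
  is_derive x 1 (fun s => f (s + t)) d.
Proof.
move=> /is_deriveP h; apply/is_deriveP.
by under eq_fun do rewrite -addrA.
Qed.

End RealDerivative.

Section ComplexDerivative.
Context {R : realType}.
Implicit Types (f g : R -> R[i]) (t : R) (z w : R[i]).

Definition cderiv f t z :=
  is_derive t (1 : R) (fun s => Re (f s)) (Re z) /\
  is_derive t (1 : R) (fun s => Im (f s)) (Im z).

Lemma cderivD f g t z w : cderiv f t z -> cderiv g t w ->
  cderiv (fun s => f s + g s) t (z + w).
Proof.
move=> [h1 h2] [h1' h2']; split.
  rewrite ReD (_ : (fun s => _) = (fun s => Re (f s)) + (fun s => Re (g s))).
    exact: is_deriveD.
  by rewrite funeqE => s; rewrite ReD.
rewrite ImD (_ : (fun s => _) = (fun s => Im (f s)) + (fun s => Im (g s))).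
  exact: is_deriveD.
by rewrite funeqE => s; rewrite ImD.
Qed.

Lemma cderivM f g t z w : cderiv f t z -> cderiv g t w ->
  cderiv (fun s => f s * g s) t (z * g t + f t * w).
Proof.
move=> [h1 h2] [h1' h2']; split.
  rewrite (_ : (fun s => _) = (fun s => Re (f s)) * (fun s => Re (g s)) -
     (fun s => Im (f s)) * (fun s => Im (g s))).
    apply: (is_derive_eq (is_deriveB (is_deriveM h1 h1') (is_deriveM h2 h2'))).
    by rewrite !cplxE /GRing.scale /=; ring.
  by rewrite funeqE => s; rewrite ReM.
rewrite (_ : (fun s => _) = (fun s => Re (f s)) * (fun s => Im (g s)) +
     (fun s => Im (f s)) * (fun s => Re (g s))).
  apply: (is_derive_eq (is_deriveD (is_deriveM h1 h2') (is_deriveM h2 h1'))).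
  by rewrite !cplxE /GRing.scale /=; ring.
by rewrite funeqE => s; rewrite ImM.
Qed.

Lemma cderivJ f t z : cderiv f t z -> cderiv (fun s => conjc (f s)) t (conjc z).
Proof.
move=> [h1 h2]; split.
  by rewrite ReJ; under eq_fun do rewrite ReJ.
by rewrite ImJ; under eq_fun do rewrite ImJ; exact: is_deriveN.
Qed.

Lemma cderiv_cst (c : R[i]) t : cderiv (fun=> c) t 0.
Proof. by split; exact: is_derive_cst. Qed.

Lemma cderiv_unique f t z w : cderiv f t z -> cderiv f t w -> z = w.
Proof.
move=> [[_ h1] [_ h2]] [[_ h1'] [_ h2']].
by apply: complex_eqP; [rewrite -h1 -h1'|rewrite -h2 -h2'].
Qed.

Lemma cderiv_eq f t z w : cderiv f t z -> z = w -> cderiv f t w.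
Proof. by move=> h <-. Qed.

Lemma cderiv_sum (I : Type) (s : seq I) (f : I -> R -> R[i]) t (z : I -> R[i]) :
  (forall i, cderiv (f i) t (z i)) ->
  cderiv (fun u => \sum_(i <- s) f i u) t (\sum_(i <- s) z i).
Proof.
move=> h; elim: s => [|i s IH].
  rewrite big_nil (_ : (fun u => _) = (fun=> 0)); first exact: cderiv_cst.
  by rewrite funeqE => u; rewrite big_nil.
rewrite big_cons (_ : (fun u => _) = (fun u => f i u + \sum_(i <- s) f i u)).
  exact: cderivD.
by rewrite funeqE => u; rewrite big_cons.
Qed.

Definition pderiv (p : R -> {poly R[i]}) t (q : {poly R[i]}) :=
  forall i, cderiv (fun s => (p s)`_i) t q`_i.

Lemma pderivM (p q : R -> {poly R[i]}) t p' q' : pderiv p t p' -> pderiv q t q' ->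
  pderiv (fun s => p s * q s) t (p' * q t + p t * q').
Proof.
move=> hp hq i; under eq_fun do rewrite coefM.
apply: cderiv_eq; first by apply: cderiv_sum => j; exact: cderivM (hp _) (hq _).
by rewrite coefD !coefM -big_split.
Qed.

Lemma pderivX (p : R -> {poly R[i]}) t p' n : pderiv p t p' ->
  pderiv (fun s => p s ^+ n) t (p t ^+ n.-1 * p' *+ n).
Proof.
move=> hp; elim: n => [|n IH].
  move=> i; rewrite mulr0n coef0; under eq_fun do rewrite expr0.
  exact: cderiv_cst.
under [X in pderiv X]eq_fun do rewrite exprS.
have := pderivM hp IH; congr (pderiv _ _ _).
case: n {IH} => [|n]; first by rewrite expr0 mulr0n mulr0 addr0 mulr1n mulr1 mul1r.
rewrite /= mulrnAr mulrA -exprS mulrC [in RHS]mulrS //.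
Qed.

Definition mderiv n m (A : R -> 'M[R[i]]_(n, m)) t (B : 'M[R[i]]_(n, m)) :=
  forall i j, cderiv (fun s => A s i j) t (B i j).

Lemma mderivM n m p (A : R -> 'M[R[i]]_(n, m)) (B : R -> 'M[R[i]]_(m, p)) t A' B' :
  mderiv A t A' -> mderiv B t B' ->
  mderiv (fun s => A s *m B s) t (A' *m B t + A t *m B').
Proof.
move=> hA hB i j; under eq_fun do rewrite mxE.
apply: cderiv_eq; first by apply: cderiv_sum => k; exact: cderivM (hA _ _) (hB _ _).
by rewrite !mxE -big_split.
Qed.

Lemma mderiv_cst n m (A : 'M[R[i]]_(n, m)) t : mderiv (fun=> A) t 0.
Proof. by move=> i j; rewrite mxE; exact: cderiv_cst. Qed.

Lemma mderiv_unique n m (A : R -> 'M[R[i]]_(n, m)) t B C :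
  mderiv A t B -> mderiv A t C -> B = C.
Proof.
by move=> hB hC; apply/matrixP => i j; exact: cderiv_unique (hB i j) (hC i j).
Qed.

End ComplexDerivative.

Section FlowDerivative.
Context {R : realType} {X : ptopologicalType}.
Variable F : R -> X -> X.
Implicit Types a b : X -> R[i].

Definition ccont a := continuous (Re \o a) /\ continuous (Im \o a).

(** The derivative is required at every time: this is what makes the mean value
    theorem available along each orbit. *)
Definition flow_deriv a b := forall (x : X) (t : R),
  cderiv (fun s => a (F s x)) t (b (F t x)).

Definition flowC1 a := ccont a /\ exists2 b, ccont b & flow_deriv a b.

Lemma ccont_conj_algebra : conj_algebra ccont.
Proof.
split.
- by move=> c; split=> x; exact: cvg_cst.
- move=> f g [f1 f2] [g1 g2]; split=> x.
    rewrite (_ : _ \o _ = (fun x => Re (f x) + Re (g x))).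
      by apply: cvgD; [exact: f1|exact: g1].
    by apply/funext => y; rewrite /= ReD.
  rewrite (_ : _ \o _ = (fun x => Im (f x) + Im (g x))).
    by apply: cvgD; [exact: f2|exact: g2].
  by apply/funext => y; rewrite /= ImD.
- move=> f g [f1 f2] [g1 g2]; split=> x.
    rewrite (_ : _ \o _ = (fun x => Re (f x) * Re (g x) - Im (f x) * Im (g x))).
      by apply: cvgB; apply: cvgM; [exact: f1|exact: g1|exact: f2|exact: g2].
    by apply/funext => y; rewrite /= ReM.
  rewrite (_ : _ \o _ = (fun x => Re (f x) * Im (g x) + Im (f x) * Re (g x))).
    by apply: cvgD; apply: cvgM; [exact: f1|exact: g2|exact: f2|exact: g1].
  by apply/funext => y; rewrite /= ImM.
- move=> f [f1 f2]; split=> x.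
    rewrite (_ : _ \o _ = (fun x => Re (f x))); first exact: f1.
    by apply/funext => y; rewrite /= ReJ.
  rewrite (_ : _ \o _ = (fun x => - Im (f x))); first by apply: cvgN; exact: f2.
  by apply/funext => y; rewrite /= ImJ.
Qed.

Lemma flow_derivD a b a' b' : flow_deriv a b -> flow_deriv a' b' ->
  flow_deriv (fun x => a x + a' x) (fun x => b x + b' x).
Proof. by move=> h h' x t; exact: cderivD (h x t) (h' x t). Qed.

Lemma flow_derivM a b a' b' : flow_deriv a b -> flow_deriv a' b' ->
  flow_deriv (fun x => a x * a' x) (fun x => b x * a' x + a x * b' x).
Proof. by move=> h h' x t; exact: cderivM (h x t) (h' x t). Qed.

Lemma flow_derivJ a b : flow_deriv a b ->
  flow_deriv (fun x => conjc (a x)) (fun x => conjc (b x)).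
Proof. by move=> h x t; exact: cderivJ (h x t). Qed.

Lemma flow_deriv_cst (c : R[i]) : flow_deriv (fun=> c) (fun=> 0).
Proof. by move=> x t; exact: cderiv_cst. Qed.

Lemma flow_deriv_unique a b : (forall x, F 0 x = x) -> flow_deriv a b ->
  b = lie_deriv F a.
Proof.
move=> F0 h; apply/funext => x; have [h1 h2] := h x 0.
by apply: complex_eqP; rewrite /lie_deriv /= derive1E derive_val F0.
Qed.

Lemma flow_deriv_comp a b (N : R) : (forall s t x, F (s + t) x = F s (F t x)) ->
  flow_deriv a b -> flow_deriv (fun x => a (F N x)) (fun x => b (F N x)).
Proof.
move=> FD h x t; have [h1 h2] := h x (t + N); split.
  rewrite -FD addrC; under eq_fun do rewrite -FD addrC.
  exact: (@is_derive_shift _ (fun u => Re (a (F u x))) t N _ h1).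
rewrite -FD addrC; under eq_fun do rewrite -FD addrC.
exact: (@is_derive_shift _ (fun u => Im (a (F u x))) t N _ h2).
Qed.

Lemma flowC1_conj_algebra : conj_algebra flowC1.
Proof.
have CA := ccont_conj_algebra.
split.
- move=> c; split; first exact: (calg_cst CA).
  by exists (fun=> 0); [exact: (calg_cst CA)|exact: flow_deriv_cst].
- move=> f g [cf [f' cf' df]] [cg [g' cg' dg]]; split; first exact: (calgD CA).
  by eexists; [exact: (calgD CA cf' cg')|exact: flow_derivD].
- move=> f g [cf [f' cf' df]] [cg [g' cg' dg]]; split; first exact: (calgM CA).
  eexists; [|exact: (flow_derivM df dg)].
  by apply: (calgD CA); exact: (calgM CA).
- move=> f [cf [f' cf' df]]; split; first exact: (calgJ CA).
  by eexists; [exact: (calgJ CA cf')|exact: flow_derivJ].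
Qed.

Lemma flowC1_lie a : (forall x, F 0 x = x) -> flowC1 a ->
  ccont (lie_deriv F a) /\ flow_deriv a (lie_deriv F a).
Proof.
move=> F0 [_ [b cb ab]]; rewrite -(flow_deriv_unique F0 ab).
by split; [exact: cb|exact: ab].
Qed.

Lemma ccont_bm a : compact [set: X] -> ccont a -> bm (a : borel X -> R[i]).
Proof.
move=> cX [c1 c2]; split; first by split; exact: continuous_measurable_real.
have bd (f : X -> R) : continuous f -> exists K, forall x, `|f x| <= K.
  move=> cf; have [] := @compact_EVT_max X R (fun x => `|f x|) [set: X].
  - by exists point.
  - exact: cX.
  - apply: continuous_subspaceT => x.
    apply: (@continuous_comp _ _ _ f (fun r : R => `|r|)); first exact: cf.
    exact: norm_continuous.
  - by move=> c _ h; exists `|f c| => x; apply: h; rewrite inE.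
have [K hK] := bd _ c1; have [L hL] := bd _ c2.
exists (K + L) => x; apply: (le_trans (cnorm_le_ReIm _)).
exact: lerD (hK x) (hL x).
Qed.

End FlowDerivative.

Lemma continuous_pairl (T U : topologicalType) (x : U) :
  continuous (fun t : T => (t, x)).
Proof.
by move=> t; apply: (@cvg_pair _ _ _ _ (nbhs t) (nbhs x));
  [exact: cvg_id|exact: cvg_cst].
Qed.

Lemma continuous_pairr (T U : topologicalType) (t : T) :
  continuous (fun x : U => (t, x)).
Proof.
by move=> x; apply: (@cvg_pair _ _ _ _ (nbhs t) (nbhs x));
  [exact: cvg_cst|exact: cvg_id].
Qed.

Section ChartDerivative.
Context {R : realType} {n : nat} {X : ptopologicalType}.
Variables (atl : set (chart R n X)) (F : R -> X -> X).
Hypotheses (satl : smooth_atlas atl) (cF : C1_flow atl F).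

Lemma flow_continuous_time (x : X) : continuous (fun t => F t x).
Proof.
move=> t; have Fc := @flow_cont _ _ _ _ _ cF (t, x).
apply: (@continuous_comp _ _ _ (fun t : R => (t, x)) (fun p => F p.1 p.2)) => //.
exact: continuous_pairl.
Qed.

Lemma flow_continuous (t : R) : continuous (F t).
Proof.
move=> x; have Fc := @flow_cont _ _ _ _ _ cF (t, x).
apply: (@continuous_comp _ _ _ (fun x : X => (t, x)) (fun p => F p.1 p.2)) => //.
exact: continuous_pairr.
Qed.

Lemma chart_near (c : chart R n X) (x : X) : atl c -> chart_dom c x ->
  \forall y \near x, chart_dom c y.
Proof.
move=> ac cx; apply: open_nbhs_nbhs; split=> //.
exact: (chart_dom_open (atlas_chart satl ac)).
Qed.

(** Charts are homeomorphisms between open sets and cover the space. *)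
Lemma chart_continuous (W : topologicalType) (f : X -> W) :
  (forall c, atl c -> forall u, chart_img c u ->
     {for u, continuous (fun u => f (chart_inv c u))}) -> continuous f.
Proof.
move=> h x; have [c ac cx] := atlas_cover satl x.
have hc := atlas_chart satl ac.
have iu : chart_img c (chart_map c x) by exists x.
have h1 : (fun y => f (chart_inv c (chart_map c y))) @ x -->
    f (chart_inv c (chart_map c x)).
  apply: (@continuous_comp _ _ _ (chart_map c) (fun u => f (chart_inv c u))).
    exact: (chart_map_cont hc cx).
  exact: h.
rewrite (chart_mapK hc cx) in h1; apply: cvg_trans h1; apply: near_eq_cvg.
by apply: filterS (chart_near ac cx) => y cy /=; rewrite (chart_mapK hc cy).
Qed.

(** The flow and its vector field, seen in a chart. *)
Let Psi (c : chart R n X) (p : R * 'rV[R]_n) := chart_map c (F p.1 (chart_inv c p.2)).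

Let V (c : chart R n X) (u : 'rV[R]_n) : 'rV[R]_n := 'D_(1, 0) (Psi c) (0, u).

Lemma chart_flow_derive0 (f : X -> R) (c : chart R n X) (x : X) :
  atl c -> chart_dom c x -> Ck 1 (chart_img c) (fun u => f (chart_inv c u)) ->
  let u := chart_map c x in
  is_derive (0 : R) (1 : R) (fun t => f (F t x))
    (\sum_i V c u 0 i * 'D_(delta_mx 0 i) (fun u => f (chart_inv c u)) u).
Proof.
move=> ac cx [fd _] u.
have hc := atlas_chart satl ac.
have F0 := flow0 cF.
have iu : chart_img c u by exists x.
have Ku : chart_inv c u = x by exact: chart_mapK.
pose U := [set p : R * 'rV[R]_n | chart_img c p.2 /\ chart_dom c (F p.1 (chart_inv c p.2))].
have U0 : U (0, u) by split=> //=; rewrite Ku F0.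
have [Pd _] := flow_C1 cF ac ac.
have {}Pd : differentiable (Psi c) (0, u) by exact: Pd.
have Pu : Psi c (0, u) = u by rewrite /Psi /= Ku F0.
set g := fun u => f (chart_inv c u).
have gd : differentiable g (Psi c (0, u)) by rewrite Pu; exact: fd.
have dG : 'D_(1, 0) (g \o Psi c) (0, u) =
    \sum_i V c u 0 i * 'D_(delta_mx 0 i) g u.
  rewrite deriveE; last exact: differentiable_comp.
  rewrite diff_comp//= Pu -(deriveE _ Pd) -/(V c u).
  have gu : differentiable g u by exact: fd.
  rewrite {1}[V c u]row_sum_delta linear_sum; apply: eq_bigr => i _.
  by rewrite linearZ /= deriveE.
have Gder : is_derive (0 : R) (1 : R) (fun t => (g \o Psi c) (t, u))
    ('D_(1, 0) (g \o Psi c) (0, u)).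
  apply/is_deriveP.
  have E : (fun h : R => h^-1 *: ((g \o Psi c \o shift (0, u)) (h *: (1, 0)) -
        (g \o Psi c) (0, u))) =
      (fun h => h^-1 * ((g \o Psi c) (h + 0, u) - (g \o Psi c) (0, u))).
    apply/funext => h; rewrite /GRing.scale /=.
    congr (_ * (g (Psi c (_, _)) - _)); first by rewrite -[LHS]/(h * 1 + 0) mulr1.
    by rewrite -[LHS]/(h *: 0 + u) scaler0 add0r.
  have : derivable (g \o Psi c) (0, u) (1, 0).
    by apply: diff_derivable; exact: differentiable_comp.
  by rewrite /derivable /derive E.
rewrite -dG; apply: near_eq_is_derive Gder.
have Fx : (F t x) @[t --> (0 : R)] --> x.
  by have := @flow_continuous_time x 0; rewrite /continuous_at F0.
have near0 : \forall t \near (0 : R), chart_dom c (F t x) := Fx _ (chart_near ac cx).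
apply: filterS near0 => t ct.
by rewrite /= /g /Psi /= Ku (chart_mapK hc ct).
Qed.

Lemma chart_flow_deriv (f : X -> R) :
  (forall c, atl c -> Ck 1 (chart_img c) (fun u => f (chart_inv c u))) ->
  continuous f /\ exists2 b : X -> R, continuous b &
    forall (x : X) (t : R), is_derive t (1 : R) (fun s => f (F s x)) (b (F t x)).
Proof.
move=> fC1; split.
  apply: chart_continuous => c ac u iu; have [fd _] := fC1 c ac.
  by apply: differentiable_continuous; exact: fd.
pose b x := 'D_1 (fun t => f (F t x)) (0 : R).
have bE c x : atl c -> chart_dom c x -> b x =
    \sum_i V c (chart_map c x) 0 i *
       'D_(delta_mx 0 i) (fun u => f (chart_inv c u)) (chart_map c x).
  move=> ac cx; have h := chart_flow_derive0 ac cx (fC1 c ac).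
  by rewrite /b derive_val.
exists b.
  apply: chart_continuous => c ac u iu.
  have hc := atlas_chart satl ac.
  have [x cx xu] := iu.
  have Ku : chart_inv c u = x by rewrite -xu (chart_mapK hc).
  have [_ Pd] := flow_C1 cF ac ac.
  have [_ gd] := fC1 c ac.
  have h : {for u, continuous (fun v => \sum_i V c v 0 i *
       'D_(delta_mx 0 i) (fun u => f (chart_inv c u)) v)}.
    have FF : Filter (nbhs u) := nbhs_filter u.
    apply: (@cvgr_sum _ _ _ _ FF) => i; apply: cvgM; last exact: gd.
    apply: (@continuous_comp _ _ _ (V c) (fun M : 'rV[R]_n => M 0 i)); last exact: coord_continuous.
    apply: (@continuous_comp _ _ _ (fun v : 'rV[R]_n => ((0 : R), v)) ('D_(1, 0) (Psi c))).
      exact: continuous_pairr.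
    apply: Pd; split=> //=.
    by rewrite Ku (flow0 cF).
  have E v : chart_img c v -> b (chart_inv c v) = \sum_i V c v 0 i *
       'D_(delta_mx 0 i) (fun u => f (chart_inv c u)) v.
    by move=> [y cy <-]; rewrite (chart_mapK hc cy) (bE c).
  have near_u : \forall v \near u, chart_img c v.
    by apply: open_nbhs_nbhs; split; [exact: (chart_img_open hc)|exact: iu].
  suff : (fun v => b (chart_inv c v)) @ u --> b (chart_inv c u) by [].
  rewrite (E u iu); apply: cvg_trans h; apply: near_eq_cvg.
    exact: (nbhs_filter u).
  by apply: (@filterS _ _ (nbhs_filter u) _ _ _ near_u) => v iv; rewrite (E v iv).
move=> x t.
have [c ac cx] := atlas_cover satl (F t x).
have h := chart_flow_derive0 ac cx (fC1 c ac).
rewrite (bE c)//; move: h; rewrite -(subrr t) => h.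
have {h} := is_derive_shift h.
by under eq_fun do rewrite -(flowD cF) addrNK.
Qed.

Lemma C1_to_U2_flowC1 (phi : X -> U2 R) (a b : 'I_2) : C1_to_U2 atl phi ->
  flowC1 F (fun x => U2mx (phi x) a b).
Proof.
move=> pC1.
have [c1 [b1 cb1 d1]] := @chart_flow_deriv (fun x => Re (U2mx (phi x) a b))
  (fun c ac => (pC1 c ac a b).1).
have [c2 [b2 cb2 d2]] := @chart_flow_deriv (fun x => Im (U2mx (phi x) a b))
  (fun c ac => (pC1 c ac a b).2).
split; first by split.
by exists (fun x => b1 x +i* b2 x); split.
Qed.

End ChartDerivative.

(** * The infinitesimal representation *)

Section InfinitesimalRepresentation.
Context {R : realType}.
Variables (l : nat) (m : int).

Definition dactpoly (k : nat) (Z : 'M[R[i]]_2) : {poly R[i]} :=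
  ('X ^+ k.-1 * colpoly Z 0) *+ k + ('X ^+ k * colpoly Z 1) *+ (l - k).

(** The differential of [rho l m] at the identity. *)
Definition drho (Z : 'M[R[i]]_2) : 'M[R[i]]_l.+1 :=
  \matrix_(i, k) ((m - l%:Z)%:~R * \tr Z * (i == k)%:R + (dactpoly k Z)`_i).

Lemma drho_scalar (z : R[i]) : drho z%:M = ((2 * m - l%:Z)%:~R * z)%:M.
Proof.
apply/matrixP => i k.
have kl : (k <= l)%N by rewrite -ltnS.
have E : dactpoly k z%:M = (z *: 'X^k) *+ l.
  rewrite /dactpoly /colpoly !mxE /= !mulr1n !mulr0n polyC0 addr0 scale0r add0r.
  have -> : ('X ^+ k.-1 * (z *: 'X)) *+ k = (z *: 'X^k) *+ k :> {poly R[i]}.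
    case: (nat_of_ord k) => [|k0]; first by rewrite !mulr0n.
    by rewrite /= -scalerAr -exprSr.
  by rewrite mulrC mul_polyC -mulrnDr subnKC.
rewrite mxE E mxtrace_scalar coefMn coefZ coefXn !mxE -val_eqE /=.
case: (_ == _ :> nat); last by rewrite !mulr0 mul0rn addr0 mulr0n.
rewrite !mulr1 mulr1n -[z *+ 2]mulr_natl -[z *+ l]mulr_natl.
have -> : (2 * m - l%:Z)%:~R = 2 * m%:~R - l%:R :> R[i].
  by rewrite intrB intrM -!pmulrn.
have -> : (m - l%:Z)%:~R = m%:~R - l%:R :> R[i] by rewrite intrB -!pmulrn.
by ring.
Qed.

End InfinitesimalRepresentation.
Section CurveAtIdentity.
Context {R : realType}.
Variables (gam : R -> U2 R) (Z : 'M[R[i]]_2).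
Hypotheses (gam0 : U2mx (gam 0) = 1%:M) (dgam : mderiv (fun s => U2mx (gam s)) 0 Z).

(** Differentiate the relation that expresses that the curve is unitary. *)
Lemma curve_skew : map_mx conjc Z^T = - Z.
Proof.
have h : mderiv (fun s => U2mx (gam s) *m map_mx conjc (U2mx (gam s))^T) 0
   (Z *m map_mx conjc (U2mx (gam 0))^T + U2mx (gam 0) *m map_mx conjc Z^T).
  apply: (@mderivM _ _ _ _ (fun s => U2mx (gam s))
    (fun s => map_mx conjc (U2mx (gam s))^T)) => // i j.
  by under eq_fun do rewrite !mxE; rewrite !mxE; exact: cderivJ (dgam j i).
have E : (fun s => U2mx (gam s) *m map_mx conjc (U2mx (gam s))^T) = (fun=> 1%:M).
  by apply/funext => s; have /unitarymxP -> := U2mx_unitary (gam s).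
move: h; rewrite E => h; have := mderiv_unique h (mderiv_cst _ _).
rewrite gam0 trmx1 map_mx1 mulmx1 mul1mx => /eqP.
by rewrite addrC addr_eq0 => /eqP.
Qed.

Lemma cderivX (f : R -> R[i]) (t : R) (z : R[i]) n : cderiv f t z ->
  cderiv (fun s => f s ^+ n) t (f t ^+ n.-1 * z *+ n).
Proof.
move=> hf; have hp : pderiv (fun s => (f s)%:P) t z%:P.
  move=> [|i]; under eq_fun do rewrite coefC; rewrite coefC //=.
  exact: cderiv_cst.
have := pderivX n hp 0%N; under eq_fun do rewrite -polyC_exp coefC.
by rewrite coefMn coef0M -polyC_exp !coefC.
Qed.

Lemma cderiv_det : cderiv (fun s => \det (U2mx (gam s))) 0 (\tr Z).
Proof.
under eq_fun do rewrite det_mx2 -mulN1r.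
apply: cderiv_eq.
  apply: cderivD; first exact: cderivM (dgam _ _) (dgam _ _).
  exact: cderivM (cderiv_cst _ _) (cderivM (dgam _ _) (dgam _ _)).
have trZ : \tr Z = Z 0 0 + Z 1 1.
  rewrite /mxtrace !big_ord_recl big_ord0 addr0.
  by congr (Z _ _ + Z _ _); exact: val_inj.
by rewrite trZ /= gam0 !mxE /= !mulr1n !mulr0n; ring.
Qed.

Lemma cderiv_det_exprz (e : int) :
  cderiv (fun s => \det (U2mx (gam s)) ^ e) 0 (e%:~R * \tr Z).
Proof.
have d0 : \det (U2mx (gam 0)) = 1 by rewrite gam0 det1.
case: e => n.
  apply: cderiv_eq (cderivX n cderiv_det) _.
  by rewrite /= d0 expr1n mul1r -mulr_natl.
rewrite (_ : (fun s => _) = (fun s => conjc (\det (U2mx (gam s))) ^+ n.+1)).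
  apply: cderiv_eq (cderivX n.+1 (cderivJ cderiv_det)) _.
  rewrite /= d0 conjc1 expr1n mul1r.
  have -> : conjc (\tr Z) = - \tr Z.
    by rewrite -trace_map_mx -mxtrace_tr map_trmx curve_skew raddfN.
  by rewrite NegzE -mulr_natl mulrN mulrNz mulNr.
by apply/funext => s; rewrite NegzE -exprnN -exprVn U2_det_inv.
Qed.

Lemma pderiv_colpoly (b : 'I_2) :
  pderiv (fun s => colpoly (U2mx (gam s)) b) 0 (colpoly Z b).
Proof.
move=> i; under eq_fun do rewrite /colpoly coefD coefZ coefC.
rewrite /colpoly coefD coefZ coefC; apply: cderivD.
  apply: cderiv_eq; first exact: cderivM (dgam _ _) (cderiv_cst _ _).
  by rewrite mulr0 addr0.
by case: (i == 0%N); [exact: dgam|exact: cderiv_cst].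
Qed.

Lemma mderiv_rho (l : nat) (m : int) :
  mderiv (fun s => rho l m (gam s)) 0 (drho l m Z).
Proof.
have c0 : colpoly (U2mx (gam 0)) 0 = 'X.
  by rewrite gam0 /colpoly !mxE /= mulr1n mulr0n scale1r addr0.
have c1 : colpoly (U2mx (gam 0)) 1 = 1.
  by rewrite gam0 /colpoly !mxE /= mulr1n mulr0n scale0r add0r.
have hc k : pderiv (fun s => actpoly l k (U2mx (gam s))) 0 (dactpoly l k Z).
  have := pderivM (pderivX k (pderiv_colpoly 0)) (pderivX (l - k) (pderiv_colpoly 1)).
  congr (pderiv _ _ _); rewrite c0 c1 !expr1n mulr1 mul1r /dactpoly.
  by rewrite mulrnAr.
move=> i k; under eq_fun do rewrite !mxE.
apply: cderiv_eq; first exact: cderivM (cderiv_det_exprz _) (hc k i).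
rewrite /= gam0 det1 exp1rz mul1r [in RHS]mxE; congr (_ * _ + _).
have := congr1 (fun M : 'M[R[i]]_l.+1 => M i k) (cmx_scalar l (1 : R[i])).
by rewrite !mxE expr1n => ->.
Qed.

End CurveAtIdentity.

Section Cocycle.
Context {R : realType} {X : ptopologicalType}.
Variables (F : R -> X -> X) (phi : X -> U2 R) (l : nat) (m : int).
Hypotheses (F0 : forall x, F 0 x = x)
           (phiC1 : forall a b, flowC1 F (fun x => U2mx (phi x) a b)).

Definition lie_rho (x : X) : 'M[R[i]]_l.+1 :=
  \matrix_(i, k) lie_deriv F (fun y => rho l m (phi y) i k) x.

Lemma rho_phi_flowC1 i k : flowC1 F (fun x => rho l m (phi x) i k).
Proof. exact: (calg_rho (flowC1_conj_algebra F)). Qed.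

Lemma mderiv_phi x t : mderiv (fun s => U2mx (phi (F s x))) t
  (\matrix_(a, b) lie_deriv F (fun y => U2mx (phi y) a b) (F t x)).
Proof.
by move=> a b; rewrite mxE; have [_] := flowC1_lie F0 (phiC1 a b); apply.
Qed.

Lemma mderiv_rho_phi x t : mderiv (fun s => rho l m (phi (F s x))) t
  (lie_rho (F t x)).
Proof.
by move=> a b; rewrite mxE; have [_] := flowC1_lie F0 (rho_phi_flowC1 a b); apply.
Qed.

(** Differentiating [t |-> rho (g phi(F_t x) phi(x)^-1 g^-1)] at zero, before
    and after using the multiplicativity of [rho]. *)
Lemma rho_conj_lie (g : U2 R) (x : X) :
  rho l m g *m (lie_rho x *m rho l m (phi x)^-1%g) *m rho l m g^-1%g =
  drho l m (U2mx g *m cocycle_deriv F phi x *m U2mx g^-1%g).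
Proof.
pose gam s := (g * phi (F s x) * (phi x)^-1 * g^-1)%g.
have gam0 : U2mx (gam 0) = 1%:M by rewrite /gam F0 mulgK mulgV.
have dgam : mderiv (fun s => U2mx (gam s)) 0
    (U2mx g *m cocycle_deriv F phi x *m U2mx g^-1%g).
  have h := mderivM (mderivM (mderivM (mderiv_cst (U2mx g) 0) (mderiv_phi x 0))
    (mderiv_cst (U2mx (phi x)^-1%g) 0)) (mderiv_cst (U2mx g^-1%g) 0).
  move: h; congr (mderiv _ _ _).
  by rewrite !mulmx0 !addr0 !mul0mx !add0r F0 !mulmxA.
suff key : mderiv (fun s => rho l m (gam s)) 0
    (rho l m g *m (lie_rho x *m rho l m (phi x)^-1%g) *m rho l m g^-1%g).
  exact: mderiv_unique key (@mderiv_rho _ gam _ gam0 dgam l m).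
have h := mderivM (mderivM (mderivM (mderiv_cst (rho l m g) 0) (mderiv_rho_phi x 0))
    (mderiv_cst (rho l m (phi x)^-1%g) 0)) (mderiv_cst (rho l m g^-1%g) 0).
have -> : (fun s => rho l m (gam s)) = (fun s => rho l m g *m rho l m (phi (F s x)) *m
    rho l m (phi x)^-1%g *m rho l m g^-1%g).
  by apply/funext => s; rewrite /gam !rhoM.
by move: h; congr (mderiv _ _ _); rewrite !mulmx0 !addr0 !mul0mx !add0r F0 !mulmxA.
Qed.

Lemma cocycle_deriv_skew x :
  map_mx conjc (cocycle_deriv F phi x)^T = - cocycle_deriv F phi x.
Proof.
pose gam s := (phi (F s x) * (phi x)^-1)%g.
apply: (@curve_skew _ gam); first by rewrite /gam F0 mulgV.
have h := mderivM (mderiv_phi x 0) (mderiv_cst (U2mx (phi x)^-1%g) 0).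
by move: h; congr (mderiv _ _ _); rewrite !mulmx0 !addr0 F0.
Qed.

End Cocycle.

(** * The degree *)

Section MatrixCoefficients.
Context {R : realType} {l : nat} {m : int}.

Lemma dactpolyP (k : nat) (a : R[i]) (A B : 'M[R[i]]_2) :
  dactpoly l k (a *: A + B) = a *: dactpoly l k A + dactpoly l k B.
Proof.
have cP b : colpoly (a *: A + B) b = a *: colpoly A b + colpoly B b.
  rewrite /colpoly !mxE scalerDr scalerA -[a *: (A 1 b)%:P]mul_polyC -polyCM.
  by rewrite scalerDl polyCD addrACA.
rewrite /dactpoly !cP.
move: (colpoly A 0) (colpoly A 1) (colpoly B 0) (colpoly B 1) => p q r s.
rewrite !mulrDr !mulrnDl -!scalerAr !scalerMnr scalerDr.
exact: addrACA.
Qed.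

Lemma drho_linear (a : R[i]) (A B : 'M[R[i]]_2) :
  drho l m (a *: A + B) = a *: drho l m A + drho l m B.
Proof.
apply/matrixP => i k; rewrite !mxE dactpolyP coefD coefZ linearP /=.
by ring.
Qed.

Lemma drho_entries (Z : 'M[R[i]]_2) :
  drho l m Z = \sum_a \sum_b Z a b *: drho l m (delta_mx a b).
Proof.
have d0 : drho l m (0 : 'M[R[i]]_2) = 0.
  by have := drho_linear (-1) 0 0; rewrite !scaleN1r oppr0 addr0 addNr.
have dsum (I : Type) (s : seq I) (f : I -> 'M[R[i]]_2) :
    drho l m (\sum_(i <- s) f i) = \sum_(i <- s) drho l m (f i).
  elim: s => [|i s IH]; first by rewrite !big_nil.
  by rewrite !big_cons -IH -[X in drho l m (X + _)]scale1r drho_linear scale1r.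
rewrite {1}[Z]matrix_sum_delta dsum; apply: eq_bigr => a _.
rewrite dsum; apply: eq_bigr => b _.
by rewrite -[X in drho l m X]addr0 drho_linear d0 addr0.
Qed.

End MatrixCoefficients.

Section BoundedComplex.
Context {R : realType} {d : measure_display} {T : measurableType d}.
Variable P : probability T R.

Lemma bm_cintegrable (f : T -> R[i]) : bm f -> cintegrable P f.
Proof.
move=> [mf [K fK]]; apply: (@cintegrable_le _ _ _ _ _ (fun=> K)) => //.
  exact: finite_measure_integrable_cst.
move=> x; rewrite -cnorm_sqr lerXn2r ?nnegrE ?cnorm_ge0//.
exact: le_trans (cnorm_ge0 _) (fK x).
Qed.

Lemma bm_L2 (f : T -> R[i]) : bm f -> L2 P f.
Proof.
move=> [mf [K fK]]; apply: (@L2_le _ _ _ _ _ (fun=> K ^+ 2)) => //.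
  exact: finite_measure_integrable_cst.
move=> x; rewrite -cnorm_sqr lerXn2r ?nnegrE ?cnorm_ge0//.
exact: le_trans (cnorm_ge0 _) (fK x).
Qed.

Lemma bm_L2M (a f : T -> R[i]) : bm a -> L2 P f -> L2 P (fun x => a x * f x).
Proof.
move=> [ma [K aK]]; apply: (@L2_bdM _ _ _ _ (K ^+ 2)) => // x.
rewrite -cnorm_sqr lerXn2r ?nnegrE ?cnorm_ge0//.
exact: le_trans (cnorm_ge0 _) (aK x).
Qed.

End BoundedComplex.

Lemma mulmx2E {S : pzSemiRingType} (A B : 'M[S]_2) i j :
  (A *m B) i j = A i 0 * B 0 j + A i 1 * B 1 j.
Proof.
rewrite mxE !big_ord_recl big_ord0 addr0.
by congr (_ * _ + A _ _ * B _ _); exact: val_inj.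
Qed.

(** Already the diagonal and the permutation matrices of U(2) have only scalar
    commuting matrices. *)
Lemma U2_commutant_skew {R : realType} (E : 'M[R[i]]_2) :
  (forall h : U2 R, U2mx h *m E = E *m U2mx h) -> map_mx conjc E^T = - E ->
  exists s : R, E = (0 +i* s)%:M.
Proof.
move=> comm skewE.
pose d : 'M[R[i]]_2 := diag_mx (\row_i (if i == 0 then 1 else -1)).
have ud : d \is unitarymx.
  apply/unitarymxP; apply/matrixP => i j; rewrite mulmx2E !mxE.
  by case: i j => [[|[|//]] ?] [[|[|//]] ?] /=;
    rewrite ?(mulr1n, mulr0n, rmorphN1, rmorph1, rmorph0); ring.
pose w : 'M[R[i]]_2 := \matrix_(i, j) (i != j)%:R.
have uw : w \is unitarymx.
  apply/unitarymxP; apply/matrixP => i j; rewrite mulmx2E !mxE.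
  by case: i j => [[|[|//]] ?] [[|[|//]] ?] /=;
    rewrite ?(mulr1n, mulr0n, rmorphN1, rmorph1, rmorph0); ring.
have dE := comm (MkU2 ud); have wE := comm (MkU2 uw).
have e01 : E 0 1 = 0.
  have /matrixP/(_ 0 1) := dE; rewrite !mulmx2E !mxE /=.
  rewrite !mulr1n !mulr0n.
  move=> /eqP; rewrite -subr_eq0 (_ : _ - _ = 2 * E 0 1); last by ring.
  by rewrite mulf_eq0 pnatr_eq0 /= => /eqP.
have e10 : E 1 0 = 0.
  have /matrixP/(_ 1 0) := dE; rewrite !mulmx2E !mxE /=.
  rewrite !mulr1n !mulr0n.
  move=> /eqP; rewrite -subr_eq0 (_ : _ - _ = - 2 * E 1 0); last by ring.
  by rewrite mulf_eq0 oppr_eq0 pnatr_eq0 /= => /eqP.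
have e11 : E 1 1 = E 0 0.
  have /matrixP/(_ 0 1) := wE; rewrite !mulmx2E !mxE /=.
  move=> /eqP; rewrite -subr_eq0 (_ : _ - _ = E 1 1 - E 0 0); last by ring.
  by rewrite subr_eq0 => /eqP.
have e00 : Re (E 0 0) = 0.
  have /matrixP/(_ 0 0) := skewE; rewrite !mxE.
  by move=> /(congr1 Re); rewrite ReJ ReN; lra.
exists (Im (E 0 0)).
have eE : E 0 0 = 0 +i* Im (E 0 0) by apply: complex_eqP; rewrite /= ?e00.
apply/matrixP => i j; rewrite !mxE -eE.
have [->|->] : i = 0 \/ i = 1.
  by case: i => [[|[|//]] ?]; [left|right]; exact: val_inj.
  have [->|->] : j = 0 \/ j = 1.
    by case: j => [[|[|//]] ?]; [left|right]; exact: val_inj.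
  by rewrite mulr1n.
  by rewrite mulr0n.
have [->|->] : j = 0 \/ j = 1.
  by case: j => [[|[|//]] ?]; [left|right]; exact: val_inj.
by rewrite mulr0n.
by rewrite mulr1n.
Qed.

Section Degree.
Context {R : realType} {X : ptopologicalType}.
Variables (F : R -> X -> X) (muX : probability (borel X) R).
Variables (mu : probability (borel (U2 R)) R) (phi : X -> U2 R).
Hypotheses (cX : compact [set: X]) (F0 : forall x, F 0 x = x)
           (phiC1 : forall a b, flowC1 F (fun x => U2mx (phi x) a b))
           (haar : is_haar mu).

Local Notation XU := (borel X * borel (U2 R))%type.
Local Notation P := ((muX \x mu)%E : probability XU R).

Lemma bm_fst (f : borel X -> R[i]) : bm f -> bm (fun p : XU => f p.1).
Proof. by move=> bf; apply: (bm_comp _ bf); exact: measurable_fst. Qed.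

Lemma bm_snd (f : borel (U2 R) -> R[i]) : bm f -> bm (fun p : XU => f p.2).
Proof. by move=> bf; apply: (bm_comp _ bf); exact: measurable_snd. Qed.

Lemma bm_cocycle_deriv a b : bm (fun x : borel X => cocycle_deriv F phi x a b).
Proof.
have CA := @bm_conj_algebra R _ (borel X).
apply: (calg_mulmx CA) => {}a {}b.
  under eq_fun do rewrite mxE.
  by apply: ccont_bm => //; have [] := flowC1_lie F0 (phiC1 a b).
apply: (calg_U2V CA) => {}a {}b; apply: ccont_bm => //.
by have [] := phiC1 a b.
Qed.

Definition conj_cocycle (p : XU) : 'M[R[i]]_2 :=
  U2mx p.2 *m cocycle_deriv F phi p.1 *m U2mx (p.2 : U2 R)^-1%g.

Lemma bm_conj_cocycle a b : bm (fun p => conj_cocycle p a b).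
Proof.
have CA := @bm_conj_algebra R _ XU.
have bg a' b' : bm (fun p : XU => U2mx p.2 a' b').
  by apply: (@bm_snd (fun g => U2mx g a' b')); exact: bm_U2_entry.
apply: (calg_mulmx CA) => {}a {}b; last exact: (calg_U2V CA).
apply: (calg_mulmx CA) => {}a {}b; first exact: bg.
by apply: (@bm_fst (fun x => cocycle_deriv F phi x a b)); exact: bm_cocycle_deriv.
Qed.

Definition left_shift (h : U2 R) (p : XU) : XU := (p.1, (h * p.2)%g).

Lemma measurable_left_shift h : measurable_fun setT (left_shift h).
Proof.
apply: measurable_fun_pair; first exact: measurable_fst.
have CA := @bm_conj_algebra R _ XU.
apply: measurable_U2 => a b.
suff [] : bm (fun p : XU => U2mx (h * (p.2 : U2 R))%g a b) by [].
apply: (calg_mulmx CA (A := fun=> U2mx h) (B := fun p : XU => U2mx p.2)) => {}a {}b.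
  exact: (calg_cst CA).
by apply: (@bm_snd (fun g => U2mx g a b)); exact: bm_U2_entry.
Qed.

Lemma left_shift_preserves h : preserves_measure (left_shift h) P.
Proof.
move=> A mA; rewrite /= /product_measure1; apply: eq_integral => x _ /=.
have [hl _] := haar h.
by rewrite -(hl _ (measurable_xsection x mA)); congr (mu _);
  apply/seteqP; split=> g /=; rewrite /xsection /= !inE.
Qed.

(** Left translation by [h] preserves the product measure and conjugates the
    integrand by [h]. *)
Lemma degree_mx_commutes (h : U2 R) :
  U2mx h *m degree_mx F muX mu phi *m U2mx h^-1%g = degree_mx F muX mu phi.
Proof.
have ci a b : cintegrable P (fun p => conj_cocycle p a b).
  by apply: bm_cintegrable; exact: bm_conj_cocycle.
apply/matrixP => a b; rewrite [RHS]mxE -[LHS]/((_ *m _) a b).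
rewrite -[RHS](cintegral_preserves (measurable_left_shift h)
  (left_shift_preserves h) (ci a b)).
have E p : (conj_cocycle (left_shift h p)) a b = \sum_j \sum_i
    U2mx h a i * U2mx h^-1%g j b * conj_cocycle p i j.
  have -> : conj_cocycle (left_shift h p) = U2mx h *m conj_cocycle p *m U2mx h^-1%g.
    case: p => x g.
    rewrite -[LHS]/(U2mx (h * g)%g *m cocycle_deriv F phi x *m U2mx (h * g)^-1%g).
    by rewrite invgM !U2mxM !mulmxA.
  rewrite mxE; apply: eq_bigr => j _; rewrite mxE mulr_suml.
  by apply: eq_bigr => i _; rewrite mulrAC.
rewrite (eq_cintegral _ (g := fun p => \sum_j \sum_i
    U2mx h a i * U2mx h^-1%g j b * conj_cocycle p i j)); last exact: E.
rewrite cintegral_sum; last first.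
  by move=> j; apply: cintegrable_sum => i; exact: cintegrableZ.
rewrite mxE; apply: eq_bigr => j _.
rewrite cintegral_sum; last by move=> i; exact: cintegrableZ.
rewrite mxE mulr_suml; apply: eq_bigr => i _.
by rewrite cintegralZ// mulrAC mxE.
Qed.

Lemma degree_mx_skew : map_mx conjc (degree_mx F muX mu phi)^T = - degree_mx F muX mu phi.
Proof.
have ci a b : cintegrable P (fun p => conj_cocycle p a b).
  by apply: bm_cintegrable; exact: bm_conj_cocycle.
apply/matrixP => a b; rewrite !mxE -(cintegralJ (ci b a)) -mulN1r.
rewrite -(cintegralZ _ (ci a b)); apply: eq_cintegral => p.
have : map_mx conjc (conj_cocycle p)^T = - conj_cocycle p.
  rewrite /conj_cocycle U2mxV.
  move: (U2mx p.2) (cocycle_deriv_skew F0 phiC1 p.1) => G.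
  move: (cocycle_deriv F phi p.1) => M hM.
  rewrite !trmx_mul !map_mxM [(map_mx _ _)^T]map_trmx trmxK hM.
  have -> : map_mx conjc (map_mx conjc G) = G.
    by apply/matrixP => i j; rewrite !mxE conjcK.
  by rewrite mulNmx mulmxN mulmxA.
by move=> /matrixP/(_ a b); rewrite !mxE mulN1r.
Qed.

Lemma degree_mxE : degree_mx F muX mu phi = (0 +i* degree F muX mu phi)%:M.
Proof.
suff : exists s : R, degree_mx F muX mu phi = (0 +i* s)%:M.
  by move=> /cid[s hs]; exact: (xgetPex (P := [set s : R | _]) 0 (ex_intro _ s hs)).
apply: U2_commutant_skew degree_mx_skew => h.
have hE := degree_mx_commutes h.
by rewrite -{2}hE -[RHS]mulmxA -U2mxM mulVg U2mx1 mulmx1.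
Qed.

Lemma bm_drho_conj l m i k : bm (fun p : XU => drho l m (conj_cocycle p) i k).
Proof.
have CA := @bm_conj_algebra R _ XU.
rewrite (_ : (fun _ => _) = (fun p => \sum_a \sum_b
    conj_cocycle p a b * drho l m (delta_mx a b) i k)).
  apply: (calg_sum CA) => a; apply: (calg_sum CA) => b; apply: (calgM CA).
    exact: bm_conj_cocycle.
  exact: (calg_cst CA).
apply/funext => p; rewrite drho_entries summxE; apply: eq_bigr => a _.
by rewrite summxE; apply: eq_bigr => b _; rewrite mxE.
Qed.

(** The integral commutes with the linear map [drho l m], and [drho l m] sends the
    scalar matrix [z] to the scalar [(2 m - l) z]. *)
Lemma integral_drho_conj l m i k :
  cintegral P (fun p : XU => drho l m (conj_cocycle p) i k) =
  (2 * m - l%:Z)%:~R * (0 +i* degree F muX mu phi) * (i == k)%:R.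
Proof.
have ci a b : cintegrable P (fun p => conj_cocycle p a b).
  by apply: bm_cintegrable; exact: bm_conj_cocycle.
have ciM a b (c : R[i]) : cintegrable P (fun p => c * conj_cocycle p a b).
  exact: cintegrableZ.
transitivity (drho l m (degree_mx F muX mu phi) i k); last first.
  by rewrite degree_mxE drho_scalar mxE mulr_natr.
rewrite drho_entries summxE.
rewrite (eq_cintegral _ (g := fun p => \sum_a \sum_b
    drho l m (delta_mx a b) i k * conj_cocycle p a b)); last first.
  move=> p; rewrite drho_entries summxE; apply: eq_bigr => a _.
  by rewrite summxE; apply: eq_bigr => b _; rewrite mxE mulrC.
rewrite cintegral_sum; last by move=> a; exact: cintegrable_sum.
apply: eq_bigr => a _; rewrite cintegral_sum// summxE; apply: eq_bigr => b _.
by rewrite cintegralZ// [RHS]mxE mulrC; congr (_ * _); rewrite mxE.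
Qed.

End Degree.

(** * Ergodic averages of the infinitesimal cocycle *)

Section IteratedCocycle.
Context {R : realType} {X : ptopologicalType}.
Variables (F : R -> X -> X) (phi : X -> U2 R) (l : nat) (m : int).
Hypotheses (F0 : forall x, F 0 x = x) (FD : forall s t x, F (s + t) x = F s (F t x))
           (Fc : forall t, continuous (F t))
           (phiC1 : forall a b, flowC1 F (fun x => U2mx (phi x) a b)).

Fixpoint iter_cocycle (N : nat) (x : X) : U2 R :=
  if N is N'.+1 then (phi x * iter_cocycle N' (F 1 x))%g else 1%g.

Lemma iter_skew_product N (p : X * U2 R) :
  iter N (skew_product F phi) p = (F N%:R p.1, (p.2 * iter_cocycle N p.1)%g).
Proof.
elim: N p => [|N IH] [x g] /=; first by rewrite F0 mulg1.
rewrite -iterS iterSr IH /= -FD; congr (F _ _, _); last by rewrite mulgA.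
by rewrite -natr1.
Qed.

Lemma flowC1_comp (t : R) (a : X -> R[i]) : flowC1 F a -> flowC1 F (fun x => a (F t x)).
Proof.
have cc (b : X -> R[i]) : ccont b -> ccont (fun x => b (F t x)).
  move=> [c1 c2]; split=> x.
    by apply: (@continuous_comp _ _ _ (F t) (fun x => Re (b x))); [exact: Fc|exact: c1].
  by apply: (@continuous_comp _ _ _ (F t) (fun x => Im (b x))); [exact: Fc|exact: c2].
move=> [ca [b cb ab]]; split; first exact: cc.
by exists (fun x => b (F t x)); [exact: cc|exact: flow_deriv_comp].
Qed.

Lemma iter_cocycle_flowC1 N a b : flowC1 F (fun x => U2mx (iter_cocycle N x) a b).
Proof.
have CA := flowC1_conj_algebra F.
elim: N a b => [|N IH] a b; first exact: (calg_cst CA).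
rewrite (_ : (fun x => _) =
  (fun x => (U2mx (phi x) *m U2mx (iter_cocycle N (F 1 x))) a b)) //.
apply: (calg_mulmx CA) => {}a {}b; first exact: phiC1.
by apply: (@flowC1_comp 1 (fun x => U2mx (iter_cocycle N x) a b)).
Qed.

(** The infinitesimal generator of the [N]-th iterate, read in the fibre over
    [x]. By the cocycle relation it is a sum of [N] conjugates of that of the
    first iterate. *)
Definition gen (N : nat) (x : X) : 'M[R[i]]_l.+1 :=
  lie_rho F (iter_cocycle N) l m x *m rho l m (iter_cocycle N x)^-1%g.

Lemma gen0 x : gen 0 x = 0.
Proof.
rewrite /gen (_ : lie_rho _ _ _ _ _ = 0) ?mul0mx//.
have h := mderiv_rho_phi (l := l) m F0 (iter_cocycle_flowC1 0) x 0.
rewrite F0 in h; exact: (mderiv_unique h (mderiv_cst (rho l m 1%g) 0)).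
Qed.

Definition gen1 (x : X) : 'M[R[i]]_l.+1 :=
  lie_rho F phi l m x *m rho l m (phi x)^-1%g.

Lemma genS N x : gen N.+1 x = gen1 x +
  rho l m (phi x) *m gen N (F 1 x) *m rho l m (phi x)^-1%g.
Proof.
have E : lie_rho F (iter_cocycle N.+1) l m x =
    lie_rho F phi l m x *m rho l m (iter_cocycle N (F 1 x)) +
    rho l m (phi x) *m lie_rho F (iter_cocycle N) l m (F 1 x).
  have h1 := mderiv_rho_phi (l := l) m F0 (iter_cocycle_flowC1 N.+1) x 0.
  have h2 : mderiv (fun s => rho l m (iter_cocycle N (F 1 (F s x)))) 0
      (lie_rho F (iter_cocycle N) l m (F 1 x)).
    have h := mderiv_rho_phi (l := l) m F0 (iter_cocycle_flowC1 N) (F 1 x) 0.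
    rewrite F0 in h; move: h; congr (mderiv _ _ _).
    by apply/funext => s; rewrite -!FD addrC.
  have h3 := mderivM (mderiv_rho_phi (l := l) m F0 phiC1 x 0) h2.
  rewrite F0 in h1; apply: (mderiv_unique h1).
  have -> : (fun s => rho l m (iter_cocycle N.+1 (F s x))) =
      (fun s => rho l m (phi (F s x)) *m rho l m (iter_cocycle N (F 1 (F s x)))).
    by apply/funext => s; rewrite -rhoM.
  by move: h3; congr (mderiv _ _ _); rewrite !F0.
rewrite /gen E -[iter_cocycle N.+1 x]/(phi x * iter_cocycle N (F 1 x))%g invgM rhoM.
rewrite mulmxDl; congr (_ + _); last by rewrite !mulmxA.
by rewrite mulmxA -[_ *m _ *m rho l m (iter_cocycle _ _)^-1%g]mulmxA rhoV mulmx1.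
Qed.

(** Conjugating by the fibre coordinate turns the sum of conjugates into a
    Birkhoff sum of the skew product, for an observable whose integral is computed
    by the degree. *)
Lemma birkhoff_gen N (x : X) (g : U2 R) (i k : 'I_l.+1) :
  \sum_(n < N) drho l m (conj_cocycle F phi (iter n (skew_product F phi) (x, g))) i k =
  (rho l m g *m gen N x *m rho l m g^-1%g) i k.
Proof.
elim: N x g => [|N IH] x g; first by rewrite big_ord0 gen0 mulmx0 mul0mx mxE.
rewrite big_ord_recl /=.
under eq_bigr => n _ do rewrite -iterS iterSr.
rewrite IH genS mulmxDr mulmxDl [RHS]mxE; congr (_ + _).
  by rewrite /conj_cocycle /= -(rho_conj_lie l m F0 phiC1).
by rewrite invgM !rhoM !mulmxA.
Qed.

End IteratedCocycle.

Section ErgodicAverage.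
Context {R : realType} {X : ptopologicalType}.
Variables (F : R -> X -> X) (muX : probability (borel X) R).
Variables (mu : probability (borel (U2 R)) R) (phi : X -> U2 R).
Hypotheses (cX : compact [set: X])
           (F0 : forall x, F 0 x = x) (FD : forall s t x, F (s + t) x = F s (F t x))
           (Fc : forall t, continuous (F t))
           (phiC1 : forall a b, flowC1 F (fun x => U2mx (phi x) a b))
           (haar : is_haar mu).

Local Notation XU := (borel X * borel (U2 R))%type.
Local Notation P := ((muX \x mu)%E : probability XU R).
Local Notation T := (skew_product F phi : XU -> XU).
Local Notation gen := (gen F phi).

Lemma bm_phi a b : bm (fun x : borel X => U2mx (phi x) a b).
Proof. by apply: ccont_bm => //; have [] := phiC1 a b. Qed.

Lemma bm_U2_snd a b : bm (fun p : XU => U2mx p.2 a b).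
Proof. by apply: (@bm_snd _ _ (fun g => U2mx g a b)); exact: bm_U2_entry. Qed.

Lemma measurable_skew_product : measurable_fun setT T.
Proof.
apply: measurable_fun_pair.
  apply: (@measurableT_comp _ _ _ _ _ _ (F 1 : borel X -> borel X)).
    exact: continuous_borel.
  exact: measurable_fst.
have CA := @bm_conj_algebra R _ XU.
apply: measurable_U2 => a b.
suff [] : bm (fun p : XU => U2mx (p.2 * phi p.1)%g a b) by [].
apply: (calg_mulmx CA (A := fun p : XU => U2mx p.2)
  (B := fun p : XU => U2mx (phi p.1))) => {}a {}b; first exact: bm_U2_snd.
by apply: (@bm_fst _ _ (fun x => U2mx (phi x) a b)); exact: bm_phi.
Qed.

(** The limit of the averages: [(2 m - l) i s], with [s] the degree. *)
Definition mean (l : nat) (m : int) : R[i] :=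
  (2 * m - l%:Z)%:~R * (0 +i* degree F muX mu phi).

Lemma gen_bound l m : exists K : R, forall N x (i k : 'I_l.+1),
  cnorm (gen l m N x i k) <= N%:R * K.
Proof.
have /choice[K hK] : forall ik : 'I_l.+1 * 'I_l.+1, exists K : R, forall p : XU,
    cnorm (drho l m (conj_cocycle F phi p) ik.1 ik.2) <= K.
  by move=> ik; have [] := bm_drho_conj cX F0 phiC1 m ik.1 ik.2.
exists (\sum_ik `|K ik|) => N x i k.
have -> : gen l m N x i k = (rho l m 1%g *m gen l m N x *m rho l m 1^-1%g) i k.
  by rewrite invg1 rho1 mul1mx mulmx1.
rewrite -(birkhoff_gen m F0 FD Fc phiC1) (le_trans (cnorm_sum _ _))//.
have -> : N%:R * (\sum_ik `|K ik|) = \sum_(n < N) \sum_ik `|K ik|.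
  by rewrite sumr_const card_ord mulr_natl.
apply: ler_sum => n _; rewrite (le_trans (hK (i, k) _))//.
by rewrite (bigD1 (i, k))//= (le_trans (ler_norm _))// lerDl sumr_ge0.
Qed.

Lemma cvg_cnorm_sum (I : Type) (s : seq I) (f : I -> R[i] ^nat) :
  (forall i, (fun N => cnorm (f i N)) @ \oo --> (0 : R)) ->
  (fun N => cnorm (\sum_(i <- s) f i N)) @ \oo --> (0 : R).
Proof.
move=> h; apply: (@squeeze_cvgr _ _ _ _ (fun=> 0) (fun N => \sum_(i <- s) cnorm (f i N))).
- by apply: nearW => N; rewrite cnorm_ge0 cnorm_sum.
- exact: cvg_cst.
- have z : \sum_(i <- s) (0 : R) = 0 by rewrite big1.
  rewrite -[X in _ --> X]z.
  exact: (@cvgr_sum R nat I \oo _ s (fun i N => cnorm (f i N)) (fun=> 0) h).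
Qed.

Lemma cvg_cnormM (c : R[i]) (f : R[i] ^nat) :
  (fun N => cnorm (f N)) @ \oo --> (0 : R) ->
  (fun N => cnorm (c * f N)) @ \oo --> (0 : R).
Proof.
move=> h; have -> : (fun N => cnorm (c * f N)) = (fun N => cnorm c * cnorm (f N)).
  by apply/funext => N; rewrite cnormM.
by rewrite -[X in _ --> X](mulr0 (cnorm c)); apply: cvgM => //; exact: cvg_cst.
Qed.

Lemma cvg_cnorm_ReIm (f : R[i] ^nat) (z : R[i]) :
  Re (f N) @[N --> \oo] --> Re z -> Im (f N) @[N --> \oo] --> Im z ->
  (fun N => cnorm (f N - z)) @ \oo --> (0 : R).
Proof.
move=> h1 h2.
apply: (@squeeze_cvgr _ _ _ _ (fun=> 0) (fun N => `|Re (f N) - Re z| + `|Im (f N) - Im z|)).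
- apply: nearW => N; rewrite cnorm_ge0 /=.
  by rewrite (le_trans (cnorm_le_ReIm _))// !cplxE.
- exact: cvg_cst.
- rewrite -[X in _ --> X](addr0 (0 : R)); apply: cvgD.
    apply/norm_cvg0P.
    by rewrite -(subrr (Re z)); apply: cvgB => //; exact: cvg_cst.
  apply/norm_cvg0P.
  by rewrite -(subrr (Im z)); apply: cvgB => //; exact: cvg_cst.
Qed.

(** The Birkhoff theorem gives convergence of the conjugates by [rho g] for almost
    every [(x, g)]. The limit is a scalar matrix, so that for almost every [x] one
    may pick a suitable [g] and undo the conjugation. *)
Lemma gen_cvg l m : uniquely_ergodic T (haar_prod muX mu) ->
  {ae muX, forall x, forall i k : 'I_l.+1,
    (fun N => cnorm (N%:R^-1 * gen l m N x i k - mean l m * (i == k)%:R)) @ \oo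
      --> (0 : R)}.
Proof.
move=> ue.
pose W i k (p : XU) := drho l m (conj_cocycle F phi p) i k.
have bW i k : bm (W i k) by exact: bm_drho_conj.
have conv i k : {ae P, forall p, (fun N => cnorm (N%:R^-1 * \sum_(n < N) W i k (iter n T p) -
    mean l m * (i == k)%:R)) @ \oo --> (0 : R)}.
  have [[m1 m2] [K hK]] := bW i k.
  have I := integral_drho_conj muX cX F0 phiC1 haar m i k.
  have r1 : Rintegral P setT (Re \o W i k) = Re (mean l m * (i == k)%:R).
    by rewrite -I.
  have r2 : Rintegral P setT (Im \o W i k) = Im (mean l m * (i == k)%:R).
    by rewrite -I.
  have c1 := birkhoff_cvg measurable_skew_product ue m1
    (fun p => le_trans (Re_le_cnorm _) (hK p)).
  have c2 := birkhoff_cvg measurable_skew_product ue m2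
    (fun p => le_trans (Im_le_cnorm _) (hK p)).
  apply: filterS2 c1 c2 => p; rewrite r1 r2 => h1 h2.
  have natE N : (N%:R^-1 : R[i]) = (N%:R^-1 : R)%:C by rewrite fmorphV rmorph_nat.
  apply: cvg_cnorm_ReIm.
    apply: cvg_trans h1; apply: near_eq_cvg; apply: nearW => N.
    by rewrite natE ReM /= mul0r subr0 Re_sum.
  apply: cvg_trans h2; apply: near_eq_cvg; apply: nearW => N.
  by rewrite natE ImM /= mul0r addr0 Im_sum.
have conv2 : {ae P, forall p, forall i k, (fun N => cnorm (N%:R^-1 * \sum_(n < N) W i k (iter n T p) -
    mean l m * (i == k)%:R)) @ \oo --> (0 : R)}.
  have : {ae P, forall p, forall ik : 'I_l.+1 * 'I_l.+1, (fun N => cnorm (N%:R^-1 *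
     \sum_(n < N) W ik.1 ik.2 (iter n T p) -
     mean l m * (ik.1 == ik.2)%:R)) @ \oo --> (0 : R)}.
    by apply: filter_forall => ik; exact: conv.
  by apply: filterS => p h i k; exact: (h (i, k)).
(* a null set of the product has null sections, hence sections that do not
   exhaust U(2) *)
have [A [mA A0 hA]] := conv2.
have h0 : {ae muX, forall x, mu (xsection A x) = 0%E}.
  have mf : measurable_fun setT (fun x => mu (xsection A x)).
    exact: measurable_fun_xsection.
  have [h _] := ae_eq_integral_abs muX measurableT mf.
  have : (\int[muX]_(x in setT) `|mu (xsection A x)| = 0)%E.
    rewrite -[RHS]A0 /= /product_measure1; apply: eq_integral => x _.
    by rewrite gee0_abs.
  by move=> /h; apply: filterS => x /(_ I).
apply: filterS h0 => x hx i k.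
have [g hg] : exists g, ~ xsection A x g.
  apply: contrapT => /forallNP h.
  have : mu (xsection A x) = mu setT.
    by congr (mu _); apply/seteqP; split=> // g _; apply: contrapT; exact: h.
  by rewrite hx probability_setT => /eqP; rewrite eq_sym onee_eq0.
have {}hg i' k' : (fun N => cnorm (N%:R^-1 * \sum_(n < N) W i' k' (iter n T (x, g)) -
    mean l m * (i' == k')%:R)) @ \oo --> (0 : R).
  apply: contrapT => nh; apply: hg; rewrite /xsection /= inE; apply: hA => /= h.
  exact: nh (h i' k').
have E N : N%:R^-1 * gen l m N x i k - mean l m * (i == k)%:R =
   \sum_b \sum_a rho l m g^-1%g i a * rho l m g b k *
     (N%:R^-1 * \sum_(n < N) W a b (iter n T (x, g)) - mean l m * (a == b)%:R).
  pose A' := N%:R^-1 *: gen l m N x - (mean l m)%:M.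
  have -> : N%:R^-1 * gen l m N x i k - mean l m * (i == k)%:R = A' i k.
    by rewrite !mxE mulr_natr.
  have -> : A' = rho l m g^-1%g *m (rho l m g *m A' *m rho l m g^-1%g) *m rho l m g.
    by rewrite !mulmxA rhoVl mul1mx -mulmxA rhoVl mulmx1.
  rewrite mxE; apply: eq_bigr => b _; rewrite mxE mulr_suml.
  apply: eq_bigr => a _; rewrite mulrAC; congr (_ * _).
  rewrite (birkhoff_gen m F0 FD Fc phiC1).
  rewrite /A' mulmxBr mulmxBl.
  have -> : rho l m g *m (N%:R^-1 *: gen l m N x) *m rho l m g^-1%g =
      N%:R^-1 *: (rho l m g *m gen l m N x *m rho l m g^-1%g).
    by move: (rho _ _ g) (rho _ _ g^-1%g) => A1 A2; rewrite -scalemxAr -scalemxAl.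
  have -> : rho l m g *m (mean l m)%:M *m rho l m g^-1%g = (mean l m)%:M.
    by rewrite scalar_mxC -mulmxA rhoV mulmx1.
  by rewrite mxE [X in X + _ = _]mxE [X in _ + X = _]mxE [X in - X]mxE mulr_natr.
under eq_fun do rewrite E.
by apply: cvg_cnorm_sum => b; apply: cvg_cnorm_sum => a; apply: cvg_cnormM.
Qed.

End ErgodicAverage.

(** * The generator of the flow *)

Section Generator.
Context {R : realType} {X : ptopologicalType}.
Variables (F : R -> X -> X) (muX : probability (borel X) R).
Hypotheses (F0 : forall x, F 0 x = x) (FD : forall s t x, F (s + t) x = F s (F t x))
           (Fm : forall t, measurable_fun setT (F t : borel X -> borel X))
           (Fp : forall t, preserves_measure (F t : borel X -> borel X) muX).
Implicit Types (a b w h : borel X -> R[i]).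

Lemma L2_flow t w : L2 muX w -> L2 muX (fun x => w (F t x)).
Proof. by move=> Lw; exact: (L2_preserves (Fm t) (Fp t) Lw). Qed.

Lemma L2norm_flow t w : L2 muX w -> L2norm muX (fun x => w (F t x)) = L2norm muX w.
Proof. by move=> Lw; exact: (L2norm_preserves (Fm t) (Fp t) Lw). Qed.

Lemma bm_flow t a : bm a -> bm (fun x : borel X => a (F t x)).
Proof. by move=> ba; exact: (bm_comp (Fm t) ba). Qed.

Definition quot t w (x : borel X) : R[i] := 'i * (t^-1)%:C * (w (F t x) - w x).

Lemma L2_quot t w : L2 muX w -> L2 muX (quot t w).
Proof. by move=> Lw; apply: L2Z; apply: L2B => //; exact: L2_flow. Qed.

Lemma cnorm_i : cnorm ('i : R[i]) = 1.
Proof. by rewrite /cnorm /nsq /= expr0n add0r expr1n sqrtr1. Qed.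

(** By the mean value theorem the difference quotients are bounded by the
    derivative, so that dominated convergence applies to them. *)
Lemma flow_deriv_quot_bound a b (K : R) t (x : borel X) : flow_deriv F a b ->
  (forall y, cnorm (b y) <= K) -> t != 0 ->
  cnorm ((t^-1)%:C * (a (F t x) - a x)) <= 2 * K.
Proof.
move=> dab bK t0.
have mvt (f df : R -> R) : (forall s, is_derive s (1 : R) f (df s)) ->
    (forall s, `|df s| <= K) -> `|t^-1 * (f t - f 0)| <= K.
  move=> fdf dfK.
  have fc : continuous f.
    by move=> s; apply/differentiable_continuous/derivable1_diffP; have [] := fdf s.
  have [c hc] : exists c, f t - f 0 = df c * t.
    have [tn|tp|te] := ltgtP t 0; last by rewrite te eqxx in t0.
      have [c _ h] := MVT tn (fun s _ => fdf s) (continuous_subspaceT fc).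
      by exists c; rewrite -opprB h sub0r mulrN opprK.
    have [c _ h] := MVT tp (fun s _ => fdf s) (continuous_subspaceT fc).
    by exists c; rewrite h subr0.
  by rewrite hc mulrC mulfK.
rewrite (le_trans (cnorm_le_ReIm _))// mulr_natl mulr2n.
rewrite !cplxE /= mul0r subr0 mul0r addr0 -{2 4}(F0 x).
apply: lerD.
  apply: (mvt (fun s => Re (a (F s x))) (fun s => Re (b (F s x)))).
    by move=> s; have [] := dab x s.
  by move=> s; exact: le_trans (Re_le_cnorm _) (bK _).
apply: (mvt (fun s => Im (a (F s x))) (fun s => Im (b (F s x)))).
  by move=> s; have [] := dab x s.
by move=> s; exact: le_trans (Im_le_cnorm _) (bK _).
Qed.

Lemma flow_deriv_quot_cvg a b (u : R ^nat) (x : borel X) : flow_deriv F a b ->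
  (forall n, u n != 0) -> u @ \oo --> (0 : R) ->
  (fun n => cnorm (((u n)^-1)%:C * (a (F (u n) x) - a x) - b x)) @ \oo --> (0 : R).
Proof.
move=> dab u0 uc.
have [/is_deriveP h1 /is_deriveP h2] := dab x 0.
have u_dnbhs : u @ \oo --> 0^'.
  move=> A hA; have hA' : \forall n \near \oo, u n != 0 -> A (u n) := uc _ hA.
  by apply: filterS hA' => n; apply; exact: u0.
apply: cvg_cnorm_ReIm.
  have := cvg_comp _ _ u_dnbhs h1; rewrite F0; apply: cvg_trans; apply: near_eq_cvg.
  by apply: nearW => n; rewrite /= addr0 !cplxE /= mul0r subr0.
have := cvg_comp _ _ u_dnbhs h2; rewrite F0; apply: cvg_trans; apply: near_eq_cvg.
by apply: nearW => n; rewrite /= addr0 !cplxE /= mul0r addr0.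
Qed.

Lemma flow_deriv_cvg a b (u : R ^nat) (x : borel X) : flow_deriv F a b ->
  u @ \oo --> (0 : R) ->
  (fun n => cnorm (a (F (u n) x) - a x)) @ \oo --> (0 : R).
Proof.
move=> dab uc; have [[d1 _] [d2 _]] := dab x 0.
move/derivable1_diffP/differentiable_continuous in d1.
move/derivable1_diffP/differentiable_continuous in d2.
apply: cvg_cnorm_ReIm.
  by have := cvg_comp _ _ uc d1; rewrite F0.
by have := cvg_comp _ _ uc d2; rewrite F0.
Qed.

(** The product rule for the generator [H = i d/dt]: the difference quotient of
    [a w] splits into three parts; the first is small because [a] is bounded, the other
    two tend to zero by dominated convergence. *)
Lemma H_graph_mul a b w h : flow_deriv F a b -> bm a -> bm b ->
  H_graph F muX w h ->
  H_graph F muX (fun x => a x * w x) (fun x => 'i * b x * w x + a x * h x).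
Proof.
move=> dab ba bb [Lw Lh wh].
have [ma [K hK]] := ba; have [mb [K' hK']] := bb.
have CA := @bm_conj_algebra R _ (borel X).
have K0 : 0 <= K := le_trans (cnorm_ge0 _) (hK point).
have K0' : 0 <= K' := le_trans (cnorm_ge0 _) (hK' point).
have LE : L2 muX (fun x => 'i * b x * w x + a x * h x).
  apply: L2D; last exact: bm_L2M.
  by apply: bm_L2M => //; apply: (calgM CA) => //; exact: (calg_cst CA).
split=> //; first exact: bm_L2M.
(* [a] and [w] are moved by the flow one after the other *)
pose r1 t x := a (F t x) * (quot t w x - h x).
pose r2 t x := (a (F t x) - a x) * h x.
pose r3 t x := 'i * ((t^-1)%:C * (a (F t x) - a x) - b x) * w x.
have bmr2 t : bm (fun x : borel X => a (F t x) - a x).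
  have := calgD CA (bm_flow t ba) (calgM CA (calg_cst CA (-1)) ba).
  by congr bm; apply/funext => x; rewrite mulN1r.
have bmr3 t : bm (fun x : borel X => 'i * ((t^-1)%:C * (a (F t x) - a x) - b x)).
  apply: (calgM CA (calg_cst CA _)).
  have := calgD CA (calgM CA (calg_cst CA (t^-1)%:C) (bmr2 t))
    (calgM CA (calg_cst CA (-1)) bb).
  by congr bm; apply/funext => x; rewrite mulN1r.
have L1 t : L2 muX (r1 t).
  by apply: bm_L2M; [exact: bm_flow|apply: L2B => //; exact: L2_quot].
have L2' t : L2 muX (r2 t) by exact: bm_L2M.
have L3 t : L2 muX (r3 t) by exact: bm_L2M.
have nsq_cnorm_le (z : R[i]) (M : R) : cnorm z <= M -> nsq z <= M ^+ 2.
  move=> zM; rewrite -cnorm_sqr lerXn2r ?nnegrE ?cnorm_ge0//.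
  exact: le_trans (cnorm_ge0 _) zM.
have c1 : L2norm muX (r1 t) @[t --> 0^'] --> (0 : R).
  apply: (@squeeze_cvgr _ _ _ _ (fun=> 0) (fun t => K * L2norm muX (fun x => quot t w x - h x))).
  - apply: nearW => t; rewrite L2norm_ge0 /=.
    apply: L2norm_bdM => //; first by have [] := bm_flow t ba.
    by apply: L2B => //; exact: L2_quot.
  - exact: cvg_cst.
  - by rewrite -[X in _ --> X](mulr0 K); apply: cvgM; [exact: cvg_cst|exact: wh].
have c2 : L2norm muX (r2 t) @[t --> 0^'] --> (0 : R).
  apply/cvgr_dnbhsP => u [u0 uc].
  apply: (@L2_dominated_cvg0 _ _ _ _ _ (fun x => (2 * K) ^+ 2 * nsq (h x))).
  - by move=> n; exact: L2_cmeas.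
  - have := integrableZl measurableT ((2 * K) ^+ 2) (L2_nsq Lh).
    by apply: eq_integrable.
  - move=> n x; rewrite nsqM ler_wpM2r ?nsq_ge0//; apply: nsq_cnorm_le.
    by rewrite (le_trans (cnormD _ _))// cnormN mulr_natl mulr2n lerD.
  - apply/aeW => x; rewrite /r2; under eq_fun do rewrite mulrC.
    by apply: cvg_cnormM; exact: flow_deriv_cvg.
have c3 : L2norm muX (r3 t) @[t --> 0^'] --> (0 : R).
  apply/cvgr_dnbhsP => u [u0 uc].
  apply: (@L2_dominated_cvg0 _ _ _ _ _ (fun x => (2 * K' + K') ^+ 2 * nsq (w x))).
  - by move=> n; exact: L2_cmeas.
  - have := integrableZl measurableT ((2 * K' + K') ^+ 2) (L2_nsq Lw).
    by apply: eq_integrable.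
  - move=> n x; rewrite nsqM ler_wpM2r ?nsq_ge0//; apply: nsq_cnorm_le.
    rewrite cnormM cnorm_i mul1r (le_trans (cnormD _ _))// cnormN lerD//.
    exact: flow_deriv_quot_bound.
  - apply/aeW => x; rewrite /r3; under eq_fun do rewrite mulrC mulrA.
    by apply: cvg_cnormM; exact: flow_deriv_quot_cvg.
apply: (@squeeze_cvgr _ _ _ _ (fun=> 0) (fun t => L2norm muX (r1 t) + L2norm muX (r2 t) + L2norm muX (r3 t))).
- apply: nearW => t; rewrite L2norm_ge0 /=.
  rewrite (_ : (fun x => _) = (fun x => r1 t x + r2 t x + r3 t x)).
    rewrite (le_trans (L2normD (L2D (L1 t) (L2' t)) (L3 t)))// lerD2r.
    exact: L2normD.
  by apply/funext => x; rewrite /r1 /r2 /r3 /quot; ring.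
- exact: cvg_cst.
- rewrite -[X in _ --> X](addr0 (0 : R)); apply: cvgD => //.
  by rewrite -[X in _ --> X](addr0 (0 : R)); apply: cvgD.
Qed.

Lemma H_graph_flow s w h : H_graph F muX w h ->
  H_graph F muX (fun x => w (F s x)) (fun x => h (F s x)).
Proof.
move=> [Lw Lh wh]; split; [exact: L2_flow|exact: L2_flow|].
apply: cvg_trans wh; apply: near_eq_cvg; apply: nearW => t.
rewrite -(L2norm_flow s); last by apply: L2B => //; exact: L2_quot.
congr (L2norm _ _); apply/funext => x /=.
by rewrite -!FD [s + t]addrC.
Qed.

Lemma H_graph_lin (c : R[i]) w h w' h' : H_graph F muX w h -> H_graph F muX w' h' ->
  H_graph F muX (fun x => c * w x + w' x) (fun x => c * h x + h' x).
Proof.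
move=> [Lw Lh wh] [Lw' Lh' wh']; split; [by apply: L2D => //; exact: L2Z..|].
pose r1 t x := c * (quot t w x - h x).
pose r2 t x := quot t w' x - h' x.
have L1 t : L2 muX (r1 t) by apply: L2Z; apply: L2B => //; exact: L2_quot.
have L2' t : L2 muX (r2 t) by apply: L2B => //; exact: L2_quot.
apply: (@squeeze_cvgr _ _ _ _ (fun=> 0) (fun t => cnorm c * L2norm muX (fun x => quot t w x - h x) + L2norm muX (r2 t))).
- apply: nearW => t; rewrite L2norm_ge0 /=.
  rewrite -L2normZ; last by apply: L2B => //; exact: L2_quot.
  rewrite (_ : (fun x => _) = (fun x => r1 t x + r2 t x)); first exact: L2normD.
  by apply/funext => x; rewrite /r1 /r2 /quot; ring.
- exact: cvg_cst.
- rewrite -[X in _ --> X](addr0 (0 : R)); apply: cvgD => //.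
  by rewrite -[X in _ --> X](mulr0 (cnorm c)); apply: cvgM; [exact: cvg_cst|exact: wh].
Qed.

Lemma H_graph0 : H_graph F muX (fun=> 0) (fun=> 0).
Proof.
split; [exact: L20..|].
rewrite (_ : (fun t => _) = (fun=> 0)); first exact: cvg_cst.
apply/funext => t; rewrite L2norm0//; last by apply/aeW => x _; rewrite !subr0 mulr0.
by apply: (L2_ext _ (L20 muX)) => x; rewrite !subr0 mulr0.
Qed.

Lemma H_graph_sum (I : Type) (s : seq I) (w h : I -> borel X -> R[i]) :
  (forall i, H_graph F muX (w i) (h i)) ->
  H_graph F muX (fun x => \sum_(i <- s) w i x) (fun x => \sum_(i <- s) h i x).
Proof.
move=> wh; elim: s => [|i s IH].
  rewrite (_ : (fun x => _) = (fun=> 0)); last by apply/funext => x; rewrite big_nil.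
  rewrite (_ : (fun x => \sum_(i <- [::]) h i x) = (fun=> 0)); first exact: H_graph0.
  by apply/funext => x; rewrite big_nil.
have := H_graph_lin 1 (wh i) IH.
by congr (H_graph _ _ _ _); apply/funext => x; rewrite big_cons mul1r.
Qed.

Lemma cvg_L2inner_l (r : R -> borel X -> R[i]) f g : L2 muX f -> L2 muX g ->
  (forall t, L2 muX (r t)) ->
  L2norm muX (fun x => r t x - f x) @[t --> 0^'] --> (0 : R) ->
  cnorm (L2inner muX (r t) g - L2inner muX f g) @[t --> 0^'] --> (0 : R).
Proof.
move=> Lf Lg Lr h.
apply: (@squeeze_cvgr _ _ _ _ (fun=> 0) (fun t => L2norm muX (fun x => r t x - f x) * L2norm muX g)).
- apply: nearW => t; rewrite cnorm_ge0 /= -L2innerBl//.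
  by apply: cauchy_schwarz => //; exact: L2B.
- exact: cvg_cst.
- by rewrite -[X in _ --> X](mul0r (L2norm muX g)); apply: cvgM => //; exact: cvg_cst.
Qed.

(** Since the flow preserves the measure, the adjoint of the difference quotient
    at time [t] is the difference quotient at time [- t]. *)
Lemma H_symmetric w h w' h' : H_graph F muX w h -> H_graph F muX w' h' ->
  L2inner muX h w' = L2inner muX w h'.
Proof.
move=> [Lw Lh wh] [Lw' Lh' wh'].
have c1 := cvg_L2inner_l Lh Lw' (fun t => L2_quot t Lw) wh.
have c2 := cvg_L2inner_l Lh' Lw (fun t => L2_quot t Lw') wh'.
have E t : L2inner muX (quot t w) w' = conjc (L2inner muX (quot (- t) w') w).
  have Lq := L2_quot (- t) Lw'.
  rewrite -L2innerC// -(L2inner_preserves (Fm t) (Fp t) Lw Lq).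
  have -> : quot (- t) w' \o F t = (fun x => 'i * (t^-1)%:C * (w' (F t x) - w' x)).
    apply/funext => x; rewrite /quot /= -FD addNr F0 invrN rmorphN /= mulrN mulNr -mulrN opprB.
    by [].
  rewrite (L2innerZr _ (L2B (L2_flow t Lw') Lw') (L2_flow t Lw)).
  rewrite (L2innerZl _ (L2B (L2_flow t Lw) Lw) Lw').
  rewrite (L2innerBl (L2_flow t Lw) Lw Lw') (L2innerBr (L2_flow t Lw') Lw' (L2_flow t Lw)).
  have := L2inner_preserves (Fm t) (Fp t) Lw Lw'; rewrite /comp => ->.
  have -> : conjc ('i * (t^-1)%:C) = - ('i * (t^-1)%:C) :> R[i].
    by apply: complex_eqP; rewrite !cplxE /=; ring.
  by rewrite mulNr -mulrN opprB.
have c3 : cnorm (L2inner muX (quot (- t) w') w - L2inner muX h' w) @[t --> 0^'] --> (0 : R).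
  have : (fun t : R => - t) @ 0^' --> 0^'.
    have nc : (fun t : R => - t) @ (0 : R) --> (0 : R).
      by rewrite -[X in _ --> X]oppr0; apply: cvgN; exact: cvg_id.
    move=> A hA; have hA' : \forall t \near (0 : R), - t != 0 -> A (- t) := nc _ hA.
    by apply: filterS hA' => t ht t0; apply: ht; rewrite oppr_eq0.
  by move=> nd; exact: (cvg_comp _ _ nd c2).
have c4 : cnorm (L2inner muX h w' - L2inner muX w h') @[t --> (0 : R)^'] --> (0 : R).
  apply: (@squeeze_cvgr _ _ _ _ (fun=> 0) (fun t =>
     cnorm (L2inner muX (quot t w) w' - L2inner muX h w') +
     cnorm (L2inner muX (quot (- t) w') w - L2inner muX h' w))).
  - apply: nearW => t; rewrite cnorm_ge0 /=.
    rewrite -(cnormJ (L2inner muX (quot (- t) w') w - _)) conjcD conjcN -E -L2innerC//.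
    rewrite -[X in _ <= X + _]cnormN.
    by rewrite (le_trans _ (cnormD _ _))// opprB addrA subrK.
  - exact: cvg_cst.
  - by rewrite -[X in _ --> X](addr0 (0 : R)); apply: cvgD.
have := cvg_unique _ (cvg_cst _) c4; move=> /(_ (@Rhausdorff R)) h0.
by apply/eqP; rewrite -subr_eq0; apply/eqP; apply: cnorm_eq0; exact: h0.
Qed.

End Generator.

(** * Averages along the flow *)

Section JointMeasurability.
Context {R : realType}.

(** An open subset of [R * X] is a countable union of rectangles: for each ball
    with rational centre take the union of all open sets that fit. *)
Lemma continuous_prod_measurable {X Y : ptopologicalType} (f : R * X -> Y) :
  continuous f ->
  measurable_fun setT (f : (measurableTypeR R * borel X)%type -> borel Y).
Proof.
move=> cf; apply: measurable_fun_borel => U oU.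
have oO : open (f @^-1` U) by exact: open_comp.
pose V (i : rat * nat) : set X := \bigcup_(W in [set W : set X | open W /\
   forall s x, ball (ratr i.1 : R) i.2.+1%:R^-1 s -> W x -> U (f (s, x))]) W.
have oV i : open (V i) by apply: bigcup_open => W [].
rewrite (_ : f @^-1` U = \bigcup_n (if unpickle n is Some i then
    ball (ratr i.1 : R) i.2.+1%:R^-1 `*` V i else set0)).
  apply: bigcupT_measurable => n; case: (unpickle n) => // i.
  by apply: measurableX; [exact: measurable_ball|exact: open_borel_measurable].
apply/seteqP; split=> [[s x] /= Uf|[s x] [n _]]; last first.
  by case: (unpickle n) => // i [/= bs [W [_ hW] Wx]]; exact: hW.
have [[A B] [/= nA nB] AB] : nbhs (s, x) (f @^-1` U).
  by apply: open_nbhs_nbhs; split.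
have /nbhs_ballP[e /= e0 eA] := nA.
have [k hk] : exists k : nat, k.+1%:R^-1 < e / 2.
  have e2 : 0 < e / 2 by rewrite divr_gt0.
  exists (Num.truncn (e / 2)^-1); rewrite invf_plt ?posrE//.
  exact: truncnS_gt.
have k0 : 0 < k.+1%:R^-1 :> R by rewrite invr_gt0.
have lt_s : s - k.+1%:R^-1 < s + k.+1%:R^-1 by rewrite ltrD2l gtrN.
have [q hq] := rat_in_itvoo lt_s.
have {}hq : `|ratr q - s| < k.+1%:R^-1 by rewrite ltr_distl; move: hq; rewrite in_itv.
exists (pickle (q, k)); first exact: I.
rewrite pickleK; split; first by rewrite -ball_normE.
have [W [oW Wx] WB] : exists2 W, open_nbhs x W & W `<=` B by move: nB; rewrite nbhsE.
exists W => //; split=> // s' x' bs' Wx'; apply: AB; split => /=; last exact: WB.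
apply: eA; rewrite -ball_normE /=; move: bs'; rewrite -ball_normE /= => bs'.
rewrite (_ : s - s' = (s - ratr q) + (ratr q - s')); last by ring.
by rewrite (le_lt_trans (ler_normD _ _))// (splitr e) ltrD ?(lt_trans _ hk)// distrC.
Qed.

End JointMeasurability.

Section Antiderivative.
Context {R : realType}.
Local Notation leb := (@lebesgue_measure R).

(** The bound [3] leaves room for the shifts by a time less than [1] of an average
    over an interval of length at most [1]. *)
Lemma continuous_antiderivative (g : R -> R) : continuous g ->
  exists G : R -> R, forall t, `|t| < 3 -> is_derive t (1 : R) G (g t).
Proof.
move=> cg; exists (fun t => Rintegral leb `[-4, t] g) => t.
rewrite ltr_norml => /andP[t1 t2].
have ig : leb.-integrable `[-4, (4 : R)] (EFin \o g).
  by apply: continuous_compact_integrable; [exact: segment_compact|exact: continuous_subspaceT].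
have t4 : t < 4 by rewrite (lt_trans t2)// ltr_nat.
have t4' : -4 < t by rewrite (lt_trans _ t1)// ltrN2 ltr_nat.
have [d1 d2] := continuous_FTC1_closed t4 ig t4' (cg t).
by apply: DeriveDef => //; rewrite -d2 derive1E.
Qed.

Lemma Rintegral_antiderivative (g G : R -> R) (e : R) : 0 < e -> e <= 1 ->
  continuous g -> (forall t, `|t| < 2 -> is_derive t (1 : R) G (g t)) ->
  Rintegral leb `[0, e] g = G e - G 0.
Proof.
move=> e0 e1 cg dG.
have in2 t : 0 <= t <= e -> `|t| < 2.
  move=> /andP[t0 te]; rewrite ger0_norm// (le_lt_trans te)// (le_lt_trans e1)//.
  by rewrite ltr1n.
have Gc t : 0 <= t <= e -> {for t, continuous G}.
  move=> h; apply/differentiable_continuous/derivable1_diffP.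
  by have [] := dG _ (in2 _ h).
rewrite /Rintegral (@continuous_FTC2 _ g G 0 e)//.
- exact: continuous_subspaceT.
- split.
  + move=> t; rewrite in_itv /= => /andP[h1 h2].
    have t2 : `|t| < 2 by apply: in2; rewrite (ltW h1) (ltW h2).
    by have [] := dG t t2.
  + apply: cvg_at_right_filter; apply: Gc; rewrite lexx ltW//.
  + by apply: cvg_at_left_filter; apply: Gc; rewrite lexx ltW.
- move=> t; rewrite in_itv /= => /andP[h1 h2].
  have t2 : `|t| < 2 by apply: in2; rewrite (ltW h1) (ltW h2).
  by have [_ h] := dG t t2; rewrite derive1E.
Qed.

End Antiderivative.

Section FlowAverage.
Context {R : realType} {X : ptopologicalType}.
Variables (F : R -> X -> X) (muX : probability (borel X) R).
Hypotheses (F0 : forall x, F 0 x = x) (FD : forall s t x, F (s + t) x = F s (F t x))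
           (Fc : continuous (fun p : R * X => F p.1 p.2))
           (Fm : forall t, measurable_fun setT (F t : borel X -> borel X))
           (Fp : forall t, preserves_measure (F t : borel X -> borel X) muX).
Local Notation leb := (@lebesgue_measure R).

Let Fct (x : X) : continuous (fun t => F t x).
Proof.
move=> t; apply: (@continuous_comp _ _ _ (fun t : R => (t, x)) (fun p => F p.1 p.2)).
  exact: continuous_pairl.
exact: Fc.
Qed.

Variable v : X -> R.
Hypotheses (vc : continuous v) (v01 : forall x, 0 <= v x <= 1).

Let vFc (x : X) : continuous (fun t => v (F t x)).
Proof.
by move=> t; apply: (@continuous_comp _ _ _ (fun t => F t x) v); [exact: Fct|exact: vc].
Qed.

(** Averaging over a short piece of orbit makes a continuous function differentiable
    along the flow, and is close to the identity. *)
Definition flow_avg (e : R) (x : X) : R :=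
  e^-1 * Rintegral leb `[0, e] (fun s => v (F s x)).

Lemma flow_avgE (e : R) (x : X) (G : R -> R) (t : R) : 0 < e -> e <= 1 ->
  (forall s, `|s| < 3 -> is_derive s (1 : R) G (v (F s x))) -> `|t| < 1 ->
  flow_avg e (F t x) = e^-1 * (G (t + e) - G t).
Proof.
move=> e0 e1 dG t1; rewrite /flow_avg; congr (_ * _).
have dGt s : `|s| < 2 -> is_derive s (1 : R) (fun s => G (s + t)) (v (F s (F t x))).
  move=> s2; rewrite -FD; apply: is_derive_shift; apply: dG.
  by rewrite (le_lt_trans (ler_normD _ _))// (_ : 3 = 2 + 1) ?ltrD//; ring.
rewrite (Rintegral_antiderivative e0 e1 (@vFc (F t x)) dGt).
by rewrite [e + t]addrC add0r.
Qed.

Lemma flow_avg_range e x : 0 < e -> e <= 1 -> 0 <= flow_avg e x <= 1.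
Proof.
move=> e0 e1; have [G dG] := continuous_antiderivative (@vFc x).
have := flow_avgE e0 e1 dG (t := 0); rewrite normr0 F0 add0r => -> //.
have in3 s : s \in `]0, e[ -> `|s| < 3.
  rewrite in_itv /= => /andP[s0 se]; rewrite gtr0_norm// (lt_trans se)//.
  by rewrite (le_lt_trans e1)// ltr1n.
have Gc : {within `[0, e], continuous G}.
  apply: continuous_in_subspaceT => s; rewrite inE /= in_itv /= => /andP[s0 se].
  apply/differentiable_continuous/derivable1_diffP.
  suff h : `|s| < 3 by have [] := dG s h.
  by rewrite ger0_norm// (le_lt_trans se)// (le_lt_trans e1)// ltr1n.
have [c _ ->] := MVT e0 (fun s hs => dG s (in3 s hs)) Gc.
by rewrite subr0 mulrCA mulVf ?mulr1// gt_eqF.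
Qed.

Lemma flow_avg_deriv e : 0 < e -> e <= 1 ->
  flow_deriv F (fun x => (flow_avg e x)%:C) (fun x => (e^-1 * (v (F e x) - v x))%:C).
Proof.
move=> e0 e1 x t; split; last exact: is_derive_cst.
pose y := F t x.
have [G dG] := continuous_antiderivative (@vFc y).
have d0 : is_derive (0 : R) (1 : R) (fun s => flow_avg e (F s y)) (e^-1 * (v (F e y) - v y)).
  have e3 : `|0 + e| < 3 :> R.
    by rewrite add0r gtr0_norm// (le_lt_trans e1)// ltr1n.
  have n3 : `|0 : R| < 3 by rewrite normr0.
  have h1 := is_derive_shift (dG _ e3); have h2 := dG _ n3.
  rewrite add0r in h1; rewrite F0 in h2.
  apply: (@near_eq_is_derive _ _ _ (e^-1 \*: ((fun s => G (s + e)) - G))).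
    have near0 : \forall s \near (0 : R), `|s| < 1.
      by have := @nbhsx_ballx _ R^o 0 1 ltr01; apply: filterS => s;
        rewrite -ball_normE /= sub0r normrN.
    by apply: filterS near0 => s s1; rewrite (flow_avgE e0 e1 dG s1).
have := @is_derive_shift _ (fun s => flow_avg e (F s y)) t (- t) (e^-1 * (v (F e y) - v y)).
rewrite subrr => /(_ d0) /=.
by rewrite /y; under eq_fun do rewrite -FD subrK.
Qed.

Lemma measurable_flow_avg e : measurable_fun setT (flow_avg e : borel X -> R).
Proof.
apply: measurable_funM; first exact: measurable_cst.
pose f (p : borel X * measurableTypeR R) : \bar R :=
  (v (F p.2 p.1) * \1_(`[0, e]%classic) p.2)%:E.
have -> : (fun x : borel X => Rintegral leb `[0, e] (fun s => v (F s x))) =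
    (fun x => fine (\int[leb]_s f (x, s))).
  apply/funext => x; rewrite /Rintegral integral_mkcond; congr fine.
  by apply: eq_integral => s _; rewrite /f /= patchE indicE; case: ifP => hs;
    rewrite ?mulr1 ?mulr0.
have mf : measurable_fun setT f.
  apply/measurable_EFinP; apply: measurable_funM; last first.
    by apply: (measurableT_comp (measurable_indic (measurable_itv _))); exact: measurable_snd.
  have mv : measurable_fun setT (v : borel X -> R) by exact: continuous_measurable_real.
  have mF := continuous_prod_measurable Fc.
  apply: (measurableT_comp mv); apply: (measurableT_comp mF (g := fun p : borel X * measurableTypeR R => (p.2, p.1))).
  by apply: measurable_fun_pair; [exact: measurable_snd|exact: measurable_fst].
have f0 p : (0 <= f p)%E.
  rewrite lee_fin mulr_ge0//; first by have /andP[] := v01 (F p.2 p.1).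
apply: measurableT_comp; first exact: fine_measurable.
exact: (@measurable_fun_fubini_tonelli_F _ _ _ _ _ leb f mf f0).
Qed.

Lemma flow_avg_cvg x :
  (fun n : nat => flow_avg n.+1%:R^-1 x) @ \oo --> v x.
Proof.
have [G dG] := continuous_antiderivative (@vFc x).
have n3 : `|0 : R| < 3 by rewrite normr0.
have /is_deriveP := dG _ n3; rewrite F0 => /cvgr_dnbhsP h.
have := h (fun n => n.+1%:R^-1); move=> /(_ _)/wrap[].
  split; first by move=> n; rewrite invr_eq0.
  exact: cvg_harmonic.
apply: cvg_trans; apply: near_eq_cvg; apply: nearW => n.
have := @flow_avgE n.+1%:R^-1 x G 0; rewrite F0 => -> //; last by rewrite normr0.
- by rewrite addr0 add0r invrK.
- by rewrite invf_le1 ?ler1n.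
Qed.

Lemma flow_avg_H_graph e : 0 < e -> e <= 1 -> exists h,
  H_graph F muX (fun x => (flow_avg e x)%:C) h.
Proof.
move=> e0 e1.
have b1 : bm (fun x : borel X => (flow_avg e x)%:C).
  split; first by split; [exact: measurable_flow_avg|exact: measurable_cst].
  exists 1 => x; rewrite /cnorm nsqC sqrtr_sqr.
  by have /andP[h1 h2] := flow_avg_range x e0 e1; rewrite ger0_norm.
have mv : measurable_fun setT (v : borel X -> R) by exact: continuous_measurable_real.
have b2 : bm (fun x : borel X => (e^-1 * (v (F e x) - v x))%:C).
  split.
    split; last exact: measurable_cst.
    apply: measurable_funM; first exact: measurable_cst.
    by apply: measurable_funB => //; exact: (measurableT_comp mv (Fm e)).
  exists (e^-1 * (1 + 1)) => x; rewrite /cnorm nsqC sqrtr_sqr normrM.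
  rewrite (@gtr0_norm _ e^-1) ?invr_gt0//.
  apply: ler_wpM2l; first by rewrite invr_ge0 ltW.
  rewrite (le_trans (ler_normB _ _))// lerD// ger0_norm;
    by [have /andP[] := v01 (F e x)|have /andP[] := v01 x].
have H1 : H_graph F muX (fun=> 1) (fun=> 0).
  split; [by apply: bm_L2; exact: (calg_cst bm_conj_algebra)|exact: L20|].
  rewrite (_ : (fun t => _) = (fun=> 0)); first exact: cvg_cst.
  apply/funext => t; rewrite L2norm0//; last by apply/aeW => x _; rewrite subrr mulr0 subr0.
  by apply: (L2_ext _ (L20 muX)) => x; rewrite subrr mulr0 subr0.
have := H_graph_mul F0 Fm Fp (flow_avg_deriv e0 e1) b1 b2 H1.
rewrite (_ : (fun x => _ * 1) = (fun x => (flow_avg e x)%:C)); last first.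
  by apply/funext => x; rewrite mulr1.
by move=> h; eexists; exact: h.
Qed.

End FlowAverage.

(** * Closed subspaces containing the indicators of a pi-system *)

Import HBNNSimple.

Section Totality.
Context {R : realType} {d : measure_display} {T : measurableType d}.
Variables (mu : probability T R) (C : (T -> R[i]) -> Prop) (G : set (set T)).
Hypotheses (CL2 : forall f, C f -> L2 mu f) (C0 : C (fun=> 0))
  (Clin : forall c f g, C f -> C g -> C (fun x => c * f x + g x))
  (Cclosed : forall f, L2 mu f -> (forall e : R, 0 < e ->
     exists2 g, C g & L2norm mu (fun x => f x - g x) < e) -> C f).
Hypotheses (GT : G setT) (GI : setI_closed G) (Gm : G `<=` measurable)
  (Ggen : forall A : set T, measurable A -> <<s G >> A)
  (GC : forall A, G A -> C (fun x => (\1_A x : R)%:C)).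

Lemma total_sum (I : Type) (s : seq I) (c : I -> R[i]) (f : I -> T -> R[i]) :
  (forall i, C (f i)) -> C (fun x => \sum_(i <- s) c i * f i x).
Proof.
move=> hf; elim: s => [|i s IH].
  rewrite (_ : (fun x => _) = (fun=> 0)); first exact: C0.
  by apply/funext => x; rewrite big_nil.
have := Clin (c i) (hf i) IH.
by congr C; apply/funext => x; rewrite big_cons.
Qed.

(** Dominated convergence turns pointwise approximation into approximation in
    norm. *)
Lemma total_lim (f : (T -> R[i]) ^nat) (g : T -> R[i]) (h : T -> R) :
  (forall n, C (f n)) -> L2 mu g -> mu.-integrable setT (EFin \o h) ->
  (forall n x, nsq (g x - f n x) <= h x) ->
  (forall x, (fun n => cnorm (g x - f n x)) @ \oo --> (0 : R)) -> C g.
Proof.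
move=> hf Lg ih fh fg; apply: Cclosed => // e e0.
have lim0 : (fun n => L2norm mu (fun x => g x - f n x)) @ \oo --> (0 : R).
  apply: (@L2_dominated_cvg0 _ _ _ _ _ h) => //.
  - by move=> n; apply: (@L2_cmeas _ _ _ mu); apply: L2B => //; exact: CL2.
  - by apply: aeW => x; exact: fg.
move/cvgr0Pnorm_lt: lim0 => /(_ _ e0)[n _ /(_ n (leqnn n))].
by rewrite ger0_norm ?L2norm_ge0// => hn; exists (f n).
Qed.

(** Functions with values in [[0, 1]] need no further domination. *)
Lemma total_lim01 (f : (T -> R) ^nat) (g : T -> R) :
  (forall n, C (fun x => (f n x)%:C)) -> measurable_fun setT g ->
  (forall n x, 0 <= f n x <= 1) -> (forall x, 0 <= g x <= 1) ->
  (forall x, f n x @[n --> \oo] --> g x) -> C (fun x => (g x)%:C).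
Proof.
move=> hf mg f01 g01 fg.
apply: (@total_lim (fun n x => (f n x)%:C) _ (fun=> 1)) => //.
- apply: bm_L2; split; first by split=> //; exact: measurable_cst.
  exists 1 => x; rewrite /cnorm nsqC sqrtr_sqr.
  by have /andP[g0 g1] := g01 x; rewrite ger0_norm.
- exact: finite_measure_integrable_cst.
- move=> n x; rewrite -rmorphB nsqC -[1](expr1n _ 2) -[_ ^+ 2]real_normK ?num_real//.
  rewrite lerXn2r ?nnegrE ?ler_norml//.
  have /andP[g0 g1] := g01 x; have /andP[h0 h1] := f01 n x.
  by apply/andP; split; lra.
- move=> x; rewrite (_ : (fun n => _) = (fun n => `|g x - f n x|)); last first.
    by apply/funext => n; rewrite -rmorphB /cnorm nsqC sqrtr_sqr.
  apply/norm_cvg0P; rewrite -[X in _ --> X](subrr (g x)).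
  by apply: cvgB; [exact: cvg_cst|exact: fg].
Qed.

Lemma indic01 (A : set T) x : 0 <= (\1_A x : R) <= 1.
Proof. by rewrite indicE; case: (x \in A); rewrite /= ?lexx ?ler01. Qed.

Lemma total_indic (A : set (T)) : measurable A ->
  C (fun x => (\1_A x : R)%:C).
Proof.
pose D : set (set (T)) := [set A | measurable A /\ C (fun x => (\1_A x : R)%:C)].
have H1 : C (fun x => (\1_[set: T] x : R)%:C) by exact: GC GT.
have dD : dynkin D.
  split.
  - by split.
  - move=> B [mB hB]; split; first exact: measurableC.
    have := Clin (-1) hB H1.
    congr C; apply/funext => x.
    rewrite !indicE in_setT in_setC; case: (x \in B) => /=.
      by rewrite mulr1 addNr.
    by rewrite mulr0 add0r.
  - move=> A_ tA hA; have mA i : measurable (A_ i) by have [] := hA i.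
    split; first exact: bigcupT_measurable.
    have E n x : (\sum_(i < n) \1_(A_ i) x : R) = \1_(\bigcup_(i < n) A_ i) x.
      elim: n => [|n IH].
        by rewrite big_ord0 bigcup_mkord big_ord0 indicE in_set0.
      rewrite big_ord_recr IH !bigcup_mkord big_ord_recr /= -!bigcup_mkord !indicE in_setU.
      have [xn|xn] := boolP (x \in A_ n); last by rewrite orbF addr0.
      rewrite orbT memNset ?add0r//= => -[i /= ni Ai]; move: xn => /set_mem xn.
      by have := tA i n I I (ex_intro _ x (conj Ai xn)) => e; rewrite e ltnn in ni.
    apply: (@total_lim01 (fun n x => \1_(\bigcup_(i < n) A_ i) x)).
    + move=> n; have := @total_sum 'I_n (index_enum _) (fun=> 1) (fun i x => (\1_(A_ i) x : R)%:C) (fun i => (hA i).2).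
      congr C; apply/funext => x; rewrite -E rmorph_sum /=.
      by apply: eq_bigr => i _; rewrite mul1r.
    + by apply: measurable_indic; exact: bigcupT_measurable.
    + by move=> n x; exact: indic01.
    + by move=> x; exact: indic01.
    + move=> x; have [[i _ Ai]|nA] := pselect ((\bigcup_i A_ i) x).
        rewrite [X in _ --> X]indicE mem_set; last by exists i.
        apply: cvg_near_cst; exists i.+1 => // n /= ni.
        by rewrite indicE mem_set//; exists i.
      rewrite [X in _ --> X]indicE memNset//.
      apply: cvg_near_cst; apply: nearW => n; rewrite indicE memNset//.
      by move=> [i _ Ai]; apply: nA; exists i.
have : <<d G >> `<=` D by apply: smallest_sub => // B GB; split; [exact: Gm|exact: GC].
rewrite setI_closed_g_dynkin_g_sigma_algebra// => sD mA.
by have [] := sD A (Ggen mA).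
Qed.

Lemma total_nneg (g : T -> R) : (forall x, 0 <= g x) ->
  L2 mu (fun x => (g x)%:C) -> C (fun x => (g x)%:C).
Proof.
move=> g0 Lg.
have mg : measurable_fun setT (EFin \o g).
  by apply/measurable_EFinP; have [[]] := (L2P mu _).1 Lg.
have gE0 x : setT x -> (0 <= (EFin \o g) x)%E by rewrite lee_fin.
pose s n : {nnsfun T >-> R} := nnsfun_approx measurableT mg n.
have sg x : s n x @[n --> \oo] --> g x.
  have := @cvg_nnsfun_approx _ _ _ _ measurableT _ mg gE0 x I.
  by move=> /fine_cvg.
have s_le n x : s n x <= g x.
  have nd : nondecreasing_seq (fun n => s n x).
    by move=> i j ij; have /lefP/(_ x) := @nd_nnsfun_approx _ _ _ _ measurableT _ mg i j ij.
  have cs : cvgn (fun n => s n x) by apply/cvg_ex; exists (g x); exact: sg.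
  by have := nondecreasing_cvgn_le nd cs n; rewrite (cvg_lim _ (sg x)).
have s_ge n x : 0 <= s n x by [].
apply: (@total_lim (fun n x => (s n x)%:C) _ (fun x => nsq (g x)%:C)) => //.
- move=> n; pose r : seq R := finmap.enum_fset (fset_set (range (s n))).
  have := @total_sum 'I_(size r) (index_enum _) (fun i => (r`_i)%:C)
    (fun i x => (\1_(s n @^-1` [set r`_i]) x : R)%:C).
  have mr i : measurable (s n @^-1` [set r`_i]).
    by rewrite -[X in measurable X]setTI; exact: measurable_funP.
  move=> /(_ (fun i => total_indic (mr i))).
  congr C; apply/funext => x.
  rewrite [in RHS]fimfunEord -/r rmorph_sum /=; apply: eq_bigr => i _.
  by rewrite rmorphM.
- exact: L2_nsq.
- move=> n x; rewrite -rmorphB !nsqC lerXn2r ?nnegrE ?subr_ge0//.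
  by rewrite lerBlDr lerDl.
- move=> x; rewrite (_ : (fun n => _) = (fun n => `|g x - s n x|)); last first.
    by apply/funext => n; rewrite -rmorphB /cnorm nsqC sqrtr_sqr.
  apply/norm_cvg0P; rewrite -[X in _ --> X](subrr (g x)).
  by apply: cvgB; [exact: cvg_cst|exact: sg].
Qed.

Lemma total_real (g : T -> R) : L2 mu (fun x => (g x)%:C) ->
  C (fun x => (g x)%:C).
Proof.
move=> Lg; have [[mg _] ig] := (L2P mu _).1 Lg.
have part (q : T -> R) : measurable_fun setT q -> (forall x, 0 <= q x <= `|g x|) ->
    C (fun x => (q x)%:C).
  move=> mq qg; apply: total_nneg; first by move=> x; have /andP[] := qg x.
  apply: (@L2_le _ _ _ _ _ (fun x => nsq (g x)%:C)) => //.
    by split=> //; exact: measurable_cst.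
  move=> x; rewrite !nsqC -[g x ^+ 2]real_normK ?num_real//.
  by have /andP[q0 q1] := qg x; rewrite lerXn2r ?nnegrE.
have hp := part (fun x => Num.max (g x) 0).
have hn := part (fun x => Num.max (- g x) 0).
have mp : measurable_fun setT (fun x => Num.max (g x) 0).
  by apply: measurable_maxr => //; exact: measurable_cst.
have mn : measurable_fun setT (fun x => Num.max (- g x) 0).
  by apply: measurable_maxr; [exact: measurable_funN|exact: measurable_cst].
have bp x : 0 <= Num.max (g x) 0 <= `|g x|.
  by rewrite le_max lexx orbT /= ge_max ler_norm normr_ge0.
have bn x : 0 <= Num.max (- g x) 0 <= `|g x|.
  by rewrite le_max lexx orbT /= ge_max normr_ge0 -normrN ler_norm.
have := Clin (-1) (hn mn bn) (hp mp bp).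
congr C; apply/funext => x; rewrite mulN1r -rmorphN -rmorphD; congr (_ %:C).
have [h|h] := leP 0 (g x).
  by rewrite [Num.max (- g x) 0]max_r ?oppr_le0// oppr0 add0r.
by rewrite [Num.max (- g x) 0]max_l ?oppr_ge0 ?ltW// opprK addr0.
Qed.

(** Successively: indicators of measurable sets by Dynkin's theorem, nonnegative
    functions by simple approximations, real and then complex functions. *)
Lemma total_L2 (f : T -> R[i]) : L2 mu f -> C f.
Proof.
move=> Lf; have [[m1 m2] i] := (L2P mu _).1 Lf.
have h1 : C (fun x => (Re (f x))%:C).
  apply: total_real; apply: (@L2_le _ _ _ _ _ (nsq \o f)) => //.
    by split=> //; exact: measurable_cst.
  by move=> x; rewrite nsqC; exact: Re2_le_nsq.
have h2 : C (fun x => (Im (f x))%:C).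
  apply: total_real; apply: (@L2_le _ _ _ _ _ (nsq \o f)) => //.
    by split=> //; exact: measurable_cst.
  by move=> x; rewrite nsqC; exact: Im2_le_nsq.
have := Clin 'i h2 h1; congr C; apply/funext => x.
by rewrite addrC -complexE.
Qed.

End Totality.

(** * Density of the domain of the generator *)

Section Density.
Context {R : realType} {X : ptopologicalType}.
Variables (F : R -> X -> X) (muX : probability (borel X) R).
Hypotheses (cX : compact [set: X]) (scX : second_countable (T := X)) (hX : hausdorff_space X).
Hypotheses (F0 : forall x, F 0 x = x) (FD : forall s t x, F (s + t) x = F s (F t x))
           (Fc : continuous (fun p : R * X => F p.1 p.2))
           (Fm : forall t, measurable_fun setT (F t : borel X -> borel X))
           (Fp : forall t, preserves_measure (F t : borel X -> borel X) muX).

Definition Hclosure (f : borel X -> R[i]) := L2 muX f /\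
  forall e : R, 0 < e -> exists u h, H_graph F muX u h /\
    L2norm muX (fun x => f x - u x) < e.

Lemma Hclosure_lin (c : R[i]) f g : Hclosure f -> Hclosure g ->
  Hclosure (fun x => c * f x + g x).
Proof.
move=> [Lf hf] [Lg hg]; split; first by apply: L2D => //; exact: L2Z.
move=> e e0; have c1 : 0 < cnorm c + 1 by rewrite ltr_wpDl ?cnorm_ge0.
have [u [h [uh fu]]] := hf _ (divr_gt0 e0 (mulr_gt0 (ltr0n _ 2) c1)).
have [u' [h' [uh' gu]]] := hg _ (divr_gt0 e0 (ltr0n _ 2)).
exists (fun x => c * u x + u' x), (fun x => c * h x + h' x); split.
  exact: H_graph_lin.
have [Lu _ _] := uh; have [Lu' _ _] := uh'.
have Lfu := L2B Lf Lu; have Lgu := L2B Lg Lu'.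
rewrite (_ : (fun x => _) = (fun x => c * (f x - u x) + (g x - u' x))); last first.
  by apply/funext => x; ring.
rewrite (le_lt_trans (L2normD (L2Z c Lfu) Lgu))// L2normZ//.
rewrite (splitr e) ler_ltD//.
rewrite (@le_trans _ _ ((cnorm c + 1) * (e / (2 * (cnorm c + 1)))))//.
  apply: ler_pM; rewrite ?cnorm_ge0 ?L2norm_ge0 ?lerDl//; exact: ltW.
by rewrite le_eqVlt; apply/orP; left; apply/eqP; field; rewrite gt_eqF.
Qed.

Lemma Hclosure0 : Hclosure (fun=> 0).
Proof.
split; first exact: L20.
move=> e e0; exists (fun=> 0), (fun=> 0); split; first exact: H_graph0.
rewrite L2norm0//; last by apply/aeW => x _; rewrite subr0.
by apply: L2B; exact: L20.
Qed.

Lemma Hclosure_closed f : L2 muX f -> (forall e : R, 0 < e ->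
  exists2 g, Hclosure g & L2norm muX (fun x => f x - g x) < e) -> Hclosure f.
Proof.
move=> Lf hf; split=> // e e0.
have e2 : 0 < e / 2 by rewrite divr_gt0.
have [g [Lg /(_ _ e2)[u [w [uw gu]]]] fg] := hf _ e2.
exists u, w; split=> //; have [Lu _ _] := uw.
rewrite (_ : (fun x => _) = (fun x => (f x - g x) + (g x - u x))).
  rewrite (le_lt_trans (L2normD (L2B Lf Lg) (L2B Lg Lu)))//.
  by rewrite (splitr e) ltrD.
by apply/funext => x; ring.
Qed.

Let HL2 f : Hclosure f -> L2 muX f. Proof. by case. Qed.

Lemma Hclosure_continuous (v : X -> R) : continuous v -> (forall x, 0 <= v x <= 1) ->
  Hclosure (fun x => (v x)%:C).
Proof.
move=> vc v01.
have en0 n : 0 < n.+1%:R^-1 :> R by rewrite invr_gt0.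
have en1 n : n.+1%:R^-1 <= 1 :> R by rewrite invf_le1 ?ler1n.
apply: (@total_lim01 _ _ _ muX Hclosure HL2 Hclosure_closed (fun n => flow_avg F v n.+1%:R^-1)) => //.
- move=> n; have [h hh] := flow_avg_H_graph F0 FD Fc Fm Fp vc v01 (en0 n) (en1 n).
  have [Lu _ _] := hh; split=> // e e0; eexists; exists h; split; first exact: hh.
  rewrite L2norm0//; last by apply/aeW => x _; rewrite subrr.
  exact: L2B.
- exact: continuous_measurable_real.
- by move=> n x; exact: flow_avg_range.
- by move=> x; exact: flow_avg_cvg.
Qed.

(** Indicators of open sets are pointwise limits of continuous functions built
    from Urysohn functions of the closed basic sets that the open set contains. *)
Lemma open_indicator_limit (O : set X) : open O ->
  exists w : (X -> R) ^nat, [/\ forall n, continuous (w n),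
    forall n x, 0 <= w n x <= 1 & forall x, w n x @[n --> \oo] --> (\1_O x : R)].
Proof.
move=> oO; have [B cB [Bo Bb]] := scX.
have /countable_injP[idx inj] := cB.
pose good U := B U /\ closure U `<=` O.
pose b n : set X := xget set0 [set U | good U /\ idx U = n].
have bP n : b n = set0 \/ good (b n).
  by rewrite /b; case: xgetP => [U _ [gU _]|]; [right|left].
have clb n : closure (b n) `<=` O.
  by have [->|[]] := bP n => //; rewrite closure0.
have nX : normal_space X by exact: compact_normal.
have sep n : uniform_separator (~` O) (closure (b n)).
  have [sepT _] := @normal_separatorP R X; apply: (sepT nX).
  - exact: open_closedC.
  - exact: closed_closure.
  - by apply/seteqP; split=> // x [nO cx]; apply: nO; exact: clb cx.
pose h n : X -> R := Urysohn (~` O) (closure (b n)).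
have hc n : continuous (h n) by exact: Urysohn_continuous.
have h01 n x : 0 <= h n x <= 1.
  have := @Urysohn_range X R (~` O) (closure (b n)) (h n x).
  by rewrite /= in_itv; apply; exists x.
have h0 n x : ~ O x -> h n x = 0.
  by move=> nO; apply: (Urysohn_sub0 (sep n)); exists x.
have h1 n x : closure (b n) x -> h n x = 1.
  by move=> cx; apply: (Urysohn_sub1 (sep n)); exists x.
have cover x : O x -> exists n, closure (b n) x.
  move=> Ox; have rX := @compact_regular X x setT hX cX (filterT).
  have [U nU UO] : filter_from (nbhs x) closure O.
    by apply: rX; apply: open_nbhs_nbhs; split.
  have [V [BV Vx] VU] := Bb x _ nU.
  have gV : good V by split=> //; exact: subset_trans (closureS VU) UO.
  exists (idx V); suff -> : b (idx V) = V by exact: subset_closure.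
  rewrite /b; case: xgetP => [W _ [[BW _] E]|]; last by move=> /(_ V); case.
  by apply: inj => //; rewrite inE.
pose p n x := \prod_(i < n) (1 - h i x).
have p01 n x : 0 <= p n x <= 1.
  rewrite /p; elim/big_ind : _ => [|y z /andP[y0 y1] /andP[z0 z1]|i _].
  - by rewrite ler01 lexx.
  - by rewrite mulr_ge0//= mulr_ile1.
  - by have /andP[i0 i1] := h01 i x; rewrite subr_ge0 i1 lerBlDr lerDl.
exists (fun n x => 1 - p n x); split.
- move=> n x; apply: cvgB; first exact: cvg_cst.
  rewrite /p; elim: n => [|n IH].
    rewrite (_ : (fun x => _) = (fun=> 1)); first by rewrite big_ord0; exact: cvg_cst.
    by apply/funext => y; rewrite big_ord0.
  rewrite (_ : (fun x => _) = (fun x => (\prod_(i < n) (1 - h i x)) * (1 - h n x))).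
    by rewrite big_ord_recr /=; apply: cvgM => //; apply: cvgB; [exact: cvg_cst|exact: hc].
  by apply/funext => y; rewrite big_ord_recr.
- move=> n x; have /andP[p0 p1] := p01 n x.
  by rewrite subr_ge0 p1 lerBlDr lerDl.
- move=> x; rewrite indicE; have [Ox|nO] := pselect (O x).
    rewrite mem_set//; have [k ck] := cover x Ox.
    apply: cvg_near_cst; exists k.+1 => // n /= kn.
    by rewrite /p (bigD1 (Ordinal kn))//= h1// subrr mul0r subr0.
  rewrite memNset//; apply: cvg_near_cst; apply: nearW => n.
  by rewrite /p big1 ?subrr// => i _; rewrite h0// subr0.
Qed.

(** The averages along the flow of a continuous function are in the domain and
    converge to it; the indicator of an open set is a limit of continuous
    functions, and the open sets generate the Borel sets. *)
Lemma generator_dense (f : borel X -> R[i]) : L2 muX f -> Hclosure f.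
Proof.
apply: (@total_L2 _ _ _ muX Hclosure (@open X)).
- by move=> g [].
- exact: Hclosure0.
- by move=> c g h; exact: Hclosure_lin.
- by move=> g; exact: Hclosure_closed.
- exact: openT.
- by move=> U V; exact: openI.
- by move=> U; exact: open_borel_measurable.
- by [].
move=> O oO; have [w [wc w01 wO]] := open_indicator_limit oO.
apply: (@total_lim01 _ _ _ muX Hclosure HL2 Hclosure_closed w) => //.
- by move=> n; exact: Hclosure_continuous.
- exact: (@measurable_indic _ (borel X) R setT O (open_borel_measurable oO)).
- by move=> x; exact: indic01.
Qed.

End Density.

(** * Orthogonality of the matrix coefficients *)

Section GramMatrix.
Context {R : realType}.
Variables (mu : probability (borel (U2 R)) R) (l : nat) (m : int) (j : 'I_l.+1).
Hypothesis haar : is_haar mu.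

Local Notation G := (borel (U2 R)).

Definition coefficient (k : 'I_l.+1) (g : G) : R[i] := rho l m g j k.

Lemma bm_rho i k : bm (fun g : G => rho l m g i k).
Proof. by apply: (calg_rho bm_conj_algebra) => a b; exact: bm_U2_entry. Qed.

Lemma L2_coefficient k : L2 mu (coefficient k).
Proof. exact/bm_L2/bm_rho. Qed.

Lemma measurable_right_shift (h : U2 R) : measurable_fun setT (fun g : G => (g * h)%g : G).
Proof.
apply: measurable_U2 => a b; apply: (proj1 (_ : bm _)).
apply: (calg_mulmx bm_conj_algebra) => c d; first exact: bm_U2_entry.
exact: (calg_cst bm_conj_algebra).
Qed.

Definition gram i k : R[i] := L2inner mu (coefficient i) (coefficient k).

(** Invariance of the Haar measure under right translation by [h]. *)
Lemma gram_shift (h : U2 R) i k : gram i k =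
  \sum_a \sum_b rho l m h a i * conjc (rho l m h b k) * gram a b.
Proof.
have E n : coefficient n \o (fun g : G => (g * h)%g : G) =
    fun g => \sum_a rho l m h a n * coefficient a g.
  apply/funext => g; rewrite /coefficient /= rhoM mxE.
  by apply: eq_bigr => a _; rewrite mulrC.
have LZ n a : L2 mu (fun g => rho l m h a n * coefficient a g).
  by apply: L2Z; exact: L2_coefficient.
rewrite /gram -(L2inner_preserves (measurable_right_shift h) (haar h).2);
  [|exact: L2_coefficient|exact: L2_coefficient].
rewrite !E L2inner_suml; [|exact: LZ|exact: L2_sum].
apply: eq_bigr => a _; rewrite L2inner_sumr; [|exact: LZ|exact: LZ].
apply: eq_bigr => b _; have La := L2_coefficient a; have Lb := L2_coefficient b.
by rewrite (L2innerZl _ La (LZ k b)) (L2innerZr _ Lb La) mulrA.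
Qed.

Lemma U2_diag_unitary (z : R[i]) : z * conjc z = 1 ->
  (diag_mx (\row_(i < 2) (if i == 0 then z else 1))) \is unitarymx.
Proof.
move=> z1; apply/unitarymxP; apply/matrixP => a b.
rewrite mul_diag_mx !mxE; have [->|_] := eqVneq a b; last first.
  by rewrite mulr0n raddf0 mulr0.
rewrite !mulr1n; case: (b == 0); first exact: z1.
by rewrite conjC1 mulr1.
Qed.

(** The torus acts on the columns by distinct characters: for [i < k] and [z] such
    that [z^(k-i) = -1], translation by the diagonal matrix [(z, 1)] multiplies
    the [(i, k)] entry of the Gram matrix by [-1]. *)
Lemma gram_offdiag i k : i != k -> gram i k = 0.
Proof.
wlog ik : i k / (i < k)%N => [H|_].
  rewrite neq_lt => /orP[ik|ki]; first by apply: H; rewrite // lt_eqF.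
  rewrite /gram L2innerC; [|exact: L2_coefficient|exact: L2_coefficient].
  by rewrite [L2inner _ _ _](H k i)// ?raddf0// lt_eqF.
have n0 : (0 < k - i)%N by rewrite subn_gt0.
pose z : R[i] := (k - i)%N.-root (-1).
have zn : z ^+ (k - i) = -1 by rewrite /z rootCK.
have zz : z * conjc z = 1.
  have : `|z| ^+ (k - i) = 1 by rewrite -normrX zn normrN1.
  move=> /eqP; rewrite pexpr_eq1 ?normr_ge0// => /eqP z1.
  have {}z1 : cnorm z = 1 by have := cnormE z; rewrite z1 => /(congr1 Re).
  by rewrite -nsqE -cnorm_sqr z1 expr1n.
pose h := MkU2 (U2_diag_unitary zz).
have hE a n : rho l m h a n = \det (U2mx h) ^ (m - l%:Z) * z ^+ n * (a == n)%:R.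
  rewrite /rho /= cmx_diag !mxE expr1n mulr1 -mulrA; congr (_ * _).
  by rewrite mulr_natr; case: eqVneq => // ->.
have dd : \det (U2mx h) ^ (m - l%:Z) * conjc (\det (U2mx h) ^ (m - l%:Z)) = 1.
  by rewrite (fmorphXz conjc) -expfzMl U2_det_nsq exp1rz.
have := gram_shift h i k; rewrite (bigD1 i)//= [X in _ + X]big1 ?addr0; last first.
  by move=> a ai; apply: big1 => b _; rewrite hE (negPf ai) mulr0 !mul0r.
rewrite (bigD1 k)//= [X in _ + X]big1 ?addr0; last first.
  by move=> b bk; rewrite !hE (negPf bk) mulr0 raddf0 mulr0 mul0r.
rewrite !hE !eqxx !mulr1 conjcM mulrACA dd mul1r.
have -> : z ^+ i * conjc (z ^+ k) = -1.
  rewrite -(subnKC (ltnW ik)) exprD zn mulrN1 conjcN mulrN rmorphXn -exprMn zz.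
  by rewrite expr1n.
move=> /eqP; rewrite mulN1r -addr_eq0 -mulr2n -mulr_natl mulf_eq0 pnatr_eq0 /=.
by move=> /eqP.
Qed.

Definition gram_norm k : R := L2sq mu (coefficient k).

Lemma gramE i k : gram i k = (gram_norm k)%:C * (i == k)%:R.
Proof.
have [->|ik] := eqVneq i k; first by rewrite mulr1 /gram L2inner_diag.
by rewrite mulr0 gram_offdiag.
Qed.

(** A Pythagorean triple gives a rotation without zero entries. *)
Lemma U2_rotation_unitary :
  (\matrix_(a < 2, b < 2) (if a == b then (3 / 5)%:C
     else if a == 0 then (4 / 5)%:C else (- (4 / 5))%:C : R[i])) \is unitarymx.
Proof.
apply/unitarymxP; apply/matrixP => a b; rewrite mulmx2E !mxE.
have five : (5 : R) != 0 by rewrite pnatr_eq0.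
by case: a => -[|[|//]] ?; case: b => -[|[|//]] ?;
  apply: complex_eqP; rewrite !cplxE /=; field.
Qed.

(** A rotation with nonzero entries mixes all the columns, so that if one of the
    coefficients vanished almost everywhere, they all would. *)
Lemma gram_norm_gt0 k : 0 < gram_norm k.
Proof.
have nn n : 0 <= gram_norm n by exact: L2sq_ge0.
pose h := MkU2 U2_rotation_unitary.
have h0 a b : U2mx h a b != 0.
  rewrite mxE; case: (a == b); [|case: (a == 0)];
    by apply/eqP => /(congr1 Re) /= /eqP; rewrite ?oppr_eq0 mulf_eq0 invr_eq0 !pnatr_eq0.
have step i n : gram_norm n = 0 -> rho l m h i n != 0 -> gram_norm i = 0.
  move=> n0 hin; have := gram_shift h n n; rewrite gramE n0 mul0r.
  under eq_bigr => a _.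
    rewrite (bigD1 a)//= [X in _ + X]big1 ?addr0; last first.
      by move=> b ba; rewrite gramE eq_sym (negPf ba) !mulr0.
    rewrite gramE eqxx mulr1 -nsqE -rmorphM.
    over.
  rewrite -rmorph_sum => /(congr1 Re) /= /esym /eqP.
  rewrite psumr_eq0; last by move=> a _; rewrite mulr_ge0 ?nsq_ge0.
  move=> /allP /(_ i (mem_index_enum _)) /=.
  by rewrite mulf_eq0 nsq_eq0 (negPf hin) => /eqP.
rewrite lt_neqAle nn andbT; apply/eqP => /esym k0.
have d0 : \det (U2mx h) ^ (m - l%:Z) != 0 by rewrite expfz_neq0 ?U2_det_neq0.
have c0 : gram_norm ord0 = 0.
  apply: (step _ k k0); rewrite !mxE mulf_neq0//.
  rewrite -horner_coef0 hornerM !horner_exp !hornerD !hornerZ hornerX !mulr0 !add0r !hornerC.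
  by rewrite mulf_neq0 ?expf_neq0.
have call n : gram_norm n = 0.
  apply: (step _ ord0 c0); rewrite !mxE mulf_neq0//.
  rewrite /actpoly expr0 mul1r subn0 /colpoly addrC exprDn coef_sum.
  rewrite (bigD1 n)//= [X in _ + X]big1 ?addr0; last first.
    move=> i ni; rewrite coefMn -polyC_exp coefCM exprZn coefZ coefXn.
    by rewrite -val_eqE eq_sym in ni; rewrite (negPf ni) !mulr0 mul0rn.
  rewrite coefMn -polyC_exp coefCM exprZn coefZ coefXn eqxx mulr1.
  rewrite mulrn_eq0 negb_or -lt0n bin_gt0 -ltnS ltn_ord.
  exact: mulf_neq0 (expf_neq0 _ (h0 1 1)) (expf_neq0 _ (h0 0 1)).
have aez : \forall g \ae mu, forall n, coefficient n g = 0.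
  apply: filter_forall => n; have := L2sq_ae0 (L2_coefficient n) (call n).
  by apply: filterS => g; apply.
have : \forall g \ae mu, False.
  apply: filterS aez => g cz.
  have := rhoV l m (g : U2 R) => /matrixP/(_ j j); rewrite !mxE eqxx big1.
    by move=> /eqP; rewrite eq_sym oner_eq0.
  by move=> n _; rewrite [rho _ _ _ _ _]cz mul0r.
move=> /negligibleP; rewrite (_ : ~` _ = setT); last first.
  by apply/seteqP; split=> // g _ [].
move=> /(_ measurableT) mu0; have : (mu setT = 1)%E by exact: probability_setT.
by rewrite [LHS]mu0 => /eqP; rewrite eq_sym onee_eq0.
Qed.

End GramMatrix.

(** * Quadratic forms on a dense subspace *)

Section QuadraticForms.
Context {R : realType} {d : measure_display} {T : measurableType d}.
Variables (mu : {measure set T -> \bar R}) (K D : set (T -> R[i])).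
Hypotheses (KL2 : forall f, K f -> L2 mu f) (DK : forall f, D f -> K f)
  (Klin : forall c f g, K f -> K g -> K (fun x => c * f x + g x))
  (Dlin : forall c f g, D f -> D g -> D (fun x => c * f x + g x))
  (Ddense : forall f, K f -> forall e : R, 0 < e ->
     exists2 g, D g & L2norm mu (fun x => f x - g x) < e).

Let KB f g : K f -> K g -> K (fun x => f x - g x).
Proof.
move=> Kf Kg; have := Klin (-1) Kg Kf; congr K.
by apply/funext => x; rewrite mulN1r addrC.
Qed.

Lemma form_expand (E : (T -> R[i]) -> T -> R[i]) (c : R[i]) f g : bounded_op mu K E ->
  K f -> K g ->
  L2inner mu (fun x => c * f x + g x) (E (fun x => c * f x + g x)) =
  c * conjc c * L2inner mu f (E f) + c * L2inner mu f (E g)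
  + conjc c * L2inner mu g (E f) + L2inner mu g (E g).
Proof.
move=> [EK Elin _] Kf Kg; have Kc := Klin c Kf Kg.
have Lf := KL2 Kf; have Lg := KL2 Kg; have LEf := KL2 (EK _ Kf); have LEg := KL2 (EK _ Kg).
have LcE : L2 mu (fun x => c * E f x + E g x) by apply: L2D => //; exact: L2Z.
rewrite (L2inner_ae (KL2 Kc) (KL2 Kc) (KL2 (EK _ Kc)) LcE (ae_eq_refl _ _ _) (Elin c f g Kf Kg)).
rewrite (L2innerDl (L2Z c Lf) Lg LcE) (L2innerZl c Lf LcE).
rewrite (L2innerDr (L2Z c LEf) LEg Lf) (L2innerDr (L2Z c LEf) LEg Lg).
rewrite (L2innerZr c LEf Lf) (L2innerZr c LEf Lg); ring.
Qed.

(** By polarisation, a bounded operator is determined by its quadratic form on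
    a dense subspace. *)
Lemma bounded_op_form_ext (E1 E2 : (T -> R[i]) -> T -> R[i]) :
  bounded_op mu K E1 -> bounded_op mu K E2 ->
  (forall f, D f -> L2inner mu f (E1 f) = L2inner mu f (E2 f)) ->
  forall f, K f -> ae_eq mu setT (E1 f) (E2 f).
Proof.
move=> b1 b2 E12; have [EK1 Elin1 [M1 EM1]] := b1; have [EK2 Elin2 [M2 EM2]] := b2.
have polar f g : D f -> D g -> L2inner mu f (E1 g) = L2inner mu f (E2 g).
  move=> Df Dg; have Kf := DK Df; have Kg := DK Dg.
  have eq c : c * (L2inner mu f (E1 g) - L2inner mu f (E2 g)) +
      conjc c * (L2inner mu g (E1 f) - L2inner mu g (E2 f)) = 0.
    have := E12 _ (Dlin c Df Dg); rewrite !form_expand// (E12 f)// (E12 g)// => /eqP.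
    by rewrite -subr_eq0 => /eqP h; rewrite -[RHS]h; ring.
  (* the values [1] and ['i] of the scalar separate the two cross terms *)
  have := eq 1; have := eq 'i; set a := _ - _; set b := _ - _.
  have -> : conjc 1 = 1 :> R[i] by apply: complex_eqP; rewrite /= ?oppr0.
  have -> : conjc 'i = - 'i :> R[i] by apply: complex_eqP; rewrite /= ?oppr0.
  rewrite !mul1r mulNr -mulrBr => /eqP.
  rewrite mulf_eq0 (negPf (neq0Ci _)) /= subr_eq0 => /eqP <- /eqP.
  by rewrite -mulr2n mulrn_eq0 /= subr_eq0 => /eqP.
have onD g : D g -> L2norm mu (fun x => E1 g x - E2 g x) = 0.
  move=> Dg; have Kg := DK Dg; have Kh := KB (EK1 _ Kg) (EK2 _ Kg).
  set h := fun x => _ in Kh *; have Lh := KL2 Kh.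
  have bound e : 0 < e -> L2norm mu h <= e.
    move=> e0; have [f Df hf] := Ddense Kh e0; have Lf := KL2 (DK Df).
    have ortho : L2inner mu f h = 0.
      by rewrite L2innerBr ?polar ?subrr//; apply: KL2; [exact: EK1|exact: EK2].
    have : L2inner mu (fun x => h x - f x) h = (L2sq mu h)%:C.
      by rewrite L2innerBl// ortho subr0 L2inner_diag.
    move=> /(congr1 cnorm); rewrite /cnorm nsqC sqrtr_sqr ger0_norm ?L2sq_ge0// -L2norm_sqr => E.
    have := cauchy_schwarz (L2B Lh Lf) Lh; rewrite /cnorm E expr2.
    have [->|h0] := eqVneq (L2norm mu h) 0; first by move=> _; exact: ltW.
    rewrite ler_pM2r ?lt_neqAle ?L2norm_ge0 1?eq_sym ?h0// => /le_trans; apply; exact: ltW.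
  apply/eqP; rewrite eq_le L2norm_ge0 andbT; apply/ler_addgt0Pr => e e0.
  by rewrite add0r; exact: bound.
move=> f Kf; have Kh := KB (EK1 _ Kf) (EK2 _ Kf).
have LE1 g : K g -> L2 mu (E1 g) by move=> Kg; exact/KL2/EK1.
have LE2 g : K g -> L2 mu (E2 g) by move=> Kg; exact/KL2/EK2.
suff h0 : L2norm mu (fun x => E1 f x - E2 f x) = 0.
  have := L2norm_ae0 (KL2 Kh) h0; apply: filterS => x /(_ I) h _.
  by apply/eqP; rewrite -subr_eq0; apply/eqP.
apply/eqP; rewrite eq_le L2norm_ge0 andbT; apply/ler_addgt0Pr => e e0; rewrite add0r.
pose M := `|M1| + `|M2| + 1; have M0 : 0 < M by rewrite ltr_wpDl// addr_ge0.
have [g Dg fg] := Ddense Kf (divr_gt0 e0 M0); have Kg := DK Dg; have Kfg := KB Kf Kg.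
have Lfg := KL2 Kfg.
have split1 E : bounded_op mu K E -> ae_eq mu setT (E f) (fun x => E (fun x => f x - g x) x + E g x).
  move=> [_ El _]; have := El 1 (fun x => f x - g x) g Kfg Kg.
  rewrite (_ : (fun x => 1 * (f x - g x) + g x) = f); last by apply/funext => x; ring.
  by apply: filterS => x /(_ I) -> _; rewrite mul1r.
have E : ae_eq mu setT (fun x => E1 f x - E2 f x) (fun x =>
    (E1 (fun x => f x - g x) x - E2 (fun x => f x - g x) x) + (E1 g x - E2 g x)).
  have := split1 _ b1; have := split1 _ b2; apply: filterS2 => x /(_ I) -> /(_ I) -> _; ring.
have La := L2B (LE1 _ Kfg) (LE2 _ Kfg); have Lb := L2B (LE1 _ Kg) (LE2 _ Kg).
rewrite (L2norm_ae (KL2 Kh) (L2D La Lb) E).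
apply: le_trans (L2normD La Lb) _; rewrite (onD g Dg) addr0.
apply: le_trans (L2normB (LE1 _ Kfg) (LE2 _ Kfg)) _.
apply: le_trans (lerD (EM1 _ Kfg) (EM2 _ Kfg)) _; rewrite -mulrDl.
apply: (@le_trans _ _ (M * L2norm mu (fun x => f x - g x))).
  rewrite ler_wpM2r ?L2norm_ge0// /M; have := ler_norm M1; have := ler_norm M2; lra.
by rewrite -ler_pdivlMl// mulrC ltW.
Qed.

End QuadraticForms.

(** * The isotypic components in coordinates *)

Section ProductSpace.
Context {R : realType} {X : ptopologicalType}.
Variables (muX : probability (borel X) R) (mu : probability (borel (U2 R)) R).

Local Notation XU := (borel X * borel (U2 R))%type.
Local Notation P := ((muX \x mu)%E : probability XU R).

Lemma integrable_fst (f : borel X -> R) : muX.-integrable setT (EFin \o f) ->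
  P.-integrable setT (EFin \o (fun p : XU => f p.1)).
Proof.
move=> /integrableP[mf iff].
have mf1 : measurable_fun setT (fun p : XU => (f p.1)%:E).
  exact: measurableT_comp mf measurable_fst.
apply/integrableP; split=> //.
rewrite (@fubini_tonelli1 _ _ _ _ _ muX mu); last by move=> p; exact: abse_ge0.
  rewrite (_ : fubini_F _ _ = fun x => `|(f x)%:E|%E)//.
  apply/funext => x; rewrite /fubini_F /= integral_cst//.
  by rewrite [X in (_ * X)%E]probability_setT mule1.
exact: measurableT_comp.
Qed.

Lemma integrable_tensor (K : R) (f : borel X -> R) (q : borel (U2 R) -> R) :
  muX.-integrable setT (EFin \o f) -> measurable_fun setT q -> (forall g, `|q g| <= K) ->
  P.-integrable setT (EFin \o (fun p : XU => f p.1 * q p.2)).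
Proof.
move=> intf mq qK; have /measurable_EFinP mf := measurable_int muX intf.
apply: (@le_integrable _ _ _ P _ measurableT _ (EFin \o (fun p : XU => K * `|f p.1|))).
- apply/measurable_EFinP; apply: measurable_funM; first exact: measurableT_comp mf measurable_fst.
  exact: measurableT_comp mq measurable_snd.
- move=> p _ /=; rewrite lee_fin normrM mulrC [leRHS]ger0_norm.
    by apply: ler_wpM2r.
  by rewrite mulr_ge0// (le_trans _ (qK p.2)).
- have := integrableZl measurableT K (integrable_abse (integrable_fst intf)).
  by apply: eq_integrable.
Qed.

Lemma Rintegral_tensor (K : R) (f : borel X -> R) (q : borel (U2 R) -> R) :
  muX.-integrable setT (EFin \o f) -> measurable_fun setT q -> (forall g, `|q g| <= K) ->
  Rintegral P setT (fun p : XU => f p.1 * q p.2) =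
  Rintegral muX setT f * Rintegral mu setT q.
Proof.
move=> intf mq qK; have intq := bounded_integrable mu mq qK.
have iq := integrable_fin_num measurableT intq.
have ix := integrable_fin_num measurableT intf.
rewrite /Rintegral -(@integral12_prod_meas1 _ _ _ _ _ muX mu); last exact: integrable_tensor intf mq qK.
rewrite -fineM//; congr fine.
rewrite -[in RHS](fineK iq) -integralZr//; apply: eq_integral => x _.
by rewrite (fineK iq) /fubini_F /= -integralZl.
Qed.

Lemma bmP {d} {T : measurableType d} (q : T -> R[i]) : bm q -> exists K : R,
  [/\ measurable_fun setT (Re \o q), measurable_fun setT (Im \o q),
   forall g, `|(Re \o q) g| <= K & forall g, `|(Im \o q) g| <= K].
Proof.
move=> [[m1 m2] [K qK]]; exists K; split=> // g.
  exact: le_trans (Re_le_cnorm _) (qK g).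
exact: le_trans (Im_le_cnorm _) (qK g).
Qed.

Lemma cintegral_tensor (f : borel X -> R[i]) (q : borel (U2 R) -> R[i]) :
  cintegrable muX f -> bm q ->
  cintegral P (fun p : XU => f p.1 * q p.2) = cintegral muX f * cintegral mu q.
Proof.
move=> [i1 i2] /bmP[K [m1 m2 k1 k2]]; rewrite /cintegral.
rewrite (_ : _ \o _ = fun p : XU => (Re \o f) p.1 * (Re \o q) p.2 - (Im \o f) p.1 * (Im \o q) p.2);
  last by apply/funext => p; rewrite /= ReM.
rewrite (_ : Im \o _ = fun p : XU => (Re \o f) p.1 * (Im \o q) p.2 + (Im \o f) p.1 * (Re \o q) p.2);
  last by apply/funext => p; rewrite /= ImM.
rewrite RintegralB//; [|exact: integrable_tensor i1 m1 k1|exact: integrable_tensor i2 m2 k2].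
rewrite RintegralD//; [|exact: integrable_tensor i1 m2 k2|exact: integrable_tensor i2 m1 k1].
rewrite (Rintegral_tensor i1 m1 k1) (Rintegral_tensor i2 m2 k2).
rewrite (Rintegral_tensor i1 m2 k2) (Rintegral_tensor i2 m1 k1).
by apply: complex_eqP; rewrite !cplxE /=; ring.
Qed.

Lemma L2_tensor (u : borel X -> R[i]) (q : borel (U2 R) -> R[i]) : L2 muX u -> bm q ->
  L2 P (fun p : XU => u p.1 * q p.2).
Proof.
move=> Lu bq; have [cu iu] := (L2P muX u).1 Lu.
apply: (@L2_ext _ _ _ _ (fun p : XU => q p.2 * u p.1)); first by move=> p; rewrite mulrC.
apply: bm_L2M; first exact: bm_snd.
apply/L2P; split; first exact: cmeas_comp measurable_fst cu.
exact: integrable_fst iu.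
Qed.

Lemma L2inner_tensor (u w : borel X -> R[i]) (q r : borel (U2 R) -> R[i]) :
  L2 muX u -> L2 muX w -> bm q -> bm r ->
  L2inner P (fun p : XU => u p.1 * q p.2) (fun p : XU => w p.1 * r p.2) =
  L2inner muX u w * L2inner mu q r.
Proof.
move=> Lu Lw bq br; rewrite /L2inner -cintegral_tensor; last 2 first.
- exact: L2_prod.
- apply: (calgM bm_conj_algebra) => //; exact: (calgJ bm_conj_algebra).
by apply: eq_cintegral => p; rewrite conjcM mulrACA.
Qed.

End ProductSpace.

Section Isotypic.
Context {R : realType} {X : ptopologicalType}.
Variables (muX : probability (borel X) R) (mu : probability (borel (U2 R)) R).
Variables (l : nat) (m : int) (j : 'I_l.+1).
Hypothesis haar : is_haar mu.

Local Notation XU := (borel X * borel (U2 R))%type.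
Local Notation P := ((muX \x mu)%E : probability XU R).
Local Notation vfun := ('I_l.+1 -> borel X -> R[i]).
Implicit Types (u w : vfun) (f : XU -> R[i]).

Definition L2v u := forall k, L2 muX (u k).

Lemma bm_rep_elt (k : 'I_l.+1) : bm (fun g : borel (U2 R) => U2_rep_elt m j k g).
Proof.
rewrite (_ : (fun g => _) = (fun g => weight j * rho l m g j k)).
  by apply: (calgM bm_conj_algebra); [exact: (calg_cst bm_conj_algebra)|exact: bm_rho].
by apply/funext => g; exact: U2_rep_elt_rho.
Qed.

Definition rep_norm (k : 'I_l.+1) : R := nsq (weight j) * gram_norm mu m j k.

Lemma rep_norm_gt0 k : 0 < rep_norm k.
Proof.
by rewrite mulr_gt0 ?gram_norm_gt0// lt_neqAle nsq_ge0 eq_sym nsq_eq0 weight_neq0.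
Qed.

Lemma L2inner_rep_elt (i k : 'I_l.+1) :
  L2inner mu (fun g => U2_rep_elt m j i g) (fun g => U2_rep_elt m j k g) =
  (rep_norm k)%:C * (i == k)%:R.
Proof.
have E n : (fun g : borel (U2 R) => U2_rep_elt m j n g) =
    (fun g => weight j * coefficient m j n g).
  by apply/funext => g; exact: U2_rep_elt_rho.
have Lc n : L2 mu (coefficient m j n) by exact: L2_coefficient.
rewrite !E (L2innerZl _ (Lc i) (L2Z _ (Lc k))) (L2innerZr _ (Lc k) (Lc i)).
by rewrite mulrA -nsqE -/(gram _ _ _ _ _) gramE// /rep_norm rmorphM -mulrA.
Qed.

Lemma L2_rep_term u k : L2v u -> L2 P (fun p : XU => u k p.1 * U2_rep_elt m j k p.2).
Proof. by move=> Lu; apply: L2_tensor => //; exact: bm_rep_elt. Qed.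

Lemma L2_rep_sum u : L2v u -> L2 P (rep_sum m j u).
Proof. by move=> Lu; apply: L2_sum => k; exact: L2_rep_term. Qed.

Lemma L2inner_rep_sum u w : L2v u -> L2v w ->
  L2inner P (rep_sum m j u) (rep_sum m j w) =
  \sum_k (rep_norm k)%:C * L2inner muX (u k) (w k).
Proof.
move=> Lu Lw; have tu := fun k => L2_rep_term k Lu; have tw := fun k => L2_rep_term k Lw.
rewrite /rep_sum L2inner_suml//; last exact: L2_sum.
apply: eq_bigr => i _; rewrite L2inner_sumr// (bigD1 i)//= big1 ?addr0; last first.
  move=> k ki; rewrite L2inner_tensor//; [|exact: bm_rep_elt..].
  by rewrite L2inner_rep_elt eq_sym (negPf ki) !mulr0.
rewrite L2inner_tensor//; [|exact: bm_rep_elt..].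
by rewrite L2inner_rep_elt eqxx mulr1 mulrC.
Qed.

Lemma L2sq_rep_sum u : L2v u ->
  L2sq P (rep_sum m j u) = \sum_k rep_norm k * L2sq muX (u k).
Proof.
move=> Lu; have := L2inner_rep_sum Lu Lu; rewrite L2inner_diag => /(congr1 Re) /= ->.
by rewrite Re_sum; apply: eq_bigr => k _; rewrite L2inner_diag -rmorphM.
Qed.

Lemma L2norm_coord_le u k : L2v u ->
  L2norm muX (u k) <= (Num.sqrt (rep_norm k))^-1 * L2norm P (rep_sum m j u).
Proof.
move=> Lu; have k0 := rep_norm_gt0 k.
rewrite ler_pdivlMl ?sqrtr_gt0// !L2normE -sqrtrM ?(ltW k0)//.
rewrite ler_wsqrtr// L2sq_rep_sum// (bigD1 k)//= lerDl.
by apply: sumr_ge0 => i _; rewrite mulr_ge0 ?L2sq_ge0// ltW// rep_norm_gt0.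
Qed.

Lemma L2norm_rep_sum_le u : L2v u ->
  L2norm P (rep_sum m j u) <= \sum_k Num.sqrt (rep_norm k) * L2norm muX (u k).
Proof.
move=> Lu; apply: (le_trans (L2norm_sum _ _)) => [k|]; first exact: L2_rep_term.
apply: ler_sum => k _; rewrite le_eqVlt; apply/orP; left; apply/eqP.
rewrite !L2normE -sqrtrM ?(ltW (rep_norm_gt0 k))//; congr Num.sqrt.
have b := bm_rep_elt k; have := L2inner_tensor mu (Lu k) (Lu k) b b.
rewrite L2inner_rep_elt !L2inner_diag eqxx mulr1 -rmorphM => /(congr1 Re) /= ->.
by rewrite mulrC.
Qed.

Lemma rep_sum_ae u w : (forall k, ae_eq muX setT (u k) (w k)) -> L2v u -> L2v w ->
  ae_eq P setT (rep_sum m j u) (rep_sum m j w).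
Proof.
move=> uw Lu Lw; pose v : vfun := fun k x => u k x - w k x.
have Lv : L2v v by move=> k; exact: L2B.
have v0 : L2sq P (rep_sum m j v) = 0.
  rewrite L2sq_rep_sum//; apply: big1 => k _; rewrite -L2norm_sqr L2norm0 ?expr0n ?mulr0//.
  by apply: filterS (uw k) => x /(_ I) ux _; rewrite /v ux// subrr.
have := L2sq_ae0 (L2_rep_sum Lv) v0; apply: filterS => p /(_ I) E _.
apply/eqP; rewrite -subr_eq0 -[X in _ == X]E /rep_sum -sumrB.
by apply/eqP; apply: eq_bigr => k _; rewrite /v mulrBl.
Qed.

(** The squared norm is a combination with positive weights of those of the
    coordinates, so that the coordinates are unique up to null sets. *)
Lemma rep_sum_inj u w : L2v u -> L2v w ->
  ae_eq P setT (rep_sum m j u) (rep_sum m j w) -> forall k, ae_eq muX setT (u k) (w k).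
Proof.
move=> Lu Lw uw k; pose v : vfun := fun k x => u k x - w k x.
have Lv : L2v v by move=> n; exact: L2B.
have v0 : L2norm P (rep_sum m j v) = 0.
  apply: L2norm0; first exact: L2_rep_sum.
  apply: filterS uw => p /(_ I) E _; rewrite /rep_sum /v.
  under eq_bigr do rewrite mulrBl.
  by rewrite sumrB -/(rep_sum m j u p) E subrr.
have vk : L2norm muX (v k) = 0.
  by apply/eqP; rewrite eq_le L2norm_ge0 andbT; have := L2norm_coord_le k Lv; rewrite v0 mulr0.
have := L2norm_ae0 (Lv k) vk; apply: filterS => x /(_ I) /= E _.
by apply/eqP; rewrite -subr_eq0; apply/eqP.
Qed.

Lemma rep_sum_lin (c : R[i]) u w p :
  rep_sum m j (fun k x => c * u k x + w k x) p = c * rep_sum m j u p + rep_sum m j w p.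
Proof.
rewrite /rep_sum mulr_sumr -big_split; apply: eq_bigr => k _ /=.
by rewrite mulrDl mulrA.
Qed.

Lemma L2v_lin (c : R[i]) u w : L2v u -> L2v w -> L2v (fun k x => c * u k x + w k x).
Proof. by move=> Lu Lw k; apply: L2D => //; exact: L2Z. Qed.

Lemma rep_space_sum u : L2v u -> rep_space muX mu m j (rep_sum m j u).
Proof. by move=> Lu; split; [exact: L2_rep_sum|exists u => //; exact: ae_eq_refl]. Qed.

(** A choice of coordinates, determined only almost everywhere. *)
Definition coords f : vfun :=
  xget (fun _ _ => 0) [set u | L2v u /\ ae_eq P setT f (rep_sum m j u)].

Lemma coordsP f : rep_space muX mu m j f ->
  L2v (coords f) /\ ae_eq P setT f (rep_sum m j (coords f)).
Proof.
move=> [_ [u Lu fu]]; rewrite /coords; case: xgetP => [w _ //|/(_ u)].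
by case; split.
Qed.

Lemma rep_space_lin (c : R[i]) f (g : XU -> R[i]) : rep_space muX mu m j f -> rep_space muX mu m j g ->
  rep_space muX mu m j (fun p => c * f p + g p).
Proof.
move=> [Lf [u Lu fu]] [Lg [w Lw gw]]; split; first by apply: L2D => //; exact: L2Z.
exists (fun k x => c * u k x + w k x); first exact: L2v_lin.
move: fu gw; apply: filterS2 => p /(_ I) fu /(_ I) gw _.
by rewrite rep_sum_lin fu gw.
Qed.

Lemma coords_ae f u : L2v u -> ae_eq P setT f (rep_sum m j u) -> L2 P f ->
  forall k, ae_eq muX setT (coords f k) (u k).
Proof.
move=> Lu fu Lf; have rf : rep_space muX mu m j f by split=> //; exists u.
have [Lc fc] := coordsP rf; apply: rep_sum_inj => //.
exact: ae_eq_trans (ae_eq_sym fc) fu.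
Qed.

End Isotypic.

(** * Transfer operators *)

Section MatrixOperators.
Context {R : realType} {X : ptopologicalType}.
Variables (F : R -> X -> X) (muX : probability (borel X) R) (l : nat).
Hypotheses (Fm : forall t, measurable_fun setT (F t : borel X -> borel X))
           (Fp : forall t, preserves_measure (F t : borel X -> borel X) muX).
Local Notation vfun := ('I_l.+1 -> borel X -> R[i]).
Implicit Types (u w : vfun) (A : borel X -> 'M[R[i]]_l.+1).

Definition matop A (t : R) u : vfun := fun i x => \sum_k A x i k * u k (F t x).

Definition bmx A := forall i k, bm (fun x => A x i k).

Lemma L2v_matop A t u : bmx A -> L2v muX u -> L2v muX (matop A t u).
Proof.
move=> bA Lu i; apply: L2_sum => k; apply: bm_L2M; first exact: bA.
exact: (L2_flow Fm Fp).
Qed.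

Lemma matop_ae A t u w : (forall k, ae_eq muX setT (u k) (w k)) ->
  forall i, ae_eq muX setT (matop A t u i) (matop A t w i).
Proof.
move=> uw i.
have : {ae muX, forall x, forall k, u k (F t x) = w k (F t x)}.
  apply: (@filter_forall _ _ _ _ (ae_filter_ringOfSetsType muX)) => k.
  apply: (@ae_preserves _ _ _ _ _ (Fm t) (Fp t) (fun x => u k x = w k x)).
  by apply: (@filterS _ _ (ae_filter_ringOfSetsType muX) _ _ _ (uw k)) => x; apply.
by apply: (@filterS _ _ (ae_filter_ringOfSetsType muX)) => x E _; apply: eq_bigr => k _; rewrite E.
Qed.

Lemma matop_lin A t (c : R[i]) u w i x :
  matop A t (fun k x => c * u k x + w k x) i x = c * matop A t u i x + matop A t w i x.
Proof.
rewrite /matop mulr_sumr -big_split; apply: eq_bigr => k _ /=.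
by rewrite mulrDr mulrCA.
Qed.

Lemma L2norm_matop A t u (K : R) i : 0 <= K -> bmx A ->
  (forall x i k, cnorm (A x i k) <= K) -> L2v muX u ->
  L2norm muX (matop A t u i) <= K * \sum_k L2norm muX (u k).
Proof.
move=> K0 bA AK Lu.
apply: (le_trans (L2norm_sum _ _)) => [k|].
  by apply: bm_L2M; [exact: bA|exact: (L2_flow Fm Fp)].
rewrite mulr_sumr; apply: ler_sum => k _.
rewrite -(L2norm_flow Fm Fp t (Lu k)); apply: L2norm_bdM => //.
- exact: (bA i k).1.
- exact: (L2_flow Fm Fp).
Qed.

Lemma bmx_bound A : bmx A -> exists K, 0 <= K /\ forall x i k, cnorm (A x i k) <= K.
Proof.
move=> bA; have /choice[K KP] : forall ik : 'I_l.+1 * 'I_l.+1, exists K, forall x, cnorm (A x ik.1 ik.2) <= K.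
  by move=> ik; have [_] := bA ik.1 ik.2.
have K0 ik : 0 <= K ik by exact: le_trans (cnorm_ge0 _) (KP ik point).
exists (\sum_ik K ik); split; first exact: sumr_ge0.
move=> x i k; apply: le_trans (KP (i, k) x) _.
by rewrite (bigD1 (i, k))//= lerDl; exact: sumr_ge0.
Qed.

End MatrixOperators.

Section Transfer.
Context {R : realType} {X : ptopologicalType}.
Variables (F : R -> X -> X) (muX : probability (borel X) R) (phi : X -> U2 R).
Variables (mu : probability (borel (U2 R)) R) (l : nat) (m : int).
Hypotheses (cX : compact [set: X])
           (F0 : forall x, F 0 x = x) (FD : forall s t x, F (s + t) x = F s (F t x))
           (Fc : forall t, continuous (F t))
           (Fm : forall t, measurable_fun setT (F t : borel X -> borel X))
           (Fp : forall t, preserves_measure (F t : borel X -> borel X) muX)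
           (phiC1 : forall a b, flowC1 F (fun x => U2mx (phi x) a b)).
Local Notation vfun := ('I_l.+1 -> borel X -> R[i]).
Local Notation cocycle := (iter_cocycle F phi).
Local Notation gen := (gen F phi l m).
Implicit Types u v w : vfun.

(** The action of the N-th power of the Koopman operator on the coordinates,
    its inverse, and the coordinates of its commutator with [A]. *)
Definition transfer N : vfun -> vfun :=
  matop F (fun x => rho l m (cocycle N x)) N%:R.
Definition transfer_inv N : vfun -> vfun :=
  matop F (fun x => rho l m (cocycle N (F (- N%:R) x))^-1%g) (- N%:R).
Definition commutator_op N : vfun -> vfun :=
  matop F (fun x => 'i *: lie_rho F (cocycle N) l m x) N%:R.

Let cocycle_C1 N i k : flowC1 F (fun x => rho l m (cocycle N x) i k).
Proof. by apply: rho_phi_flowC1 => a b; exact: iter_cocycle_flowC1. Qed.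

Lemma rho_bound : exists K : R, 0 <= K /\ forall g (i k : 'I_l.+1), cnorm (rho l m g i k) <= K.
Proof.
have /choice[K KP] : forall ik : 'I_l.+1 * 'I_l.+1, exists K : R, forall g : U2 R, cnorm (rho l m g ik.1 ik.2) <= K.
  by move=> ik; have [_] := @bm_rho R l m ik.1 ik.2.
have K0 ik : 0 <= K ik by exact: le_trans (cnorm_ge0 _) (KP ik 1%g).
exists (\sum_ik K ik); split; first exact: sumr_ge0.
move=> g i k; apply: le_trans (KP (i, k) g) _.
by rewrite (bigD1 (i, k))//= lerDl; exact: sumr_ge0.
Qed.

Lemma bmx_rho N : bmx (fun x => rho l m (cocycle N x)).
Proof. by move=> i k; apply: ccont_bm => //; have [] := cocycle_C1 N i k. Qed.

Lemma bmx_rho_inv N : bmx (fun x => rho l m (cocycle N (F (- N%:R) x))^-1%g).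
Proof.
move=> i k; apply: (calg_rho bm_conj_algebra); apply: (calg_U2V bm_conj_algebra) => a b.
apply: (@bm_comp _ _ _ _ _ (F (- N%:R) : borel X -> borel X)
          (fun x => U2mx (cocycle N x) a b) (Fm _)).
by apply: ccont_bm => //; have [] := @iter_cocycle_flowC1 _ _ _ _ FD Fc phiC1 N a b.
Qed.

Lemma bmx_lie_rho N : bmx (fun x => 'i *: lie_rho F (cocycle N) l m x).
Proof.
move=> i k; rewrite (_ : (fun x => _) = fun x => 'i * lie_deriv F (fun y => rho l m (cocycle N y) i k) x).
  apply: (calgM bm_conj_algebra); first exact: (calg_cst bm_conj_algebra).
  by apply: ccont_bm => //; have [] := flowC1_lie F0 (cocycle_C1 N i k).
by apply/funext => x; rewrite !mxE.
Qed.

Lemma bmx_gen N : bmx (fun x => gen N x).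
Proof.
move=> i k; apply: (calg_mulmx bm_conj_algebra) => a b.
  by rewrite (_ : (fun x => _) = fun x => lie_deriv F (fun y => rho l m (cocycle N y) a b) x);
    [apply: ccont_bm => //; have [] := flowC1_lie F0 (cocycle_C1 N a b)
    |apply/funext => x; rewrite mxE].
apply: (calg_rho bm_conj_algebra); apply: (calg_U2V bm_conj_algebra) => c d.
by apply: ccont_bm => //; have [] := @iter_cocycle_flowC1 _ _ _ _ FD Fc phiC1 N c d.
Qed.

(** With [lie_rho = gen * rho], the commutator is the generator of the iterated
    cocycle applied after the transfer operator; this is why its averages
    converge. *)
Lemma commutator_op_gen N u i x :
  commutator_op N u i x = \sum_k 'i * gen N x i k * transfer N u k x.
Proof.
have -> : commutator_op N u i x =
    (('i *: lie_rho F (cocycle N) l m x) *m \col_k u k (F N%:R x)) i 0.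
  by rewrite mxE; apply: eq_bigr => k _; congr (_ * _); rewrite [RHS]mxE.
have -> : lie_rho F (cocycle N) l m x = gen N x *m rho l m (cocycle N x).
  by rewrite /gen -mulmxA rhoVl mulmx1.
rewrite scalemxAl -mulmxA mxE; apply: eq_bigr => k _; rewrite mxE; congr (_ * _).
by rewrite mxE; apply: eq_bigr => a _; congr (_ * _); rewrite [LHS]mxE.
Qed.

Lemma transferK N u i x : transfer N (transfer_inv N u) i x = u i x.
Proof.
have FF : F (- N%:R) (F N%:R x) = x by rewrite -FD addNr F0.
have -> : transfer N (transfer_inv N u) i x =
    (rho l m (cocycle N x) *m (rho l m (cocycle N x)^-1%g *m \col_k u k x)) i 0.
  rewrite mxE; apply: eq_bigr => k _; congr (_ * _).
  rewrite mxE; apply: eq_bigr => a _; rewrite [(\col__ _) _ _]mxE.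
  by rewrite !FF.
by rewrite mulmxA rhoV mul1mx mxE.
Qed.

(** Leibniz rule: the commutator of the generator with the transfer operator. *)
Lemma transfer_H_graph N u v : (forall k, H_graph F muX (u k) (v k)) ->
  forall i, H_graph F muX (transfer N u i)
    (fun x => commutator_op N u i x + transfer N v i x).
Proof.
move=> uv i; rewrite (_ : (fun x => _ + _) = fun x => \sum_k
    ('i * lie_deriv F (fun y => rho l m (cocycle N y) i k) x * u k (F N%:R x)
     + rho l m (cocycle N x) i k * v k (F N%:R x))).
  apply: (H_graph_sum Fm Fp) => k; have [c d] := flowC1_lie F0 (cocycle_C1 N i k).
  apply: (H_graph_mul F0 Fm Fp d); [exact: bmx_rho|exact: ccont_bm|].
  exact: (H_graph_flow FD Fm Fp).
apply/funext => x; rewrite -big_split; apply: eq_bigr => k _.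
by rewrite !mxE.
Qed.

Local Notation mean := (mean F muX mu phi l m).

Hypothesis haar : is_haar mu.
Hypothesis ue : uniquely_ergodic
    (skew_product F phi : borel X * borel (U2 R) -> borel X * borel (U2 R)) (haar_prod muX mu).

(** Almost everywhere convergence of [gen N / N] and its uniform bound give, by
    dominated convergence, strong convergence of the multiplication operators. *)
Lemma gen_limit i k (w : borel X -> R[i]) : L2 muX w ->
  (fun N => L2norm muX (fun x => (N%:R^-1 * gen N x i k - mean * (i == k)%:R) * w x))
    @ \oo --> (0 : R).
Proof.
move=> Lw; have [K KP] := gen_bound cX F0 FD Fc phiC1 l m.
have K0 : 0 <= K.
  by have := KP 1%N point i k; rewrite mul1r; exact: le_trans (cnorm_ge0 _).
pose M := K + cnorm (mean * (i == k)%:R).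
have bN N x : cnorm (N%:R^-1 * gen N x i k - mean * (i == k)%:R) <= M.
  apply: le_trans (cnormD _ _) _; rewrite cnormN lerD2r cnormM.
  have cN : cnorm (N%:R^-1 : R[i]) = N%:R^-1.
    by rewrite /cnorm -(rmorph_nat (real_complex R)) -fmorphV nsqC sqrtr_sqr ger0_norm ?invr_ge0.
  rewrite cN; have [->|N0] := posnP N; first by rewrite invr0 mul0r.
  by rewrite ler_pdivrMl ?ltr0n.
apply: (@L2_dominated_cvg0 _ _ _ _ _ (fun x => M ^+ 2 * nsq (w x))).
- move=> N; apply: cmeasM; last exact: L2_cmeas Lw.
  apply: cmeasB; last exact: cmeas_cst.
  by apply: cmeasZ; exact: (bmx_gen N i k).1.
- have := integrableZl measurableT (M ^+ 2) (L2_nsq Lw).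
  by apply: eq_integrable.
- move=> N x; rewrite nsqM ler_wpM2r ?nsq_ge0// -cnorm_sqr lerXn2r ?nnegrE ?cnorm_ge0//.
  by rewrite addr_ge0 ?cnorm_ge0.
- have := gen_cvg cX F0 FD Fc phiC1 haar l m ue;
  apply: (@filterS _ _ (ae_filter_ringOfSetsType muX)) => x /(_ i k) h.
  rewrite (_ : (fun N => _) = fun N => cnorm (w x * (N%:R^-1 * gen N x i k - mean * (i == k)%:R))).
    exact: cvg_cnormM.
  by apply/funext => N; rewrite mulrC.
Qed.

End Transfer.

(** * The averaged commutator *)

Lemma iter_koopman {R : realType} (T : Type) (S : T -> T) (f : T -> R[i]) N :
  iter N (koopman S) f = f \o iter N S.
Proof.
by elim: N => // N IH; rewrite iterS IH /koopman; apply/funext => x /=; rewrite -iterSr.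
Qed.

Lemma preserves_iter {R : realType} {d} {T : measurableType d} (P : {measure set T -> \bar R})
  (S : T -> T) N : measurable_fun setT S -> preserves_measure S P ->
  preserves_measure (iter N S) P.
Proof.
move=> mS pS; elim: N => // N IH A mA.
have mSA : measurable (S @^-1` A) by rewrite -[X in measurable X]setTI; exact: mS.
by rewrite -(pS _ mA) -(IH _ mSA).
Qed.

Section DegreeOperator.
Context {R : realType} {X : ptopologicalType}.
Variables (F : R -> X -> X) (muX : probability (borel X) R) (phi : X -> U2 R).
Variables (mu : probability (borel (U2 R)) R) (l : nat) (m : int) (j : 'I_l.+1).
Hypotheses (cX : compact [set: X])
           (F0 : forall x, F 0 x = x) (FD : forall s t x, F (s + t) x = F s (F t x))
           (Fc : forall t, continuous (F t))
           (Fm : forall t, measurable_fun setT (F t : borel X -> borel X))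
           (Fp : forall t, preserves_measure (F t : borel X -> borel X) muX)
           (phiC1 : forall a b, flowC1 F (fun x => U2mx (phi x) a b)).
Hypothesis dense : forall w, L2 muX w -> Hclosure F muX w.
Hypothesis haar : is_haar mu.

Local Notation XU := (borel X * borel (U2 R))%type.
Local Notation P := ((muX \x mu)%E : probability XU R).
Local Notation T := (skew_product F phi : XU -> XU).
Local Notation Ti := (skew_product_inv F phi : XU -> XU).
Local Notation vfun := ('I_l.+1 -> borel X -> R[i]).
Local Notation K := (rep_space muX mu m j).
Local Notation rep := (rep_sum m j).
Local Notation transfer := (transfer F phi m).
Local Notation transfer_inv := (transfer_inv F phi m).
Local Notation commutator_op := (commutator_op F phi m).
Implicit Types (u v w : vfun) (f h : XU -> R[i]).

Hypothesis ue : uniquely_ergodic T (haar_prod muX mu).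

Let mT : measurable_fun setT T. Proof. exact: measurable_skew_product. Qed.
Let pT : preserves_measure T P. Proof. by have [] := ue. Qed.

Let TK : cancel T Ti.
Proof. by move=> -[x g]; rewrite /skew_product_inv /= -FD addNr F0 mulgK. Qed.
Let mTi : measurable_fun setT Ti.
Proof.
apply: measurable_fun_pair; first exact: measurableT_comp (Fm _) measurable_fst.
apply: measurable_U2 => a b.
suff : bm (fun p : XU => U2mx (p.2 * (phi (F (- 1) p.1))^-1)%g a b) by case.
apply: (calg_mulmx bm_conj_algebra) => c d; first exact: bm_U2_snd.
apply: (calg_U2V bm_conj_algebra) => c' d'.
apply: (@bm_fst _ _ (fun x => U2mx (phi (F (- 1) x)) c' d')).
by apply: (@bm_comp _ _ _ _ _ (F (- 1) : borel X -> borel X)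
  (fun x => U2mx (phi x) c' d') (Fm _)); exact: bm_phi.
Qed.

Let pTi : preserves_measure Ti P.
Proof.
move=> A mA; rewrite -pT; last by rewrite -[X in measurable X]setTI; exact: mTi.
by congr (P _); apply/seteqP; split=> p /=; rewrite TK.
Qed.

Lemma iter_skew_product_inv N (p : XU) : iter N Ti p =
  (F (- N%:R) p.1, (p.2 * (iter_cocycle F phi N (F (- N%:R)%R p.1))^-1)%g).
Proof.
have iterK q : iter N Ti (iter N T q) = q.
  elim: N q => // N IH q; rewrite iterSr iterS TK; exact: IH.
rewrite -[RHS]iterK iter_skew_product//=; congr (iter N Ti _).
by case: p => x g /=; rewrite -FD addrN F0 mulgVK.
Qed.

Let rep_sum_shift (g h : U2 R) (c : 'I_l.+1 -> R[i]) :
  \sum_k c k * U2_rep_elt m j k (g * h)%g =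
  \sum_i (\sum_k rho l m h i k * c k) * U2_rep_elt m j i g.
Proof.
transitivity (\sum_k \sum_i (rho l m h i k * c k) * U2_rep_elt m j i g).
  apply: eq_bigr => k _; rewrite U2_rep_elt_rho rhoM mxE mulr_sumr mulr_sumr.
  apply: eq_bigr => i _; rewrite U2_rep_elt_rho.
  move: (weight j) (rho l m g j i) (rho l m h i k) (c k) => a1 a2 a3 a4; ring.
rewrite exchange_big; apply: eq_bigr => i _; exact: esym (mulr_suml _ _ _ _).
Qed.

(** Right translation acts linearly on the row [j] of the representation, hence
    on the coordinates. *)
Lemma koopman_rep_sum N u : iter N (koopman T) (rep u) = rep (transfer N u).
Proof.
rewrite iter_koopman; apply/funext => p.
transitivity (rep u (iter N T p)); first by [].
rewrite (iter_skew_product phi F0 FD).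
exact: (rep_sum_shift p.2 (iter_cocycle F phi N p.1) (fun k => u k (F N%:R p.1))).
Qed.

Lemma koopman_inv_rep_sum N u : iter N (koopman Ti) (rep u) = rep (transfer_inv N u).
Proof.
rewrite iter_koopman; apply/funext => p.
transitivity (rep u (iter N Ti p)); first by [].
rewrite iter_skew_product_inv.
exact: (rep_sum_shift p.2 (iter_cocycle F phi N (F (- N%:R) p.1))^-1%g
  (fun k => u k (F (- N%:R) p.1))).
Qed.

Lemma koopman_ae N f h : ae_eq P setT f h ->
  ae_eq P setT (iter N (koopman T) f) (iter N (koopman T) h).
Proof.
move=> fh; rewrite !iter_koopman.
apply: (@ae_preserves _ _ _ _ _ (measurable_iter mT N) (preserves_iter N mT pT)
  (fun p => setT p -> f p = h p)).
exact: fh.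
Qed.

Lemma koopman_inv_ae N f h : ae_eq P setT f h ->
  ae_eq P setT (iter N (koopman Ti) f) (iter N (koopman Ti) h).
Proof.
move=> fh; rewrite !iter_koopman.
apply: (@ae_preserves _ _ _ _ _ (measurable_iter mTi N) (preserves_iter N mTi pTi)
  (fun p => setT p -> f p = h p)).
exact: fh.
Qed.

Lemma L2_koopman N f : L2 P f -> L2 P (iter N (koopman T) f).
Proof.
rewrite iter_koopman.
exact: L2_preserves (measurable_iter mT N) (preserves_iter N mT pT) _.
Qed.

Lemma L2_koopman_inv N f : L2 P f -> L2 P (iter N (koopman Ti) f).
Proof.
rewrite iter_koopman.
exact: L2_preserves (measurable_iter mTi N) (preserves_iter N mTi pTi) _.
Qed.

Lemma L2v_transfer N u : L2v muX u -> L2v muX (transfer N u).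
Proof. by apply: L2v_matop => //; exact: bmx_rho. Qed.

Lemma L2v_transfer_inv N u : L2v muX u -> L2v muX (transfer_inv N u).
Proof. by apply: L2v_matop => //; exact: bmx_rho_inv. Qed.

Lemma L2v_commutator_op N u : L2v muX u -> L2v muX (commutator_op N u).
Proof. by apply: L2v_matop => //; exact: bmx_lie_rho. Qed.

Lemma koopman_inv_space N f : K f -> K (iter N (koopman Ti) f) /\
  ae_eq P setT (iter N (koopman Ti) f) (rep (transfer_inv N (coords muX mu m j f))).
Proof.
move=> Kf; have [Lu fu] := coordsP Kf; have [Lf _] := Kf.
have E := koopman_inv_ae N fu; rewrite koopman_inv_rep_sum in E.
split=> //; split; first exact: L2_koopman_inv.
by exists (transfer_inv N (coords muX mu m j f)) => //; exact: L2v_transfer_inv.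
Qed.

Definition commutator N f : XU -> R[i] := rep (commutator_op N (coords muX mu m j f)).

Lemma commutator_ae N f u : K f -> L2v muX u -> ae_eq P setT f (rep u) ->
  ae_eq P setT (commutator N f) (rep (commutator_op N u)).
Proof.
move=> Kf Lu fu; have [Lc _] := coordsP Kf; have [Lf _] := Kf.
apply: rep_sum_ae => //; [|exact: L2v_commutator_op..].
by apply: (matop_ae Fm Fp); exact: coords_ae Lu fu Lf.
Qed.

Lemma commutator_bounded N : bounded_op P K (commutator N).
Proof.
have [C [C0 CP]] := bmx_bound (bmx_lie_rho (l := l) m cX F0 FD Fc phiC1 N).
split.
- by move=> f Kf; apply: rep_space_sum; apply: L2v_commutator_op; have [] := coordsP Kf.
- move=> a f h Kf Kh; have [Lu fu] := coordsP Kf; have [Lw hw] := coordsP Kh.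
  apply: ae_eq_trans (commutator_ae N (rep_space_lin a Kf Kh) (L2v_lin a Lu Lw) _) _.
    move: fu hw; apply: filterS2 => p /(_ I) fu /(_ I) hw _.
    by rewrite rep_sum_lin fu hw.
  apply: aeW => p _; rewrite -rep_sum_lin; congr (rep_sum _ _ _ _).
  by apply/funext => i; apply/funext => x; exact: matop_lin.
- pose c k := Num.sqrt (rep_norm mu m j k).
  have ck k : 0 < c k by rewrite sqrtr_gt0 rep_norm_gt0.
  exists (\sum_k c k * (C * \sum_i (c i)^-1)) => f Kf; have [Lu fu] := coordsP Kf.
  have [Lf _] := Kf; rewrite (L2norm_ae Lf (L2_rep_sum _ _ _ Lu) fu).
  apply: le_trans (L2norm_rep_sum_le _ _ haar (L2v_commutator_op N Lu)) _.
  rewrite mulr_suml; apply: ler_sum => k _; rewrite -!mulrA; apply: ler_wpM2l; first exact/ltW/ck.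
  apply: (@le_trans _ _ (C * \sum_i L2norm muX (coords muX mu m j f i))).
    by apply: (L2norm_matop Fm Fp) => //; exact: bmx_lie_rho.
  rewrite ler_wpM2l// mulr_suml; apply: ler_sum => i _; exact: L2norm_coord_le.
Qed.

(** The coordinates of [A] being the generator of the flow, the commutator is
    given by the Leibniz rule. *)
Lemma commutatorP N : is_commutator P K (A_graph F muX mu m j)
  (iter N (koopman T)) (commutator N).
Proof.
split; first exact: commutator_bounded.
move=> f h [Kf [Kh [u [v [uv fu hv]]]]].
have Lu : L2v muX u by move=> k; have [] := uv k.
have Lv : L2v muX v by move=> k; have [] := uv k.
have [Lf _] := Kf; have [Lh _] := Kh.
have [bK _ _] := commutator_bounded N; have [LB _] := bK f Kf.
have LBu := L2v_commutator_op N Lu; have LTu := L2v_transfer N Lu; have LTv := L2v_transfer N Lv.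
have kf := koopman_ae N fu; have kh := koopman_ae N hv; rewrite !koopman_rep_sum in kf kh.
rewrite (L2inner_ae Lf (L2_rep_sum mu m j Lu) LB (L2_rep_sum mu m j LBu) fu (commutator_ae N Kf Lu fu)).
rewrite (L2inner_ae Lh (L2_rep_sum mu m j Lv) (L2_koopman N Lf) (L2_rep_sum mu m j LTu) hv kf).
rewrite (L2inner_ae Lf (L2_rep_sum mu m j Lu) (L2_koopman N Lh) (L2_rep_sum mu m j LTv) fu kh).
rewrite !L2inner_rep_sum// -sumrB; apply: eq_bigr => k _; rewrite -mulrBr; congr (_ * _).
have := H_symmetric F0 FD Fm Fp (uv k) (transfer_H_graph m cX F0 FD Fc Fm Fp phiC1 N uv k).
by move=> ->; rewrite L2innerDr// addrK.
Qed.

Lemma A_graph_lin c f h f' h' : A_graph F muX mu m j f h -> A_graph F muX mu m j f' h' ->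
  A_graph F muX mu m j (fun p => c * f p + f' p) (fun p => c * h p + h' p).
Proof.
move=> [Kf [Kh [u [v [uv fu hv]]]]] [Kf' [Kh' [u' [v' [uv' fu' hv']]]]].
split; first exact: rep_space_lin.
split; first exact: rep_space_lin.
exists (fun k x => c * u k x + u' k x), (fun k x => c * v k x + v' k x); split.
- by move=> k; exact: H_graph_lin.
- move: fu fu'; apply: filterS2 => p /(_ I) E /(_ I) E' _.
  by rewrite rep_sum_lin E E'.
- move: hv hv'; apply: filterS2 => p /(_ I) E /(_ I) E' _.
  by rewrite rep_sum_lin E E'.
Qed.

Lemma A_dense f (e : R) : K f -> 0 < e ->
  exists2 f', (exists h, A_graph F muX mu m j f' h) & L2norm P (fun p => f p - f' p) < e.
Proof.
move=> Kf e0; have [Lu fu] := coordsP Kf; have [Lf _] := Kf.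
set u := coords muX mu m j f in Lu fu.
pose c k := Num.sqrt (rep_norm mu m j k).
have c0 k : 0 <= c k by exact: sqrtr_ge0.
have C0 : 0 < \sum_k c k + 1 by rewrite ltr_wpDl ?sumr_ge0.
have d0 := divr_gt0 e0 C0; set d := e / _ in d0.
have /choice[w] : forall k, exists wh : (borel X -> R[i]) * (borel X -> R[i]),
    H_graph F muX wh.1 wh.2 /\ L2norm muX (fun x => u k x - wh.1 x) < d.
  by move=> k; have [_ /(_ _ d0)[w [h [wh uw]]]] := dense (Lu k); exists (w, h).
move=> wP; have Lw : L2v muX (fun k => (w k).1) by move=> k; have [[]] := wP k.
have Lv : L2v muX (fun k => (w k).2) by move=> k; have [[]] := wP k.
have Lb : L2v muX (fun k x => u k x - (w k).1 x) by move=> k; exact: L2B.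
exists (rep (fun k => (w k).1)).
  exists (rep (fun k => (w k).2)); split; first exact: rep_space_sum.
  split; first exact: rep_space_sum.
  exists (fun k => (w k).1), (fun k => (w k).2).
  by split; [move=> k; have [] := wP k|exact: ae_eq_refl|exact: ae_eq_refl].
have E : ae_eq P setT (fun p => f p - rep (fun k => (w k).1) p)
    (rep (fun k x => u k x - (w k).1 x)).
  apply: filterS fu => p /(_ I) -> _; rewrite /rep_sum -sumrB.
  by apply: eq_bigr => k _; rewrite mulrBl.
rewrite (L2norm_ae (L2B Lf (L2_rep_sum mu m j Lw)) (L2_rep_sum mu m j Lb) E).
apply: le_lt_trans (L2norm_rep_sum_le m j haar Lb) _.
apply: (@le_lt_trans _ _ (\sum_k c k * d)).
  by apply: ler_sum => k _; apply: ler_wpM2l => //; apply/ltW; have [] := wP k.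
by rewrite -mulr_suml /d mulrCA gtr_pMr// ltr_pdivrMr// mul1r ltrDl.
Qed.

(** The commutator is prescribed through its quadratic form on the domain of [A],
    which is dense. *)
Lemma commutator_unique N B :
  is_commutator P K (A_graph F muX mu m j) (iter N (koopman T)) B ->
  forall f, K f -> ae_eq P setT (B f) (commutator N f).
Proof.
move=> [bB BP]; have [bC CP] := commutatorP N.
apply: (@bounded_op_form_ext _ _ _ P K [set f | exists h, A_graph F muX mu m j f h]).
- by move=> f [].
- by move=> f [h []].
- by move=> c f h; exact: rep_space_lin.
- by move=> c f g [h fh] [h' fh']; exists (fun p => c * h p + h' p); exact: A_graph_lin.
- by move=> f Kf e e0; exact: A_dense.
- by [].
- by [].
- by move=> f [h fh]; rewrite (BP f h fh) (CP f h fh).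
Qed.

Local Notation c := ('i * mean F muX mu phi l m).

(** In coordinates the operator of rank [N] is multiplication by the matrix
    [i gen N / N], which converges to the scalar [i mean]. *)
Lemma commutator_limit f : K f -> (fun N => L2norm P (fun p =>
    (N%:R^-1)%:C * commutator N (iter N (koopman Ti) f) p - c * f p)) @ \oo --> (0 : R).
Proof.
move=> Kf; have [Lu fu] := coordsP Kf; have [Lf _] := Kf.
set u := coords muX mu m j f in Lu fu.
pose q N i k (x : borel X) := N%:R^-1 * gen F phi l m N x i k - mean F muX mu phi l m * (i == k)%:R.
have Lq N i k : L2 muX (fun x => q N i k x * u k x).
  apply: bm_L2M => //; apply: (calgD bm_conj_algebra); last exact: (calg_cst bm_conj_algebra).
  apply: (calgM bm_conj_algebra); first exact: (calg_cst bm_conj_algebra).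
  exact: bmx_gen.
have Lr N : L2v muX (fun i x => 'i * \sum_k q N i k x * u k x).
  by move=> i; apply: L2Z; exact: L2_sum.
have E N : ae_eq P setT (fun p =>
    (N%:R^-1)%:C * commutator N (iter N (koopman Ti) f) p - c * f p)
    (rep (fun i x => 'i * \sum_k q N i k x * u k x)).
  have [KN fN] := koopman_inv_space N Kf.
  have cN := commutator_ae N KN (L2v_transfer_inv N Lu) fN.
  move: cN fu; apply: filterS2 => p /(_ I) E1 /(_ I) E2 _.
  have key i : (N%:R^-1)%:C * commutator_op N (transfer_inv N u) i p.1 - c * u i p.1 =
      'i * \sum_k q N i k p.1 * u k p.1.
    rewrite commutator_op_gen.
    under eq_bigr => k _ do rewrite transferK//.
    rewrite /q; under [in RHS]eq_bigr => k _ do rewrite mulrBl.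
    rewrite sumrB mulrBr; congr (_ - _).
      rewrite !mulr_sumr; apply: eq_bigr => k _.
      by rewrite fmorphV rmorph_nat; ring.
    rewrite (bigD1 i)// big1; first by rewrite [X in _ = 'i * X]addr0 eqxx mulr1 -mulrA.
    by move=> k ki; rewrite eq_sym (negPf ki) mulr0 mul0r.
  rewrite E1 E2 /rep_sum mulr_sumr mulr_sumr -sumrB; apply: eq_bigr => i _.
  by rewrite -key mulrBl; congr (_ - _); exact: mulrA.
have bd N : L2norm P (fun p => (N%:R^-1)%:C * commutator N (iter N (koopman Ti) f) p - c * f p)
    <= \sum_i Num.sqrt (rep_norm mu m j i) * \sum_k L2norm muX (fun x => q N i k x * u k x).
  have [KN _] := koopman_inv_space N Kf; have [bK _ _] := commutator_bounded N.
  have [LN _] := bK _ KN.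
  rewrite (L2norm_ae (L2B (L2Z _ LN) (L2Z _ Lf)) (L2_rep_sum mu m j (Lr N)) (E N)).
  apply: le_trans (L2norm_rep_sum_le m j haar (Lr N)) _.
  apply: ler_sum => i _; apply: ler_wpM2l; first exact: sqrtr_ge0.
  by rewrite L2normZ ?cnorm_i ?mul1r; [exact: L2norm_sum|exact: L2_sum].
apply: (@squeeze_cvgr _ _ _ _ (fun=> 0) (fun N => \sum_i Num.sqrt (rep_norm mu m j i) *
  \sum_k L2norm muX (fun x => q N i k x * u k x))).
- by apply: nearW => N; rewrite L2norm_ge0 bd.
- exact: cvg_cst.
- rewrite -[X in _ --> X](_ : \sum_i Num.sqrt (rep_norm mu m j i) * \sum_(k < l.+1) 0 = 0); last first.
    by apply: big1 => i _; rewrite big1// mulr0.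
  apply: cvgr_sum => i; apply: cvgMr; apply: cvgr_sum => k.
  exact: gen_limit.
Qed.

Lemma cmul_is_D : is_D F muX mu phi m j (fun f p => c * f p).
Proof.
split; last by exists commutator; split; [exact: commutatorP|exact: commutator_limit].
split.
- move=> f Kf; have := rep_space_lin c Kf (rep_space_lin (-1) Kf Kf).
  by congr K; apply/funext => p; rewrite mulN1r addNr addr0.
- by move=> a f g _ _; apply: aeW => p _; ring.
- by exists (cnorm c) => f [Lf _]; rewrite L2normZ.
Qed.

(** All the admissible families of commutators agree almost everywhere with
    [commutator], hence so do their averaged limits. *)
Lemma D_opE f : K f -> ae_eq P setT (D_op F muX mu phi m j f) (fun p => c * f p).
Proof.
move=> Kf; have : is_D F muX mu phi m j (D_op F muX mu phi m j).
  by rewrite /D_op; case: xgetP => [D _ //|/(_ (fun f p => c * f p))]; have := cmul_is_D.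
set D := D_op _ _ _ _ _ _ => -[[DK _ _] [B [BP Dlim]]].
have [Lf _] := Kf; have [LD _] := DK f Kf.
have Ldif : L2 P (fun p => D f p - c * f p) by apply: L2B => //; exact: L2Z.
suff d0 : L2norm P (fun p => D f p - c * f p) = 0.
  have := L2norm_ae0 Ldif d0; apply: filterS => p /(_ I) h _.
  by apply/eqP; rewrite -subr_eq0; apply/eqP.
pose x N p := (N%:R^-1)%:C * B N (iter N (koopman Ti) f) p.
pose y N p := (N%:R^-1)%:C * commutator N (iter N (koopman Ti) f) p.
have Lx N : L2 P (x N).
  have [KN _] := koopman_inv_space N Kf; have [[bK _ _] _] := BP N.
  by apply: L2Z; have [] := bK _ KN.
have Ly N : L2 P (y N).
  have [KN _] := koopman_inv_space N Kf; have [bK _ _] := commutator_bounded N.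
  by apply: L2Z; have [] := bK _ KN.
have xy N : ae_eq P setT (x N) (y N).
  have [KN _] := koopman_inv_space N Kf.
  by apply: filterS (commutator_unique (BP N) KN) => p /(_ I) h _; rewrite /x h.
have bd N : L2norm P (fun p => D f p - c * f p) <=
    L2norm P (fun p => x N p - D f p) + L2norm P (fun p => y N p - c * f p).
  have La := L2B (Lx N) LD; have Lb := L2B (Ly N) (L2Z c Lf).
  have E : ae_eq P setT (fun p => D f p - c * f p)
      (fun p => (y N p - c * f p) - (x N p - D f p)).
    by apply: filterS (xy N) => p /(_ I) -> _; ring.
  rewrite (L2norm_ae Ldif (L2B Lb La) E) addrC; exact: L2normB.
have lim0 : (fun N => L2norm P (fun p => x N p - D f p) +
    L2norm P (fun p => y N p - c * f p)) @ \oo --> (0 : R).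
  rewrite -[X in _ --> X](addr0 (0 : R)).
  by apply: cvgD; [exact: Dlim f Kf|exact: commutator_limit Kf].
apply/eqP; rewrite eq_le L2norm_ge0 andbT.
pose z : R := L2norm P (fun p => D f p - c * f p).
have zc : (fun=> z) @ \oo --> z by exact: cvg_cst.
apply: (ler_cvg_to zc lim0).
by apply: nearW => N; exact: bd.
Qed.

(** A multiplication by a constant has kernel zero or everything. *)
Lemma D_ker_orthoE : D_ker_ortho F muX mu phi m j =
  if c != 0 then K else L2zero P.
Proof.
have Kae f g : K f -> L2 P g -> ae_eq P setT g f -> K g.
  move=> [_ [u Lu fu]] Lg gf; split=> //; exists u => //; exact: ae_eq_trans gf fu.
have [c0|c0] := eqVneq c 0.
  apply/seteqP; split=> f.
    move=> [Kf orth]; have [Lf _] := Kf; split=> //; apply: L2sq_ae0 => //.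
    suff /(congr1 Re) : L2inner P f f = 0 by rewrite L2inner_diag.
    apply: orth; split=> //; apply: filterS (D_opE Kf) => p /(_ I) -> _.
    by rewrite [X in X * _]c0 mul0r.
  move=> [Lf f0]; have K0 : K (rep (fun _ _ => 0)) by apply: rep_space_sum => k; exact: L20.
  have Kf : K f.
    apply: Kae K0 Lf _; apply: filterS f0 => p /(_ I) -> _.
    by rewrite /rep_sum big1// => k _; rewrite mul0r.
  split=> // g [[Lg _] _]; exact: L2inner0l.
apply/seteqP; split=> f; first by case.
move=> Kf; have [Lf _] := Kf; split=> // g [Kg g0]; have [Lg _] := Kg.
have g00 : ae_eq P setT g 0.
  move: g0 (D_opE Kg); apply: filterS2 => p /(_ I) g0 /(_ I) E _.
  move: E; rewrite g0 => /esym/eqP; rewrite mulf_eq0 (negPf c0) => /eqP.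
  exact.
by rewrite (L2innerC Lg Lf) L2inner0l// raddf0.
Qed.

End DegreeOperator.

(** * Decay of correlations on the manifold *)

Lemma cvg0_approx {R : realType} (a : R ^nat) : (forall N, 0 <= a N) ->
  (forall e : R, 0 < e -> exists b : R ^nat,
     b @ \oo --> (0 : R) /\ forall N, a N <= b N + e) -> a @ \oo --> (0 : R).
Proof.
move=> a0 h; apply/cvgr0Pnorm_lt => e e0.
have e2 : 0 < e / 2 by rewrite divr_gt0.
have [b [b0 ab]] := h _ e2.
move/cvgr0Pnorm_lt: b0 => /(_ _ e2) bN.
near=> N; rewrite ger0_norm//; apply: le_lt_trans (ab N) _.
rewrite [ltRHS]splitr ltrD2r; apply: le_lt_trans (ler_norm _) _.
by near: N.
Unshelve. all: by end_near. Qed.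

Section WeakMixing.
Context {R : realType} {X : ptopologicalType}.
Variables (F : R -> X -> X) (muX : probability (borel X) R) (phi : X -> U2 R).
Variables (mu : probability (borel (U2 R)) R) (l : nat) (m : int) (j : 'I_l.+1).
Hypotheses (cX : compact [set: X])
           (F0 : forall x, F 0 x = x) (FD : forall s t x, F (s + t) x = F s (F t x))
           (Fc : forall t, continuous (F t))
           (Fm : forall t, measurable_fun setT (F t : borel X -> borel X))
           (Fp : forall t, preserves_measure (F t : borel X -> borel X) muX)
           (phiC1 : forall a b, flowC1 F (fun x => U2mx (phi x) a b)).
Hypothesis dense : forall w, L2 muX w -> Hclosure F muX w.
Hypothesis haar : is_haar mu.

Local Notation XU := (borel X * borel (U2 R))%type.
Local Notation P := ((muX \x mu)%E : probability XU R).
Local Notation T := (skew_product F phi : XU -> XU).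
Local Notation Ti := (skew_product_inv F phi : XU -> XU).
Local Notation vfun := ('I_l.+1 -> borel X -> R[i]).
Local Notation transfer := (transfer F phi m).
Local Notation transfer_inv := (transfer_inv F phi m).
Local Notation commutator_op := (commutator_op F phi m).
Local Notation mean := (mean F muX mu phi l m).
Implicit Types (u v w : vfun).

Hypothesis ue : uniquely_ergodic T (haar_prod muX mu).
Hypothesis mean_neq0 : mean != 0.

Lemma L2norm_transfer : exists C : R, 0 <= C /\ forall N u i, L2v muX u ->
  L2norm muX (transfer N u i) <= C * \sum_k L2norm muX (u k).
Proof.
have [C [C0 CP]] := @rho_bound R l m; exists C; split=> // N u i Lu.
by apply: (L2norm_matop Fm Fp) => //; exact: bmx_rho.
Qed.

Let q N i k (x : borel X) := N%:R^-1 * gen F phi l m N x i k - mean * (i == k)%:R.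

Let bmq N i k : bm (q N i k).
Proof.
apply: (calgD bm_conj_algebra); last exact: (calg_cst bm_conj_algebra).
apply: (calgM bm_conj_algebra); first exact: (calg_cst bm_conj_algebra).
exact: bmx_gen.
Qed.

(** By symmetry of the generator, the pairing of [f] with the commutator applied
    to [u] is bounded uniformly in [N]. Divided by [N], the commutator is close to
    [i mean] times the transfer operator, so that the pairing of [f] with the
    latter tends to zero as soon as the mean does not vanish. *)
Lemma transfer_weak0_smooth (f h : borel X -> R[i]) u v k :
  H_graph F muX f h -> (forall i, H_graph F muX (u i) (v i)) ->
  (fun N => cnorm (L2inner muX f (transfer N u k))) @ \oo --> (0 : R).
Proof.
move=> fh uv; have [C [C0 CP]] := L2norm_transfer.
have Lu : L2v muX u by move=> i; have [] := uv i.
have Lv : L2v muX v by move=> i; have [] := uv i.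
have [Lf Lh _] := fh.
pose S w := C * \sum_i L2norm muX (w i).
have LT N w : L2v muX w -> L2v muX (transfer N w).
  by apply: L2v_matop => //; exact: bmx_rho.
have LB N : L2v muX (commutator_op N u) by apply: L2v_matop => //; exact: bmx_lie_rho.
have Lq N i (w : borel X -> R[i]) : L2 muX w -> L2 muX (fun x => q N k i x * w x).
  by move=> Lw; apply: bm_L2M; [exact: bmq|].
have comm N : L2inner muX f (commutator_op N u k) =
    L2inner muX h (transfer N u k) - L2inner muX f (transfer N v k).
  have := H_symmetric F0 FD Fm Fp fh (transfer_H_graph m cX F0 FD Fc Fm Fp phiC1 N uv k).
  move=> ->; rewrite L2innerDr ?addrK//; [exact: LB|exact: LT].
have expand N : (fun x => N%:R^-1 * commutator_op N u k x) =
    (fun x => 'i * mean * transfer N u k x + 'i * \sum_i q N k i x * transfer N u i x).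
  apply/funext => x; rewrite commutator_op_gen.
  have -> : 'i * mean * transfer N u k x = 'i * \sum_i mean * (k == i)%:R * transfer N u i x.
    rewrite (bigD1 k)// big1; first by rewrite [X in _ = 'i * X]addr0 eqxx mulr1 -mulrA.
    by move=> i ik; rewrite eq_sym (negPf ik) mulr0 mul0r.
  rewrite -mulrDr -big_split !mulr_sumr; apply: eq_bigr => i _ /=.
  by rewrite /q -mulrDl addrC subrK; ring.
pose A := cnorm ('i * mean); have A0 : 0 < A.
  rewrite lt_neqAle cnorm_ge0 andbT eq_sym; apply/eqP => /cnorm_eq0 /eqP.
  by rewrite mulf_eq0 (negPf (neq0Ci _)) (negPf mean_neq0).
pose M := L2norm muX h * S u + L2norm muX f * S v.
have bd N : A * cnorm (L2inner muX f (transfer N u k)) <=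
    N%:R^-1 * M + \sum_i L2norm muX (fun x => q N k i x * f x) * S u.
  have Ls : L2 muX (fun x => \sum_i q N k i x * transfer N u i x).
    by apply: L2_sum => i; apply: Lq; exact: LT.
  have E : conjc ('i * mean) * L2inner muX f (transfer N u k) =
      conjc (N%:R^-1) * L2inner muX f (commutator_op N u k) -
      conjc 'i * \sum_i L2inner muX f (fun x => q N k i x * transfer N u i x).
    have Lt i : L2 muX (fun x => q N k i x * transfer N u i x) by apply: Lq; exact: LT.
    have L1 := L2Z ('i * mean) (LT N u Lu k); have L2' := L2Z 'i Ls.
    have H1 := L2innerZr (N%:R^-1) (LB N k) Lf.
    rewrite (expand N) (L2innerDr L1 L2' Lf) in H1.
    rewrite (L2innerZr ('i * mean) (LT N u Lu k) Lf) (L2innerZr 'i Ls Lf) in H1.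
    rewrite (L2inner_sumr _ Lt Lf) in H1.
    apply/eqP; rewrite eq_sym subr_eq; apply/eqP; exact: esym H1.
  have cN : cnorm (N%:R^-1 : R[i]) = N%:R^-1.
    by rewrite /cnorm -(rmorph_nat (real_complex R)) -fmorphV nsqC sqrtr_sqr ger0_norm ?invr_ge0.
  rewrite /A -cnormJ -cnormM E; apply: le_trans (cnormD _ _) _.
  rewrite cnormN !cnormM !cnormJ cnorm_i mul1r cN; apply: lerD.
    rewrite ler_wpM2l ?invr_ge0// comm; apply: le_trans (cnormD _ _) _; rewrite cnormN.
    apply: lerD.
      apply: le_trans (cauchy_schwarz Lh (LT N u Lu k)) _.
      by apply: ler_wpM2l; [exact: L2norm_ge0|exact: CP].
    apply: le_trans (cauchy_schwarz Lf (LT N v Lv k)) _.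
    by apply: ler_wpM2l; [exact: L2norm_ge0|exact: CP].
  apply: le_trans (cnorm_sum _ _) _; apply: ler_sum => i _.
  have bJ : bm (fun x => conjc (q N k i x)) by apply: (calgJ bm_conj_algebra); exact: bmq.
  have LJ : L2 muX (fun x => conjc (q N k i x) * f x) by exact: bm_L2M.
  have -> : L2inner muX f (fun x => q N k i x * transfer N u i x) =
      L2inner muX (fun x => conjc (q N k i x) * f x) (transfer N u i).
    by apply: eq_cintegral => x; rewrite conjcM mulrA [f x * _]mulrC.
  apply: le_trans (cauchy_schwarz LJ (LT N u Lu i)) _.
  have -> : L2norm muX (fun x => conjc (q N k i x) * f x) = L2norm muX (fun x => q N k i x * f x).
    rewrite !L2normE; congr Num.sqrt; rewrite /L2sq; congr (Rintegral _ _ _).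
    by apply/funext => x; rewrite /= !nsqM nsqJ.
  by apply: ler_wpM2l; [exact: L2norm_ge0|exact: CP].
apply: (@squeeze_cvgr _ _ _ _ (fun=> 0) (fun N => A^-1 * (N%:R^-1 * M +
  \sum_i L2norm muX (fun x => q N k i x * f x) * S u))).
- by apply: nearW => N; rewrite cnorm_ge0 ler_pdivlMl// bd.
- exact: cvg_cst.
- rewrite -[X in _ --> X](mulr0 A^-1) -[X in _ * X](addr0 (0 : R)).
  apply: cvgMr; apply: cvgD.
    rewrite -[X in _ --> X](mul0r M); apply: cvgMl.
    by rewrite -(@cvg_shiftS R^o (fun N => N%:R^-1)); exact: cvg_harmonic.
  rewrite -[X in _ --> X](_ : \sum_(i < l.+1) 0 * S u = 0); last first.
    by apply: big1 => i _; rewrite mul0r.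
  apply: cvgr_sum => i; apply: cvgMl.
  exact: gen_limit.
Qed.

Lemma transfer_weak0 (f : borel X -> R[i]) u k : L2 muX f -> L2v muX u ->
  (fun N => cnorm (L2inner muX f (transfer N u k))) @ \oo --> (0 : R).
Proof.
move=> Lf Lu; have [C [C0 CP]] := L2norm_transfer.
apply: cvg0_approx => [N|e e0]; first exact: cnorm_ge0.
have e2 : 0 < e / 2 by rewrite divr_gt0.
(* [a] absorbs the norms of [f] and of the transfer operators; it bounds the
   cost of replacing [u] by a vector of the domain *)
pose a := L2norm muX f * (C * l.+1%:R) + 1.
have a0 : 0 < a by rewrite ltr_wpDl// mulr_ge0 ?L2norm_ge0// mulr_ge0.
have /choice[w wP] : forall i, exists wv : (borel X -> R[i]) * (borel X -> R[i]),
    H_graph F muX wv.1 wv.2 /\ L2norm muX (fun x => u i x - wv.1 x) < e / 2 / a.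
  move=> i; have [_ /(_ _ (divr_gt0 e2 a0))[w [h [wh uw]]]] := dense (Lu i).
  by exists (w, h).
have Lw : L2v muX (fun i => (w i).1) by move=> i; have [[]] := wP i.
have Ld : L2v muX (fun i x => u i x - (w i).1 x) by move=> i; exact: L2B.
pose s := C * \sum_i L2norm muX (w i).1.
have s0 : 0 <= s by rewrite mulr_ge0// sumr_ge0// => i _; exact: L2norm_ge0.
have s1 : 0 < s + 1 by rewrite ltr_wpDl.
have [_ /(_ _ (divr_gt0 e2 s1))[f' [h' [fh ff]]]] := dense Lf.
have [Lf' _ _] := fh.
exists (fun N => cnorm (L2inner muX f' (transfer N (fun i => (w i).1) k))); split.
  by apply: (transfer_weak0_smooth k fh (v := fun i => (w i).2)) => i; have [] := wP i.
move=> N; have LT v : L2v muX v -> L2v muX (transfer N v).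
  by apply: L2v_matop => //; exact: bmx_rho.
have LTw := LT _ Lw k; have LTd := LT _ Ld k.
have -> : transfer N u k = (fun x => transfer N (fun i => (w i).1) k x +
    transfer N (fun i x => u i x - (w i).1 x) k x).
  apply/funext => x; rewrite /transfer /matop -big_split; apply: eq_bigr => i _ /=.
  by rewrite -mulrDr addrC subrK.
have -> : L2inner muX f (fun x => transfer N (fun i => (w i).1) k x +
    transfer N (fun i x => u i x - (w i).1 x) k x) =
  L2inner muX f' (transfer N (fun i => (w i).1) k) +
  (L2inner muX (fun x => f x - f' x) (transfer N (fun i => (w i).1) k) +
   L2inner muX f (transfer N (fun i x => u i x - (w i).1 x) k)).
  by rewrite (L2innerDr LTw LTd Lf) (L2innerBl Lf Lf' LTw) addrA addrC addrA [RHS]addrC; ring.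
apply: le_trans (cnormD _ _) _; rewrite lerD2l.
apply: le_trans (cnormD _ _) _; rewrite [leRHS]splitr; apply: lerD.
  apply: le_trans (cauchy_schwarz (L2B Lf Lf') LTw) _.
  apply: (@le_trans _ _ (e / 2 / (s + 1) * s)).
    by apply: ler_pM; rewrite ?L2norm_ge0// ?CP// ltW.
  by rewrite mulrAC ler_pdivrMr// ler_wpM2l ?lerDl// ltW.
apply: le_trans (cauchy_schwarz Lf LTd) _.
apply: (@le_trans _ _ (L2norm muX f * (C * (l.+1%:R * (e / 2 / a))))).
  apply: ler_wpM2l; first exact: L2norm_ge0.
  apply: le_trans (CP N _ k Ld) _; apply: ler_wpM2l => //.
  rewrite -[X in X%:R * _](card_ord l.+1) mulr_natl -sumr_const.
  by apply: ler_sum => i _; apply/ltW; have [] := wP i.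
have -> : L2norm muX f * (C * (l.+1%:R * (e / 2 / a))) = (a - 1) * (e / 2) / a.
  by rewrite /a; ring.
by rewrite ler_pdivrMr// mulrC ler_wpM2l ?gerBl// ltW.
Qed.

End WeakMixing.

(** * Mixing of the skew product *)

Section Mixing.
Context {R : realType} {X : ptopologicalType}.
Variables (F : R -> X -> X) (muX : probability (borel X) R) (phi : X -> U2 R).
Variables (mu : probability (borel (U2 R)) R) (l : nat) (m : int) (j : 'I_l.+1).
Hypotheses (cX : compact [set: X])
           (F0 : forall x, F 0 x = x) (FD : forall s t x, F (s + t) x = F s (F t x))
           (Fc : forall t, continuous (F t))
           (Fm : forall t, measurable_fun setT (F t : borel X -> borel X))
           (Fp : forall t, preserves_measure (F t : borel X -> borel X) muX)
           (phiC1 : forall a b, flowC1 F (fun x => U2mx (phi x) a b)).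
Hypothesis dense : forall w, L2 muX w -> Hclosure F muX w.
Hypothesis haar : is_haar mu.

Local Notation XU := (borel X * borel (U2 R))%type.
Local Notation P := ((muX \x mu)%E : probability XU R).
Local Notation T := (skew_product F phi : XU -> XU).
Local Notation Ti := (skew_product_inv F phi : XU -> XU).
Local Notation vfun := ('I_l.+1 -> borel X -> R[i]).
Local Notation transfer := (transfer F phi m).
Local Notation transfer_inv := (transfer_inv F phi m).
Local Notation mean := (mean F muX mu phi l m).
Implicit Types (u v w : vfun).

Hypothesis ue : uniquely_ergodic T (haar_prod muX mu).
Hypothesis mean_neq0 : mean != 0.


Local Notation K := (rep_space muX mu m j).
Local Notation rep := (rep_sum m j).

Definition decorrelates (g : XU -> R[i]) := L2 P g /\ forall f, K f ->
  (fun N => cnorm (L2inner P f (iter N (koopman T) g))) @ \oo --> (0 : R).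

Let pT : preserves_measure T P. Proof. by have [] := ue. Qed.
Let mT : measurable_fun setT T. Proof. exact: measurable_skew_product. Qed.
Let LU N f : L2 P f -> L2 P (iter N (koopman T) f).
Proof. by rewrite iter_koopman; exact: L2_preserves (measurable_iter mT N) (preserves_iter N mT pT) _. Qed.
Let LUnorm N f : L2 P f -> L2norm P (iter N (koopman T) f) = L2norm P f.
Proof. by rewrite iter_koopman; exact: L2norm_preserves (measurable_iter mT N) (preserves_iter N mT pT) _. Qed.

Lemma decorrelates_lin (c : R[i]) g h : decorrelates g -> decorrelates h ->
  decorrelates (fun p => c * g p + h p).
Proof.
move=> [Lg dg] [Lh dh]; split; first by apply: L2D => //; exact: L2Z.
move=> f Kf; have [Lf _] := Kf.
apply: (@squeeze_cvgr _ _ _ _ (fun=> 0) (fun N =>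
  cnorm c * cnorm (L2inner P f (iter N (koopman T) g)) +
  cnorm (L2inner P f (iter N (koopman T) h)))).
- apply: nearW => N; rewrite cnorm_ge0 /=.
  have E : iter N (koopman T) (fun p => c * g p + h p) =
      (fun p => c * iter N (koopman T) g p + iter N (koopman T) h p).
    by rewrite !iter_koopman.
  rewrite E (L2innerDr (L2Z c (LU N Lg)) (LU N Lh) Lf) (L2innerZr c (LU N Lg) Lf).
  by apply: le_trans (cnormD _ _) _; rewrite cnormM cnormJ.
- exact: cvg_cst.
- rewrite -[X in _ --> X](addr0 (0 : R)); apply: cvgD; last exact: dh.
  by rewrite -[X in _ --> X](mulr0 (cnorm c)); apply: cvgMr; exact: dg.
Qed.

Lemma decorrelates_closed g : L2 P g -> (forall e : R, 0 < e ->
  exists2 h, decorrelates h & L2norm P (fun p => g p - h p) < e) -> decorrelates g.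
Proof.
move=> Lg hg; split=> // f Kf; have [Lf _] := Kf.
apply: cvg0_approx => [N|e e0]; first exact: cnorm_ge0.
have f1 : 0 < L2norm P f + 1 by rewrite ltr_wpDl ?L2norm_ge0.
have [h [Lh dh] gh] := hg _ (divr_gt0 e0 f1).
exists (fun N => cnorm (L2inner P f (iter N (koopman T) h))); split; first exact: dh.
move=> N; have Lgh := L2B Lg Lh.
have -> : iter N (koopman T) g = (fun p => iter N (koopman T) h p +
    iter N (koopman T) (fun p => g p - h p) p).
  by rewrite !iter_koopman; apply/funext => p /=; rewrite addrC subrK.
rewrite (L2innerDr (LU N Lh) (LU N Lgh) Lf); apply: le_trans (cnormD _ _) _.
rewrite lerD2l; apply: le_trans (cauchy_schwarz Lf (LU N Lgh)) _; rewrite LUnorm//.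
apply: (@le_trans _ _ ((L2norm P f + 1) * (e / (L2norm P f + 1)))).
  by apply: ler_pM; rewrite ?L2norm_ge0 ?lerDl// ltW.
by rewrite mulrC divfK// gt_eqF.
Qed.

Lemma rep_sum_decorrelates u w : L2v muX u -> L2v muX w ->
  (fun N => cnorm (L2inner P (rep u) (iter N (koopman T) (rep w)))) @ \oo --> (0 : R).
Proof.
move=> Lu Lw.
rewrite (_ : (fun N => _) = fun N => cnorm (\sum_k (rep_norm mu m j k)%:C *
    L2inner muX (u k) (transfer N w k))).
  by apply: cvg_cnorm_sum => k; apply: cvg_cnormM; exact: transfer_weak0.
apply/funext => N; rewrite koopman_rep_sum// L2inner_rep_sum//.
by apply: L2v_matop => //; exact: bmx_rho.
Qed.

(** Against a product function the vectors of the isotypic component only see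
    its projection, which is again an element of the component. *)
Lemma tensor_projection (a : borel X -> R[i]) (b : borel (U2 R) -> R[i]) :
  L2 muX a -> bm b -> exists2 w, L2v muX w & forall v, L2v muX v ->
    L2inner P (rep v) (fun p : XU => a p.1 * b p.2) = L2inner P (rep v) (rep w).
Proof.
move=> La bb.
(* orthogonality forces this value of the coefficient of index [k] *)
pose al k := conjc (L2inner mu (fun g => U2_rep_elt m j k g) b) / (rep_norm mu m j k)%:C.
have Lw : L2v muX (fun k x => al k * a x) by move=> k; exact: L2Z.
exists (fun k x => al k * a x) => // v Lv.
rewrite L2inner_rep_sum// /rep_sum L2inner_suml; last 2 first.
- by move=> k; exact: L2_rep_term.
- exact: L2_tensor.
apply: eq_bigr => k _; rewrite L2inner_tensor//; last exact: bm_rep_elt.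
have conjK (z : R[i]) : conjc (conjc z) = z by case: z => x y; rewrite /= opprK.
have conjR (r : R) : conjc (r%:C^-1) = r%:C^-1.
  by rewrite -fmorphV; apply: complex_eqP; rewrite /= ?oppr0.
rewrite (L2innerZr _ La (Lv k)) /al conjcM conjK conjR.
rewrite mulrA [(_)%:C * _]mulrC divfK; first exact: mulrC.
by apply/eqP => /(congr1 Re) /= /eqP; rewrite gt_eqF// rep_norm_gt0.
Qed.

(** Transporting [f] back by the inverse of the Koopman operator, which preserves
    the component, allows to replace the product function by its projection. *)
Lemma tensor_decorrelates (a : borel X -> R[i]) (b : borel (U2 R) -> R[i]) :
  L2 muX a -> bm b -> decorrelates (fun p : XU => a p.1 * b p.2).
Proof.
move=> La bb; have Lab : L2 P (fun p : XU => a p.1 * b p.2) by exact: L2_tensor.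
split=> // f Kf; have [w Lw wE] := tensor_projection La bb.
have [Lu fu] := coordsP Kf; have [Lf _] := Kf; set u := coords muX mu m j f in Lu fu.
have Lr := L2_rep_sum mu m j Lw; have Lru := L2_rep_sum mu m j Lu.
rewrite (_ : (fun N => _) = fun N => cnorm (L2inner P (rep u) (iter N (koopman T) (rep w)))).
  exact: rep_sum_decorrelates.
apply/funext => N; congr cnorm.
rewrite (L2inner_ae Lf Lru (LU N Lab) (LU N Lab) fu (ae_eq_refl _ _ _)).
have LV : L2v muX (transfer_inv N u) by apply: L2v_matop => //; exact: bmx_rho_inv.
have LrV := L2_rep_sum mu m j LV.
have back : rep u = iter N (koopman T) (rep (transfer_inv N u)).
  rewrite koopman_rep_sum//; congr (rep_sum _ _ _).
  by apply/funext => i; apply/funext => x; rewrite transferK.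
have shift g : L2 P g -> L2inner P (rep u) (iter N (koopman T) g) =
    L2inner P (rep (transfer_inv N u)) g.
  move=> Lg; rewrite back !iter_koopman.
  exact: L2inner_preserves (measurable_iter mT N) (preserves_iter N mT pT) _ _ LrV Lg.
by rewrite (shift _ Lab) (shift _ Lr) wE.
Qed.

(** The decorrelating functions form a closed subspace, which contains the
    indicators of the measurable rectangles. *)
Lemma L2_decorrelates g : L2 P g -> decorrelates g.
Proof.
apply: (@total_L2 _ _ _ P decorrelates
  [set A `*` B | A in (@measurable _ (borel X)) & B in (@measurable _ (borel (U2 R)))]).
- by move=> h [].
- split; first exact: L20.
  move=> f [Lf _]; rewrite (_ : (fun N => _) = fun=> 0); first exact: cvg_cst.
  apply/funext => N; have L0 : L2 P (fun=> 0) by exact: L20.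
  rewrite (L2innerC (LU N L0) Lf) L2inner0l ?raddf0 ?cnorm0//; first exact: LU.
  by rewrite iter_koopman; apply: aeW.
- by move=> c f h; exact: decorrelates_lin.
- exact: decorrelates_closed.
- by exists setT => //; exists setT => //; rewrite setXTT.
- move=> _ _ [A mA [B mB <-]] [A' mA' [B' mB' <-]].
  by exists (A `&` A'); [exact: measurableI|exists (B `&` B'); [exact: measurableI|rewrite setXI]].
- by move=> _ [A mA [B mB <-]]; exact: measurableX.
- by move=> A; rewrite measurable_prod_measurableType.
move=> _ [A mA [B mB <-]].
have bA (d : measure_display) (Y : measurableType d) (S : set Y) : measurable S ->
    bm (fun y => (\1_S y : R)%:C).
  move=> mS; split; first by split; [exact: measurable_indic|exact: measurable_cst].
  exists 1 => y; rewrite /cnorm nsqC sqrtr_sqr ger0_norm; last by case/andP: (indic01 (R := R) S y).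
  by case/andP: (indic01 (R := R) S y).
have := tensor_decorrelates (bm_L2 muX (bA _ _ _ mA)) (bA _ _ _ mB).
congr decorrelates; apply/funext => p; rewrite -rmorphM !indicE in_setX.
by case: (p.1 \in A); case: (p.2 \in B); rewrite /= ?mulr1 ?mulr0.
Qed.

End Mixing.

Section MixingSubspace.
Context {R : realType} {d : measure_display} {T : measurableType d}.
Variables (mu : {measure set T -> \bar R}) (S : T -> T).
Hypotheses (mS : measurable_fun setT S) (pS : preserves_measure S mu).

(** The Koopman operator is an isometry, so that the approximation of [f] by a
    finite sum is uniform in the number of iterations. *)
Lemma hilbert_sum_decorrelates (I : eqType) (Q : set I) (K : I -> set (T -> R[i])) g :
  L2 mu g -> (forall i f, K i f -> L2 mu f) ->
  (forall i f, Q i -> K i f ->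
    (fun N => cnorm (L2inner mu f (iter N (koopman S) g))) @ \oo --> (0 : R)) ->
  forall f, hilbert_sum mu Q K f ->
    (fun N => cnorm (L2inner mu f (iter N (koopman S) g))) @ \oo --> (0 : R).
Proof.
move=> Lg KL2 Kd f [Lf fs].
have LU N : L2 mu (iter N (koopman S) g).
  by rewrite iter_koopman; exact: L2_preserves (measurable_iter mS N) (preserves_iter N mS pS) _ Lg.
have LUn N : L2norm mu (iter N (koopman S) g) = L2norm mu g.
  by rewrite iter_koopman; exact: L2norm_preserves (measurable_iter mS N) (preserves_iter N mS pS) _ Lg.
apply: cvg0_approx => [N|e e0]; first exact: cnorm_ge0.
have g1 : 0 < L2norm mu g + 1 by rewrite ltr_wpDl ?L2norm_ge0.
have [s [h [hs fh]]] := fs _ (divr_gt0 e0 g1).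
pose h' i := if i \in s then h i else fun=> 0.
have Lh' i : L2 mu (h' i).
  by rewrite /h'; case: ifP => [/hs[_ /KL2]//|_]; exact: L20.
have hE x : \sum_(i <- s) h i x = \sum_(i <- s) h' i x.
  by apply: eq_big_seq => i si; rewrite /h' si.
have Lsum : L2 mu (fun x => \sum_(i <- s) h' i x) by exact: L2_sum.
exists (fun N => cnorm (\sum_(i <- s) L2inner mu (h' i) (iter N (koopman S) g))); split.
  apply: cvg_cnorm_sum => i; rewrite /h'; case: ifP => [/hs[Qi Ki]|_]; first exact: Kd Ki.
  rewrite (_ : (fun N => _) = fun=> 0); first exact: cvg_cst.
  by apply/funext => N; rewrite L2inner0l ?cnorm0//; [exact: L20|exact: aeW].
move=> N; rewrite -L2inner_suml//.
have -> : f = (fun x => \sum_(i <- s) h' i x + (f x - \sum_(i <- s) h' i x)).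
  by apply/funext => x; rewrite addrC subrK.
have Lr := L2B Lf Lsum.
rewrite (L2innerDl Lsum Lr (LU N)); apply: le_trans (cnormD _ _) _.
rewrite lerD2l; apply: le_trans (cauchy_schwarz Lr (LU N)) _; rewrite LUn.
apply: (@le_trans _ _ (e / (L2norm mu g + 1) * (L2norm mu g + 1))); last by rewrite divfK// gt_eqF.
apply: ler_pM; rewrite ?L2norm_ge0 ?lerDl//; apply: ltW.
by move: fh; congr (L2norm _ _ < _); apply/funext => x; rewrite hE.
Qed.

End MixingSubspace.

Theorem theorem4p5 (R : realType) (n : nat) (X : ptopologicalType)
    (atl : set (chart R n X)) (muX : probability (borel X) R)
    (F : R -> X -> X) (mu : probability (borel (U2 R)) R) (phi : X -> U2 R) :
  smooth_atlas atl ->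
  compact [set: X] -> second_countable (T := X) -> hausdorff_space X ->
  C1_flow atl F -> (forall t : R, preserves_measure (F t : borel X -> borel X) muX) ->
  is_haar mu ->
  C1_to_U2 atl phi ->
  uniquely_ergodic
    (skew_product F phi : borel X * borel (U2 R) -> borel X * borel (U2 R))
    (haar_prod muX mu) ->
  (forall (l : nat) (m : int) (j : 'I_l.+1),
     (forall f g, D_ker_ortho F muX mu phi m j f -> rep_space muX mu m j g ->
        (fun N : nat =>
           L2inner (haar_prod muX mu) f (iter N (koopman (skew_product F phi)) g))
          @ \oo --> (0 : R[i])) /\
     D_ker_ortho F muX mu phi m j =
       if degree F muX mu phi * (2 * m - l%:Z)%:~R != 0
       then rep_space muX mu m j else L2zero (haar_prod muX mu)) /\
  (degree F muX mu phi != 0 -> mixing_in F muX mu phi (H_mix muX mu)).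
Proof.
move=> satl cX scX hX cF Fp haar phiC ue.
have F0 := flow0 cF; have FD := flowD cF.
have Fc t : continuous (F t) by exact: flow_continuous cF t.
have Fm t : measurable_fun setT (F t : borel X -> borel X) by exact: continuous_borel.
have phiC1 a b : flowC1 F (fun x => U2mx (phi x) a b) by exact: C1_to_U2_flowC1 satl cF _ _ _ phiC.
have dense w : L2 muX w -> Hclosure F muX w.
  exact: generator_dense cX scX hX F0 FD (flow_cont cF) Fm Fp w.
have mT := measurable_skew_product cX Fc phiC1.
have pT := ue.1.
set s := degree F muX mu phi.
have meanE l m : 'i * mean F muX mu phi l m = (- (s * (2 * m - l%:Z)%:~R))%:C.
  rewrite /mean -/s -(rmorph_int (real_complex R)).
  by apply: complex_eqP; rewrite !cplxE /=; ring.
have mean0 l m : (mean F muX mu phi l m != 0) = (s * (2 * m - l%:Z)%:~R != 0).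
  have := meanE l m => /(congr1 (fun z => z == 0)).
  by rewrite mulf_eq0 (negPf (neq0Ci _)) /= => ->; rewrite fmorph_eq0 oppr_eq0.
have mixK l m (j : 'I_l.+1) f g : s * (2 * m - l%:Z)%:~R != 0 ->
    rep_space muX mu m j f -> L2 (haar_prod muX mu) g ->
    (fun N => cnorm (L2inner (haar_prod muX mu) f (iter N (koopman (skew_product F phi)) g)))
      @ \oo --> (0 : R).
  rewrite -mean0 => m0 Kf Lg.
  have [_ dg] := L2_decorrelates j cX F0 FD Fc Fm Fp phiC1 dense haar ue m0 Lg.
  exact: dg.
split=> [l m j|s0 f g Hf Lg]; last first.
  apply: cvg_cnorm0; apply: (hilbert_sum_decorrelates mT pT Lg _ _ Hf).
    by move=> i h [].
  move=> [m [l j]] h /= lm Kh; apply: mixK Kh Lg.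
  by rewrite mulf_neq0// intr_eq0 subr_eq0 eq_sym.
rewrite (D_ker_orthoE m j cX F0 FD Fc Fm Fp phiC1 dense haar ue).
rewrite mulf_eq0 (negPf (neq0Ci _)) /= mean0; split=> // f g.
have [s0 Lf [Lg _]|s0 Kf [Lg _]] := eqVneq (s * (2 * m - l%:Z)%:~R) 0.
  have [{}Lf f0] := Lf; rewrite (_ : (fun N => _) = fun=> 0); first exact: cvg_cst.
  apply/funext => N; apply: L2inner0l => //.
  rewrite iter_koopman.
  exact: L2_preserves (measurable_iter mT N) (preserves_iter N mT pT) _ Lg.
by apply: cvg_cnorm0; exact: mixK Kf Lg.
Qed.
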